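(* Fix an integer $k\ge 2$. For every $\varepsilon>0$, as $x\to\infty$, \[ \#\left\{1\le n\le x:\ g_k(n)<\left(\frac{3(k-1)}{\log 12}-\varepsilon\right)\log n\right\}=o(x). \] Equivalently, for every real $c<3(k-1)/\log 12$, one has $g_k(n)\ge c\log n$ for almost all positive integers $n$.
   Context: $\mathbb N=\{1,2,3,\ldots\}$ and $\log$ is the natural logarithm. For a fixed integer $k\ge 2$ and $n\in\mathbb N$, \[ g_k(n)=\max\{a_1+\cdots+a_k-n:\ a_1!\cdots a_k!\mid n!,\ a_i\in\mathbb N\}. \] (The maximum exists: every admissible $a_i$ is at most $n$, and $(1,\ldots,1)$ is admissible.) A statement holds for almost all positive integers if the set of exceptions has asymptotic (natural) density zero. *)

(* Defs.v *)
From mathcomp Require Import all_boot all_order all_algebra.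
From mathcomp Require Import all_classical all_reals all_analysis.
Import Order.TTheory GRing.Theory Num.Theory.
Import numFieldNormedType.Exports.
Set Implicit Arguments.
Unset Strict Implicit.
Unset Printing Implicit Defensive.

Local Open Scope classical_set_scope.
Local Open Scope ring_scope.

Definition admissible (k n : nat) (a : 'I_k -> nat) : bool :=
  [forall i, (0 < a i)%N] && ((\prod_(i < k) (a i)`!)%N %| n`!)%N.

Definition excess (k n : nat) (a : 'I_k -> nat) : int :=
  (\sum_(i < k) a i)%N%:Z - n%:Z.

(* For n >= 1 an admissible tuple has entries at most n, so the maximum may be
   taken over the finite type {ffun 'I_k -> 'I_n.+1}; the base value of the
   iterated maximum is the value at the admissible tuple (1, ..., 1).
   Lemmas g_attained and g_ub check that this is the maximum over all
   admissible tuples. *)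
Definition g (k n : nat) : int :=
  \big[Order.max/excess n (fun _ : 'I_k => 1%N)]_(
      a : {ffun 'I_k -> 'I_n.+1} | admissible n (fun i => a i : nat))
    excess n (fun i => a i : nat).

Lemma g_attained (k n : nat) :
  exists2 a : 'I_k -> nat, admissible n a & g k n = excess n a.
Proof.
rewrite /g; apply: (big_ind (fun z => exists2 a, admissible n a & z = excess n a)).
- exists (fun=> 1%N) => //.
  rewrite /admissible big1 ?dvd1n ?andbT //; exact/forallP.
- move=> x y [a Ha ->] [b Hb ->].
  by case: (leP (excess n a) (excess n b)) => _; [exists b | exists a].
- by move=> a Ha; exists (fun i => a i : nat).
Qed.

Lemma g_ub (k n : nat) (a : 'I_k -> nat) :
  (0 < n)%N -> admissible n a -> excess n a <= g k n.
Proof.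
move=> n0 Ha; have /andP[/forallP a0 adv] := Ha.
have an i : (a i < n.+1)%N.
  rewrite ltnS leqNgt; apply/negP => nai.
  have : ((a i)`! %| n`!)%N by apply: dvdn_trans adv; rewrite (bigD1 i) //= dvdn_mulr.
  move=> /(dvdn_leq (fact_gt0 n)); apply/negP; rewrite -ltnNge.
  have : (n.+1`! <= (a i)`!)%N by apply: leq_fact.
  by apply: leq_trans; rewrite factS ltn_Pmull ?fact_gt0.
pose b : {ffun 'I_k -> 'I_n.+1} := [ffun i => Ordinal (an i)].
have ba : (fun i => b i : nat) = a by apply: funext => i; rewrite ffunE.
rewrite /g -{1}ba; apply: (@le_bigmax_cond _ _ _ _ b) => //.
by rewrite ba.
Qed.

(* The library does not register +oo as a filter usable with the =o_ notation. *)
Canonical pinfty_filter_on (R : numFieldType) : filter_on R :=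
  FilterType (pinfty_nbhs R) _.

(* #{1 <= n <= x : P n}; for x < 0 the truncation is 0 and the range is empty *)
Definition count_upto (R : realType) (P : pred nat) (x : R) : nat :=
  count P (index_iota 1 (Num.truncn x).+1).

(* R is the model of the reals in which the quotients converge. *)
Definition has_density0 (R : realType) (P : pred nat) : Prop :=
  ((count P (index_iota 1 N.+1))%:R / N%:R : R) @[N --> \oo] --> (0 : R).

Definition almost_all (R : realType) (P : pred nat) : Prop :=
  has_density0 R (predC P).

(* Main.v *)
Require Import Defs.
From mathcomp Require Import all_boot all_order all_algebra.
From mathcomp Require Import all_classical all_reals all_analysis.
From mathcomp Require Import zify ring lra.
Import Order.TTheory GRing.Theory Num.Theory.
Import numFieldNormedType.Exports.
Set Implicit Arguments.
Unset Strict Implicit.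
Unset Printing Implicit Defensive.

(** Let m = k - 1.  Take a_1 = ... = a_m = a and a_k = N - m a with N = n + D, so
    that the excess is D.  By Legendre's formula the divisibility asks, for every
    prime p, that the carries in the m successive subtractions of a from N, in base
    p, number at least the valuation of (n+1)...(n+D), which is about D/(p-1)
    ([factorial_product_dvd], [window_valuation_le]).  For random N a carry at p^j
    occurs with probability (a mod p^j)/p^j, so the carries should number about
    m f_p(a), where f_p(a) is the sum of these fractions over p^j <= a.

    For n about 2^r and a of nearly the same size, a typical a has fractions of mean
    1/2, and p = 2 is the bottleneck.  But an a slightly below multiples of large
    powers of 2 has fractions near 1 for p = 2.  Spend the top proportion al of the
    scales on 2 in this way and the remaining ones on 3, keeping mean 1/2 for the
    other prime.  Then f_2 is about (1+al)/2 r and f_3 about (2-al)/2 r ln 2/ln 3,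
    and the conditions D <= m (p-1) f_p(a) for p = 2, 3 coincide when
    (1+al)/2 = tau = 3 ln 2/ln 12.  Primes p >= 5 with mean 1/2 ask for less, because
    p^6 <= 12^(p-1) ([digit_weight_bound]).  Thus D can be almost m tau r, and
    log n is about r ln 2, which gives the constant 3 (k-1)/ln 12.

    To build such an a ([structured_summand]), descend along the powers of l = 2^S,
    and then of l = 3^S, subtracting c l^b with a free digit c < C at each scale.
    For a prime p not dividing l, the fraction of l^b/p^j is rarely close to a
    rational with small denominator, since log l/log p is irrational
    ([near_pairs_rare]); away from such b the choice of c averages the residue modulo
    p^j to half of p^j ([block_average]).  A quadratic potential chooses the digits
    for all p below a constant at once ([greedy_potential], [greedy_descent]).

    Finally a is varied below the structured number within an interval of length
    2^(r/d), and pairs of a random n and a random such a are considered.  Primes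
    below a constant are handled by Chebyshev's inequality for the carries of n
    ([carries_concentrate]); primes up to about r^4 by an exponential bound that
    uses the randomness of both numbers ([few_carries_rare]); for larger primes
    carries appear for free unless a has a small residue modulo a prime factor of
    some n + i with i <= D, which is rare ([large_residues_fail_rare]).  All
    failures together have proportion O(1/r) among the pairs, hence among the n in a
    dyadic block ([dyadic_bad_count], [dyadic_failure_bound]), and summing over the
    blocks gives density zero. *)

(** * Legendre's formula and carries *)

(** The event that subtracting [a] from [N] borrows across the digit position of
    [Q], written without subtraction. *)
Definition carry (Q N a : nat) : bool := N %% Q < a %% Q.

Lemma divn_carry Q N a : 0 < Q -> a <= N ->
  N %/ Q = a %/ Q + (N - a) %/ Q + carry Q N a.
Proof.
move=> Q0 aN; rewrite /carry divnB //.
have := leq_div2r Q aN.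
case: ltnP => // h; last lia.
have: N %/ Q <> a %/ Q -> a %/ Q < N %/ Q by have := leq_div2r Q aN; lia.
case: (N %/ Q =P a %/ Q) => [e|ne /(_ ne)]; last lia.
by move: aN; rewrite (divn_eq N Q) (divn_eq a Q) e leq_add2l leqNgt h.
Qed.

Lemma divn_carries Q m N a : 0 < Q -> m * a <= N ->
  N %/ Q = m * (a %/ Q) + (N - m * a) %/ Q
           + \sum_(i < m) carry Q (N - i * a) a.
Proof.
move=> Q0; elim: m => [|m IH] le_maN.
  by rewrite big_ord0 !mul0n subn0 addn0.
rewrite big_ord_recr /= IH; last by apply: leq_trans le_maN; rewrite leq_mul2r leqnSn orbT.
have aN : a <= N - m * a by move: le_maN; rewrite mulSn; lia.
rewrite (divn_carry Q0 aN) !mulSnr subnDA.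
move: (nat_of_bool (carry Q (N - m * a) a)) (\sum_(i < m) _) => x y; lia.
Qed.

Lemma divn_extend p n J : n < J -> 1 < p ->
  \sum_(1 <= j < J) n %/ p ^ j = \sum_(1 <= j < n.+1) n %/ p ^ j.
Proof.
move=> nJ p1; rewrite (@big_cat_nat _ _ _ n.+1) //=.
rewrite [X in _ + X]big_nat_cond [X in _ + X]big1 ?addn0 // => j.
rewrite andbT => /andP[nj _]; rewrite divn_small //.
by apply: (leq_trans nj); rewrite ltnW // ltn_expl.
Qed.

(** Legendre's formula: the p-adic valuation of the multinomial coefficient
    N!/(a!^m (N - m a)!), N = n + D, is its number of carries, so N! may lose
    the factor N!/n! whenever these carries pay for it prime by prime. *)
Lemma factorial_product_dvd m n D a : 0 < a ->
  m * a < n + D ->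
  (forall p, prime p ->
     \sum_(1 <= j < (n + D).+1) ((n + D) %/ p ^ j - n %/ p ^ j) <=
     \sum_(1 <= j < (n + D).+1) \sum_(i < m) carry (p ^ j) (n + D - i * a) a) ->
  a`! ^ m * (n + D - m * a)`! %| n`!.
Proof.
move=> a0 maN H; have fp := fact_gt0.
have L0 : 0 < a`! ^ m * (n + D - m * a)`! by rewrite muln_gt0 expn_gt0 !fp.
apply/dvdn_partP => // p; rewrite mem_primes => /and3P[pp _ _].
rewrite p_part pfactor_dvdn //.
rewrite lognM ?expn_gt0 ?fp // lognX !logn_fact //.
have p1 := prime_gt1 pp.
set N := n + D in H maN *; have nN : n <= N by rewrite leq_addr.
have [/eqP m0|m0] := boolP (m == 0).
  rewrite m0 !mul0n subn0 add0n in H *.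
  have := H p pp; under [X in _ <= X]eq_bigr do rewrite big_ord0.
  rewrite sum_nat_const_nat muln0 leqn0 => h.
  rewrite -(@divn_extend p n N.+1) ?ltnS //.
  rewrite !big_nat; apply: leq_sum => j /andP[j1 jN].
  rewrite -subn_eq0; move: h; rewrite sum_nat_seq_eq0.
  by move/allP/(_ j); apply; rewrite mem_index_iota j1.
have aN : a < N by apply: leq_ltn_trans maN; rewrite leq_pmull // lt0n.
rewrite -(@divn_extend p a N.+1) ?(ltnW aN) //; last by rewrite ltnW.
rewrite -(@divn_extend p (N - m * a) N.+1) ?ltnS ?leq_subr //.
rewrite -(@divn_extend p n N.+1) ?ltnS //.
have Hs : \sum_(1 <= j < N.+1) N %/ p ^ j =
   m * (\sum_(1 <= j < N.+1) a %/ p ^ j) + \sum_(1 <= j < N.+1) (N - m * a) %/ p ^ j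
   + \sum_(1 <= j < N.+1) \sum_(i < m) carry (p ^ j) (N - i * a) a.
  rewrite big_distrr /= -!big_split /=; apply: eq_bigr => j _.
  by apply: divn_carries; rewrite ?expn_gt0 ?(ltnW p1) // ltnW.
have Hd : \sum_(1 <= j < N.+1) N %/ p ^ j = \sum_(1 <= j < N.+1) n %/ p ^ j +
    \sum_(1 <= j < N.+1) (N %/ p ^ j - n %/ p ^ j).
  by rewrite -big_split /=; apply: eq_bigr => j _; rewrite subnKC // leq_div2r.
have := H p pp; move: Hs Hd.
move: (\sum_(1 <= j < _) (N %/ p ^ j)) (\sum_(1 <= j < _) (n %/ p ^ j))
  (\sum_(1 <= j < _) (a %/ p ^ j)) (\sum_(1 <= j < _) ((N - m * a) %/ p ^ j))
  (\sum_(1 <= j < _) (N %/ p ^ j - n %/ p ^ j))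
  (\sum_(1 <= j < N.+1) \sum_(i < m) _) => *.
lia.
Qed.

Lemma sum_divn_geometric p E D : 0 < p ->
  p.-1 * (\sum_(1 <= j < E.+1) D %/ p ^ j) + D %/ p ^ E <= D.
Proof.
move=> p0; elim: E => [|E IH]; first by rewrite big_geq // muln0 expn0 divn1.
rewrite big_nat_recr //= mulnDr -addnA -mulSnr prednK //.
apply: leq_trans IH; rewrite leq_add2l expnSr divnMA mulnC.
exact: leq_divM.
Qed.

Lemma divn_window p n D : 0 < p -> (n + D) %/ p - n %/ p <= D %/ p + 1.
Proof. by move=> p0; rewrite leq_subLR addnA leq_divDl. Qed.

Lemma divn_window0 p n D : 0 < p ->
  (forall i, 0 < i <= D -> ~~ (p %| n + i)) -> (n + D) %/ p = n %/ p.
Proof.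
move=> p0; elim: D => [|D IH] H; first by rewrite addn0.
rewrite addnS divnS // IH; last by move=> i /andP[i0 iD]; apply: H; rewrite i0 leqW.
by have /negbTE := H D.+1 (leqnn _); rewrite addnS => ->.
Qed.

(** A window of length D holds at most D/p^j + 1 multiples of p^j, and none for
    j > E by hypothesis; the main term D/(p-1) bounds the valuation of D!. *)
Lemma window_valuation_le p n D E J : 1 < p ->
  (forall i, 0 < i <= D -> ~~ (p ^ E.+1 %| n + i)) ->
  p.-1 * (\sum_(1 <= j < J) ((n + D) %/ p ^ j - n %/ p ^ j)) <= D + p.-1 * E.
Proof.
move=> p1 H; have p0 := ltnW p1.
have pe j : 0 < p ^ j by rewrite expn_gt0 p0.
apply: (@leq_trans (p.-1 * (\sum_(1 <= j < E.+1) (D %/ p ^ j + 1)))); last first.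
  rewrite big_split /= mulnDr sum_nat_const_nat subn1 muln1 leq_add2r.
  by apply: leq_trans (sum_divn_geometric E D p0); rewrite leq_addr.
rewrite leq_mul2l; apply/orP; right.
have zero j : E < j -> (n + D) %/ p ^ j - n %/ p ^ j = 0.
  move=> Ej; rewrite divn_window0 ?subnn // => i iD.
  by apply: contra (H i iD); apply: dvdn_trans; rewrite dvdn_exp2l.
have [JE|EJ] := leqP J E.+1.
  apply: (@leq_trans (\sum_(1 <= j < J) (D %/ p ^ j + 1))).
    by apply: leq_sum => j _; apply: divn_window.
  case: (leqP 1 J) => J1; last by rewrite big_geq // ltnW.
  by rewrite [X in _ <= X](big_cat_nat J1 JE) leq_addr.
rewrite (@big_cat_nat _ _ _ E.+1) //=; last by rewrite ltnW.
rewrite [X in _ + X]big_nat_cond [X in _ + X]big1 ?addn0.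
  by apply: leq_sum => j _; apply: divn_window.
by move=> j /andP[/andP[Ej _] _]; apply: zero.
Qed.

(** Here p > D, so the window holds at most one multiple of p^j, and if it does
    then n + D is congruent to a number below D modulo p^j: the residue of [a]
    exceeds it and the carry comes for free. *)
Lemma carry_of_window_multiple p j n D a : 0 < p -> 0 < j ->
  D <= a %% p -> (n + D) %/ p ^ j - n %/ p ^ j <= carry (p ^ j) (n + D) a.
Proof.
move=> p0 j0 Da.
have pj : 0 < p ^ j by rewrite expn_gt0 p0.
have Dpj : a %% p <= a %% p ^ j.
  rewrite -(@modn_dvdm (p ^ j) a p) ?leq_mod //.
  by rewrite -(prednK j0) expnS dvdn_mulr.
have Dltp : D < p ^ j.
  by apply: leq_ltn_trans (leq_trans Da Dpj) _; rewrite ltn_mod.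
have := divn_window n D pj; rewrite (divn_small Dltp) add0n => le1.
have [->//|/eqP ne0] := eqVneq ((n + D) %/ p ^ j - n %/ p ^ j) 0.
suff -> : carry (p ^ j) (n + D) a by [].
rewrite /carry; apply: leq_trans Dpj; apply: leq_trans Da.
rewrite ltnNge; apply/negP => h.
have e := divn_eq (n + D) (p ^ j).
apply: ne0; apply/eqP; rewrite subn_eq0 leq_divRL //.
move: e h; lia.
Qed.

(** * Sums over residues *)

Lemma sum_full_period (f : nat -> nat) Q s : 0 < Q ->
  \sum_(i < Q) f ((s + i) %% Q) = \sum_(i < Q) f i.
Proof.
move=> Q0; elim: s => [|s IH].
  by apply: eq_bigr => i _; rewrite add0n modn_small.
rewrite -IH; case: Q Q0 {IH} => // Q _.
rewrite big_ord_recr /= [in RHS]big_ord_recl /= addn0 addnC.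
congr (_ + _); first by rewrite addSnnS modnDr.
by apply: eq_bigr => i _; rewrite /bump /= add1n addSnnS.
Qed.

Lemma sum_periods (f : nat -> nat) Q s q : 0 < Q ->
  \sum_(i < q * Q) f ((s + i) %% Q) = q * \sum_(i < Q) f i.
Proof.
move=> Q0; elim: q => [|q IH]; first by rewrite !mul0n big_ord0.
rewrite !mulSn big_split_ord /=; congr (_ + _); first exact: sum_full_period.
by rewrite -IH; apply: eq_bigr => i _ /=; rewrite addnCA modnDl.
Qed.

Lemma leq_sum_ord (f : nat -> nat) m n : m <= n ->
  \sum_(i < m) f i <= \sum_(i < n) f i.
Proof. by move=> mn; rewrite -(subnKC mn) big_split_ord /= leq_addr. Qed.

Lemma sum_residues_le (f : nat -> nat) Q s X : 0 < Q ->
  \sum_(i < X) f ((s + i) %% Q) <= (X %/ Q).+1 * \sum_(i < Q) f i.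
Proof.
move=> Q0; rewrite -(sum_periods f s _ Q0).
by apply: (leq_sum_ord (fun i => f ((s + i) %% Q))); rewrite ltnW // ltn_ceil.
Qed.

Lemma leq_exp_base m n e : m <= n -> m ^ e <= n ^ e.
Proof. by case: e => // e; rewrite leq_exp2r. Qed.

Lemma sum_ltn_ord Q b : b <= Q -> \sum_(i < Q) (i < b) = b.
Proof.
move=> bQ; rewrite -(subnKC bQ) big_split_ord /=.
rewrite [X in _ + X]big1 ?addn0; last by move=> i _; rewrite ltnNge leq_addr.
by under eq_bigr => i _ do rewrite ltn_ord; rewrite sum_nat_const card_ord muln1.
Qed.

Lemma sum_ord_restrict (F : nat -> nat) Q b : b <= Q ->
  \sum_(i < Q) F i * (i < b) = \sum_(i < b) F i.
Proof.
move=> bQ; rewrite -(subnKC bQ) big_split_ord /=.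
rewrite [X in _ + X]big1 ?addn0; last by move=> i _; rewrite ltnNge leq_addr muln0.
by apply: eq_bigr => i _; rewrite ltn_ord muln1.
Qed.

(** * Few carries between random numbers *)

Definition carries p w N a := \sum_(1 <= j < w.+1) carry (p ^ j) N a.

(** A lower bound for the number of carries whose contributions at different
    digit positions are independent. *)
Fixpoint digit_dominations p w N a : nat :=
  if w is w'.+1 then (N %% p < a %% p) + digit_dominations p w' (N %/ p) (a %/ p)
  else 0.

Lemma digit_dominations_le p w N a : digit_dominations p w N a <= w.
Proof.
by elim: w N a => //= w IH N a; have := IH (N %/ p) (a %/ p); case: (_ < _) => /=; lia.
Qed.

Lemma carry_shift p j N a : 0 < p ->
  carry (p ^ j) (N %/ p) (a %/ p) <= carry (p ^ j.+1) N a.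
Proof.
move=> p0; rewrite /carry; case: ltnP => //= h.
have e x : x %% p ^ j.+1 = (x %/ p) %% p ^ j * p + x %% p.
  by rewrite modn_divl -expnSr {1}(divn_eq (x %% p ^ j.+1) p) modn_dvdm // expnS dvdn_mulr.
suff -> : N %% p ^ j.+1 < a %% p ^ j.+1 by [].
rewrite !e; apply: (@leq_trans (((N %/ p) %% p ^ j).+1 * p)).
  by rewrite mulSn addnC -addSn leq_add2r ltn_mod.
by apply: leq_trans (leq_addr _ _); rewrite leq_mul2r h orbT.
Qed.

Lemma digit_dominations_carries p w N a : 0 < p ->
  digit_dominations p w N a <= carries p w N a.
Proof.
move=> p0; elim: w N a => [|w IH] N a //.
rewrite /carries big_nat_recl //= expn1 leq_add //.
apply: leq_trans (IH _ _) _; rewrite /carries big_add1 /=.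
rewrite big_add1 /=; apply: leq_sum => j _; exact: carry_shift.
Qed.

Lemma sum_digits (F : nat -> nat -> nat) p w : 0 < p ->
  \sum_(N < p ^ w.+1) F (N %% p) (N %/ p) =
  \sum_(d < p) \sum_(N < p ^ w) F d N.
Proof.
move=> p0; rewrite exchange_big /= expnSr.
elim: (p ^ w) => [|q IH]; first by rewrite big_ord0 big_ord0.
rewrite big_ord_recr /= -IH mulSn addnC big_split_ord /=; congr (_ + _).
by apply: eq_bigr => d _; rewrite modnMDl modn_small // divnMDl // divn_small // addn0.
Qed.

(** The mean of 4^(-X), X the number of dominations, cleared of denominators. *)
Definition domination_weight p w :=
  \sum_(N < p ^ w) \sum_(a < p ^ w) 4 ^ (w - digit_dominations p w N a).

Lemma domination_weightS p w : 0 < p ->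
  domination_weight p w.+1 =
  (\sum_(d < p) \sum_(e < p) 4 ^ (1 - (d < e))) * domination_weight p w.
Proof.
move=> p0; rewrite /domination_weight.
have split4 d e N a : 4 ^ (w.+1 - ((d < e) + digit_dominations p w N a)) =
    4 ^ (1 - (d < e)) * 4 ^ (w - digit_dominations p w N a).
  rewrite -expnD; congr (4 ^ _).
  by have := digit_dominations_le p w N a; case: (d < e) => /=; lia.
under eq_bigr => N _.
  rewrite (@sum_digits (fun e a => 4 ^ (w.+1 -
     ((N %% p < e) + digit_dominations p w (N %/ p) a)))) //.
  over.
rewrite (@sum_digits (fun d N => \sum_(e < p) \sum_(a < p ^ w)
   4 ^ (w.+1 - ((d < e) + digit_dominations p w N a)))) //.
rewrite big_distrl /=; apply: eq_bigr => d _.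
under eq_bigr => N _.
  under eq_bigr => e _.
    under eq_bigr => a _ do rewrite split4.
    rewrite -big_distrr /=; over.
  rewrite -big_distrl /=; over.
by rewrite big_distrr.
Qed.

(** For one digit the mean of 4^(-X) is (5 + 3/p)/8, which is at most 7/10 from
    p = 5 on. *)
Lemma one_digit_weight_le p : 5 <= p ->
  10 * (\sum_(d < p) \sum_(e < p) 4 ^ (1 - (d < e))) <= 28 * p ^ 2.
Proof.
move=> p5.
have -> : \sum_(d < p) \sum_(e < p) 4 ^ (1 - (d < e)) =
   \sum_(d < p) (p + 3 * d.+1).
  apply: eq_bigr => d _.
  have -> : \sum_(e < p) 4 ^ (1 - (d < e)) = \sum_(e < p) (1 + 3 * (e < d.+1)).
    by apply: eq_bigr => e _; rewrite ltnS; case: ltnP.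
  rewrite big_split /= sum_nat_const card_ord muln1 -big_distrr /= sum_ltn_ord //.
rewrite big_split /= sum_nat_const card_ord -big_distrr /=.
have : \sum_(i < p) i.+1 * 2 = p * p.+1.
  by elim: (p) => [|q IH]; rewrite ?big_ord0 // big_ord_recr /= IH; lia.
rewrite -big_distrl /=; move: (\sum_(i < p) _) => x; nia.
Qed.

Lemma domination_weight_le p w : 5 <= p ->
  10 ^ w * domination_weight p w <= 28 ^ w * (p ^ w * p ^ w).
Proof.
move=> p5; elim: w => [|w IH].
  by rewrite /domination_weight !big_ord_recr !big_ord0.
rewrite domination_weightS; last by lia.
have := leq_mul (one_digit_weight_le p5) IH.
rewrite !expnS; move: (\sum_(d < p) _) (domination_weight p w) => x y.
move: (10 ^ w) (28 ^ w) (p ^ w) => u v t; rewrite expn0.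
rewrite !mulnA; congr (_ <= _); lia.
Qed.

(** Chernoff's method: the mean of 4^(-X) is at most (7/10)^w, so X < w/10 has
    probability at most (4^(1/10) 7/10)^w, and 4 * 8 * 7^10 <= 10^10. *)
Lemma few_carries_rare p w M : 5 <= p -> M <= w %/ 10 ->
  8 ^ (w %/ 10) * (\sum_(N < p ^ w) \sum_(a < p ^ w) (carries p w N a < M))
    <= p ^ w * p ^ w.
Proof.
move=> p5 Mw; set T := \sum_(N < p ^ w) _.
have step1 : 4 ^ w * T <= 4 ^ M * domination_weight p w.
  rewrite /T /domination_weight !big_distrr /=; apply: leq_sum => N _.
  rewrite !big_distrr /=; apply: leq_sum => a _.
  case: ltnP => /= h; last by rewrite muln0.
  rewrite muln1 -expnD leq_exp2l //.
  have := @digit_dominations_carries p w N a.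
  have := digit_dominations_le p w N a; lia.
have step2 : (40 ^ w) * T <= 4 ^ M * (28 ^ w * (p ^ w * p ^ w)).
  rewrite (_ : 40 = 10 * 4) // expnMn -mulnA.
  apply: leq_trans (_ : 10 ^ w * (4 ^ M * domination_weight p w) <= _).
    by rewrite leq_mul2l step1 orbT.
  by rewrite mulnCA leq_mul2l domination_weight_le ?orbT.
have step3 : 8 ^ (w %/ 10) * (4 ^ M * 28 ^ w) <= 40 ^ w.
  apply: leq_trans (_ : 8 ^ (w %/ 10) * (4 ^ (w %/ 10) * 28 ^ w) <= _).
    by rewrite leq_mul2l leq_mul2r leq_exp2l // Mw !orbT.
  rewrite {3 4}(divn_eq w 10) !expnD [_ * 10]mulnC !expnM !mulnA -!expnMn.
  apply: leq_mul; last by rewrite leq_exp_base.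
  by apply: leq_exp_base; rewrite !expnS expn0; lia.
have p40 : 0 < 40 ^ w by rewrite expn_gt0.
have h2 := leq_mul (leqnn (8 ^ (w %/ 10))) step2.
suff : 40 ^ w * (8 ^ (w %/ 10) * T) <= 40 ^ w * (p ^ w * p ^ w) by rewrite leq_pmul2l.
rewrite mulnCA; apply: leq_trans h2 _.
by move: step3; move: (p ^ w * p ^ w) => V h; rewrite !mulnA leq_mul2r -(mulnA (8 ^ _)) h orbT.
Qed.

(** * Rare divisibility events *)

Lemma has_sum (T : eqType) (P : pred T) s : has P s <= \sum_(x <- s) P x.
Proof.
elim: s => [|x s IH]; first by rewrite big_nil.
by rewrite big_cons /=; case: (P x) => //=; rewrite add0n.
Qed.

Lemma sum_multiples_le q s X : 0 < q ->
  \sum_(i < X) (q %| s + i) <= (X %/ q).+1.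
Proof.
move=> q0; rewrite /dvdn.
apply: leq_trans (sum_residues_le (fun r => r == 0 : nat) s X q0) _.
case: q q0 => // q _; rewrite big_ord_recl /= big1 ?addn0 ?muln1 //.
Qed.

Definition divisible_window q D n := has (fun i => q %| n + i) (index_iota 1 D.+1).

Lemma divisible_window_rare q D s X : 0 < q ->
  \sum_(i < X) divisible_window q D (s + i) <= D * (X %/ q).+1.
Proof.
move=> q0.
apply: leq_trans (_ : \sum_(i < X) \sum_(1 <= l < D.+1) (q %| s + i + l) <= _).
  by apply: leq_sum => i _; apply: has_sum.
rewrite exchange_big /=.
apply: leq_trans (_ : \sum_(1 <= l < D.+1) (X %/ q).+1 <= _).
  apply: leq_sum => l _; apply: leq_trans (sum_multiples_le (s + l) X q0).
  by apply: leq_sum => i _; rewrite addnAC.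
by rewrite sum_nat_const_nat subn1.
Qed.

Lemma size_primes_exp m : 0 < m -> 2 ^ size (primes m) <= m.
Proof.
move=> m0; rewrite {2}(prod_prime_decomp m0) /primes size_map /unzip1.
have : all (fun f => (1 < f.1) && (0 < f.2)) (prime_decomp m).
  by apply/allP => -[p e] /mem_prime_decomp[/prime_gt1 p1 e0 _]; rewrite p1.
elim: (prime_decomp m) => [|[p e] s IH] /=; first by rewrite big_nil.
case/andP => /andP[p1 e0] /IH h; rewrite big_cons expnS leq_mul //=.
apply: (leq_trans p1); rewrite -{1}(expn1 p) leq_pexp2l //.
by case: (p) p1.
Qed.

Definition large_residues Y D n a :=
  all (fun i => all (fun p => (Y < p) ==> (D <= a %% p)) (primes (n + i)))
      (index_iota 1 D.+1).

(** Union bound over the prime factors p > Y of the numbers in the window: each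
    excludes D residues modulo p out of more than Y. *)
Lemma large_residues_fail_rare Y D n A Z s : 0 < Y ->
  (forall i, 0 < i <= D -> size (primes (n + i)) <= s) ->
  \sum_(z < Z) ~~ large_residues Y D n (A + z) <= D * (s * ((Z %/ Y).+1 * D)).
Proof.
move=> Y0 Hs.
apply: leq_trans (_ : \sum_(z < Z) \sum_(1 <= i < D.+1) \sum_(p <- primes (n + i))
   ((Y < p) && ((A + z) %% p < D)) <= _).
  apply: leq_sum => z _; rewrite /large_residues -has_predC.
  apply: leq_trans (has_sum _ _) _; apply: leq_sum => i _.
  rewrite /= -has_predC; apply: leq_trans (has_sum _ _) _; apply: leq_sum => p _.
  by rewrite /= negb_imply -ltnNge.
rewrite exchange_big /=.
apply: leq_trans (_ : \sum_(1 <= i < D.+1) s * ((Z %/ Y).+1 * D) <= _); last first.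
  by rewrite sum_nat_const_nat subn1.
rewrite !big_nat; apply: leq_sum => i iD; rewrite exchange_big /=.
apply: leq_trans (_ : \sum_(p <- primes (n + i)) ((Z %/ Y).+1 * D) <= _).
  apply: leq_sum => p _; have [Yp|_] /= := ltnP Y p; last by rewrite big1.
  have p0 : 0 < p by apply: leq_trans Yp.
  apply: leq_trans (sum_residues_le (fun r => r < D : nat) A Z p0) _.
  apply: leq_mul; first by rewrite ltnS leq_div2l // ltnW.
  have [Dp|pD] := leqP D p; first by rewrite sum_ltn_ord.
  apply: leq_trans (_ : \sum_(i < p) 1 <= _); last by rewrite sum1_card card_ord ltnW.
  by apply: leq_sum => r _; case: (_ < _).
by rewrite big_const_seq count_predT iter_addn_0 mulnC leq_mul2r Hs ?orbT.
Qed.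

(** * Sufficient conditions for divisibility *)

(** Primes above [Y] are served by free carries; for the others the hypothesis on
    the carries is spread evenly over the [m] subtractions of [a], the error term
    E of the window valuation being paid by each of them. *)
Lemma good_pair_dvd m n D1 a Y E : 0 < m -> 0 < a -> m * a < n + m * D1 ->
  (forall p, prime p -> p <= Y -> ~~ divisible_window (p ^ E.+1) (m * D1) n) ->
  large_residues Y (m * D1) n a ->
  (forall p, prime p -> p <= Y -> exists2 w, w <= n + m * D1 &
    forall l, l < m -> D1 + p.-1 * E <= p.-1 * carries p w (n + m * D1 - l * a) a) ->
  a`! ^ m * (n + m * D1 - m * a)`! %| n`!.
Proof.
move=> m0 a0 maN H1 H2 H3; apply: factorial_product_dvd => // p pp.
set D := m * D1 in maN H1 H2 H3 *; set N := n + D in maN H3 *.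
have p1 := prime_gt1 pp; have p0 := ltnW p1.
have [pY|Yp] := leqP p Y.
  have [w wN Hw] := H3 p pp pY.
  have W : p.-1 * (\sum_(1 <= j < N.+1) (N %/ p ^ j - n %/ p ^ j)) <= D + p.-1 * E.
    apply: window_valuation_le => // i iD; apply: contra (H1 p pp pY) => h.
    by apply/hasP; exists i; rewrite // mem_index_iota ltnS.
  have p10 : 0 < p.-1 by rewrite -ltnS prednK.
  rewrite -(leq_pmul2l p10); apply: (leq_trans W).
  rewrite exchange_big /=.
  apply: (@leq_trans (p.-1 * \sum_(l < m) carries p w (N - l * a) a)); last first.
    rewrite leq_mul2l; apply/orP; right; apply: leq_sum => l _.
    rewrite /carries [leqRHS](@big_cat_nat _ _ _ w.+1) //=; exact: leq_addr.
  rewrite big_distrr /=.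
  apply: (@leq_trans (\sum_(l < m) (D1 + p.-1 * E))).
    rewrite sum_nat_const card_ord mulnDr leq_add2l.
    by rewrite leq_pmull.
  by apply: leq_sum => l _; apply: Hw.
rewrite !big_nat; apply: leq_sum => j /andP[j0 _].
have pj : 0 < p ^ j by rewrite expn_gt0 p0.
have [/hasP[i]|/hasPn no] := boolP (has (fun i => p %| n + i) (index_iota 1 D.+1)).
  rewrite mem_index_iota ltnS => iD pni.
  have Da : D <= a %% p.
    have ii : i \in index_iota 1 D.+1 by rewrite mem_index_iota ltnS.
    have /allP/(_ p) := allP H2 i ii.
    rewrite mem_primes pp pni addn_gt0 (_ : 0 < i) ?orbT; last by case/andP: iD.
    by rewrite Yp => /(_ isT).
  apply: leq_trans (carry_of_window_multiple n p0 j0 Da) _.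
  by rewrite (bigD1 (Ordinal m0)) //= mul0n subn0 leq_addr.
rewrite divn_window0 ?subnn // => i iD; apply: contra (no i _).
  by apply: dvdn_trans; rewrite -(prednK j0) expnS dvdn_mulr.
by rewrite mem_index_iota ltnS.
Qed.

Lemma carries_mod p w N a : carries p w N a = carries p w (N %% p ^ w) (a %% p ^ w).
Proof.
rewrite /carries !big_nat; apply: eq_bigr => j /andP[_ jw].
by rewrite /carry !modn_dvdm ?dvdn_exp2l.
Qed.

(** The corner b and the shifts S z are arbitrary since [p ^ w]-periodicity
    reduces every rectangle to at most 4 X Z / p^(2w) full squares of residues. *)
Lemma few_carries_pairs p w M X Z b (S : nat -> nat) : 5 <= p -> M <= w %/ 10 ->
  p ^ w <= X -> p ^ w <= Z ->
  8 ^ (w %/ 10) * (\sum_(z < Z) \sum_(i < X) (carries p w (S z + i) (b + z) < M))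
    <= 4 * (X * Z).
Proof.
move=> p5 Mw QX QZ; have Q0 : 0 < p ^ w by rewrite expn_gt0; case: (p) p5.
pose h a := \sum_(N < p ^ w) (carries p w N a < M).
have step1 z : \sum_(i < X) (carries p w (S z + i) (b + z) < M) <=
    (X %/ p ^ w).+1 * h ((b + z) %% p ^ w).
  have := sum_residues_le (fun r => carries p w r ((b + z) %% p ^ w) < M : nat) (S z) X Q0.
  by apply: leq_trans; apply: leq_sum => i _; rewrite carries_mod.
have step2 : \sum_(z < Z) \sum_(i < X) (carries p w (S z + i) (b + z) < M) <=
   (X %/ p ^ w).+1 * ((Z %/ p ^ w).+1 * \sum_(a < p ^ w) h a).
  apply: leq_trans (_ : \sum_(z < Z) (X %/ p ^ w).+1 * h ((b + z) %% p ^ w) <= _).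
    by apply: leq_sum => z _; apply: step1.
  by rewrite -big_distrr /= leq_mul2l (sum_residues_le h b Z Q0) orbT.
have step3 : 8 ^ (w %/ 10) * (\sum_(a < p ^ w) h a) <= p ^ w * p ^ w.
  by rewrite /h exchange_big /=; apply: few_carries_rare.
have dbl Q V : 0 < Q -> Q <= V -> (V %/ Q).+1 * Q <= 2 * V.
  by move=> Q0' QV; rewrite mulSn; have := leq_divM V Q; lia.
have dX := dbl _ _ Q0 QX; have dZ := dbl _ _ Q0 QZ.
apply: leq_trans (_ : 8 ^ (w %/ 10) *
  ((X %/ p ^ w).+1 * ((Z %/ p ^ w).+1 * \sum_(a < p ^ w) h a)) <= _).
  by rewrite leq_mul2l step2 orbT.
apply: leq_trans (_ : (X %/ p ^ w).+1 * ((Z %/ p ^ w).+1 * (p ^ w * p ^ w)) <= _).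
  by rewrite mulnCA leq_mul2l mulnCA leq_mul2l step3 !orbT.
have := leq_mul dX dZ; rewrite mulnACA [2 * Z]mulnC mulnACA; lia.
Qed.

(** * Averages along arithmetic progressions of residues *)

(** x/Q lies within 1/K of an integer. *)
Definition near_multiple (K Q x : nat) :=
  (x %% Q * K < Q) || ((Q - x %% Q) * K < Q).

(** G/Q is not within 1/(hK) of a fraction with denominator h at most H. *)
Definition spread (H K Q G : nat) :=
  all (fun h => ~~ near_multiple K Q (h * G)) (index_iota 1 H.+1).

(** Dirichlet's approximation theorem by pigeonhole, in integers. *)
Lemma dirichlet_nat Q K G : 0 < Q -> 0 < K ->
  exists2 h, 0 < h <= K & near_multiple K Q (h * G).
Proof.
move=> Q0 K0.
pose bin (i : 'I_K.+1) : 'I_K := insubd (Ordinal K0) (((i * G) %% Q * K) %/ Q).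
have binE i : bin i = (((i * G) %% Q * K) %/ Q) :> nat.
  by rewrite val_insubd ltn_divLR // mulnC ltn_mul2l K0 ltn_mod Q0.
have /injectivePn[i [j ij eij]] : ~~ injectiveb bin.
  apply/negP => /injectiveP inj.
  by have := leq_card bin inj; rewrite !card_ord ltnn.
wlog ltij : i j ij eij / i < j.
  move=> W; have := ij; rewrite -val_eqE neq_ltn => /orP[|] h; first exact: (W i j).
  by apply: (W j i); rewrite // eq_sym.
exists (j - i).
  by rewrite subn_gt0 ltij /= (leq_trans (leq_subr _ _)) // -ltnS.
have := congr1 val eij; rewrite /= !binE => e.
have ei := divn_eq ((i * G) %% Q * K) Q.
have ej := divn_eq ((j * G) %% Q * K) Q.
have mi := ltn_pmod ((i * G) %% Q * K) Q0.
have mj := ltn_pmod ((j * G) %% Q * K) Q0.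
have li := ltn_pmod (i * G) Q0.
have lj := ltn_pmod (j * G) Q0.
have E : (j - i) * G %% Q = if i * G %% Q <= j * G %% Q then j * G %% Q - i * G %% Q
   else Q - (i * G %% Q - j * G %% Q).
  rewrite mulnBl; have ijG : i * G <= j * G by rewrite leq_mul2r (ltnW ltij) orbT.
  by rewrite modnB //; case: ltnP => h /=; lia.
rewrite /near_multiple E; have [h|h] := leqP (i * G %% Q) (j * G %% Q); apply/orP; [left|right].
  by rewrite mulnBl; lia.
have -> : Q - (Q - (i * G %% Q - j * G %% Q)) = i * G %% Q - j * G %% Q by lia.
by rewrite mulnBl; lia.
Qed.

Lemma sum_affine_residues (f : nat -> nat) h a u : 0 < h -> coprime h a ->
  \sum_(l < h) f ((u + l * a) %% h) = \sum_(m < h) f m.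
Proof.
move=> h0 cop; pose s (l : 'I_h) := Ordinal (ltn_pmod (u + l * a) h0).
rewrite [RHS](reindex_inj (h := s)) // => l l' /(congr1 val) /= /eqP.
rewrite eqn_modDl; wlog ll : l l' / l <= l'.
  move=> W; have [/W//|/ltnW/W h'] := leqP l l'.
  by move=> e; symmetry; apply: h'; rewrite eq_sym.
rewrite eq_sym eqn_mod_dvd ?leq_mul2r ?ll ?orbT // -mulnBl Gauss_dvdl //.
move=> d; apply: val_inj => /=.
have : l' - l < h by apply: leq_ltn_trans (leq_subr _ _) (ltn_ord l').
case: (posnP (l' - l)) => [|p /(gtnNdvd p)]; last by rewrite d.
move=> e _; apply/eqP; rewrite eqn_leq ll /=; lia.
Qed.

(** Since G/Q is close to a/h, the residue of X + lG modulo Q is close to mQ/h,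
    where m runs through all classes modulo h as l does; it can be much smaller
    only after wrapping around, which requires m = h - 1. *)
Lemma progression_residue_lower (h Q G X a l : nat) (r : int) : 0 < h -> 0 < Q -> l < h ->
  (h%:Z * G%:Z = a%:Z * Q%:Z + r)%R -> (`|r| * h%:Z <= Q%:Z)%R ->
  let m := ((h * X) %/ Q + l * a) %% h in
  m * Q <= h * ((X + l * G) %% Q) + (h <= m.+1) * (h * Q) + Q.
Proof.
move=> h0 Q0 lh eG rh /=.
set u := (h * X) %/ Q; set m := _ %% h.
have eX := divn_eq (h * X) Q; rewrite -/u in eX.
have sQ := ltn_pmod (h * X) Q0; set s := (h * X) %% Q in eX sQ.
have em := divn_eq (u + l * a) h; rewrite -/m in em.
have mh : m < h by rewrite ltn_mod.
set e := (u + l * a) %/ h in em.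
have eF := divn_eq (X + l * G) Q; set F := _ %% Q in eF *.
set q := (X + l * G) %/ Q in eF.
have FQ : F < Q by rewrite ltn_mod.
have lr : (- Q%:Z <= l%:Z * r <= Q%:Z)%R.
  have : (`|l%:Z * r| <= Q%:Z)%R.
    rewrite normrM; apply: le_trans rh; rewrite mulrC ler_wpM2l ?normr_ge0 //; lia.
  by rewrite ler_norml.
have eq1 : (h%:Z * F%:Z = m%:Z * Q%:Z + (e%:Z - q%:Z) * (h%:Z * Q%:Z) + (s%:Z + l%:Z * r))%R.
  have E1 : (h%:Z * X%:Z = u%:Z * Q%:Z + s%:Z)%R by move: eX; lia.
  have E2 : (u%:Z + l%:Z * a%:Z = e%:Z * h%:Z + m%:Z)%R by move: em; lia.
  have E3 : (X%:Z + l%:Z * G%:Z = q%:Z * Q%:Z + F%:Z)%R by move: eF; lia.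
  have -> : (F%:Z = X%:Z + l%:Z * G%:Z - q%:Z * Q%:Z)%R by rewrite E3; lia.
  have -> : (m%:Z = u%:Z + l%:Z * a%:Z - e%:Z * h%:Z)%R by rewrite E2; lia.
  transitivity (h%:Z * X%:Z + l%:Z * (h%:Z * G%:Z) - h%:Z * q%:Z * Q%:Z)%R; first by lia.
  rewrite E1 eG; lia.
have hQ : (m%:Z * Q%:Z <= h%:Z * Q%:Z)%R by nia.
have [kn|kp] := lerP 0%R (e%:Z - q%:Z)%R.
  have : (0 <= (e%:Z - q%:Z) * (h%:Z * Q%:Z))%R by rewrite mulr_ge0.
  by move: eq1 lr; case: (h <= _) => /=; lia.
have kB : ((e%:Z - q%:Z) * (h%:Z * Q%:Z) <= - (h%:Z * Q%:Z))%R.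
  have hQ0 : (0 <= h%:Z * Q%:Z)%R by rewrite mulr_ge0.
  have k1 : (e%:Z - q%:Z <= -1)%R by lia.
  by have := ler_wpM2r hQ0 k1; rewrite mulN1r.
have -> : h <= m.+1.
  rewrite leqNgt; apply/negP => hm.
  have : (m.+2 * Q <= h * Q)%N by rewrite leq_mul2r hm orbT.
  have : (0 <= h%:Z * F%:Z)%R by rewrite mulr_ge0.
  move: eq1 lr kB; lia.
rewrite /= mul1n; lia.
Qed.

(** The values mQ/h for m < h average to Q/2. *)
Lemma progression_average h Q G X a (r : int) : 0 < h -> 0 < Q -> coprime h a ->
  (h%:Z * G%:Z = a%:Z * Q%:Z + r)%R -> (`|r| * h%:Z <= Q%:Z)%R ->
  h * Q <= 2 * (\sum_(l < h) (X + l * G) %% Q) + 5 * Q.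
Proof.
move=> h0 Q0 cop eG rh; set u := (h * X) %/ Q.
have : \sum_(l < h) ((u + l * a) %% h) * Q <=
  \sum_(l < h) (h * ((X + l * G) %% Q) + (h <= ((u + l * a) %% h).+1) * (h * Q) + Q).
  by apply: leq_sum => l _; exact: progression_residue_lower h0 Q0 (ltn_ord l) eG rh.
rewrite !big_split /= sum_nat_const card_ord -big_distrr -!big_distrl /=.
rewrite (sum_affine_residues (fun m => m) u h0 cop).
rewrite (sum_affine_residues (fun m => h <= m.+1 : nat) u h0 cop).
have -> : \sum_(m < h) (h <= m.+1) = 1.
  case: (h) h0 => // h' _; rewrite big_ord_recr /= leqnn big1 // => i _.
  by rewrite ltnNge (leq_trans (ltn_ord i)) // ltnS; case: ltngtP (ltn_ord i).
have : (\sum_(m < h) m) * 2 + h = h * h.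
  elim: (h) => [|q]; first by rewrite big_ord0.
  by rewrite big_ord_recr /=; move: (\sum_(i < q) _) => S; rewrite mulSn mulnS; lia.
move: (\sum_(m < h) _) (\sum_(l < h) _) => S T eS hS.
rewrite -(leq_pmul2l h0) mulnA -eS; lia.
Qed.

(** The least h with hG near a multiple of Q exceeds H by [spread], and its
    minimality makes the approximating fraction a/h reduced. *)
Lemma dirichlet_reduced Q K G H : 0 < Q -> 0 < K -> spread H K Q G ->
  exists h a (r : int), [/\ H < h <= K, coprime h a,
    (h%:Z * G%:Z = a%:Z * Q%:Z + r)%R & (`|r| * K%:Z < Q%:Z)%R].
Proof.
move=> Q0 K0 /allP sp.
have [h1 h1K n1] := dirichlet_nat G Q0 K0.
pose P h := (0 < h) && near_multiple K Q (h * G).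
have exP : exists h, P h by exists h1; case/andP: h1K => p _; apply/andP.
case: (ex_minnP exP) => h /andP[h0 nh] hmin.
have hK : h <= K.
  by apply: leq_trans (hmin h1 _) _; case/andP: h1K => // p _; apply/andP.
have Hh : H < h.
  rewrite ltnNge; apply/negP => hH; have := sp h.
  by rewrite mem_index_iota h0 ltnS hH nh => /(_ isT).
have e := divn_eq (h * G) Q.
have [a [r [eG rK]]] : exists a (r : int),
    (h%:Z * G%:Z = a%:Z * Q%:Z + r)%R /\ (`|r| * K%:Z < Q%:Z)%R.
  move: nh => /orP[] nh.
    exists (h * G %/ Q), (Posz (h * G %% Q)); split; lia.
  exists (h * G %/ Q).+1, (Posz (h * G %% Q) - Q%:Z)%R; split; first by lia.
  have := ltn_pmod (h * G) Q0 => mQ.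
  rewrite ltr0_norm; lia.
exists h, a, r; split; rewrite ?Hh //.
rewrite /coprime; apply/eqP; set d := gcdn h a.
have d0 : 0 < d by rewrite gcdn_gt0 h0.
have [h' eh] : exists h', h = h' * d by apply/dvdnP/dvdn_gcdl.
have [a' ea] : exists a', a = a' * d by apply/dvdnP/dvdn_gcdr.
(* Dividing h, a and r by d leaves an approximation with smaller h. *)
have h'0 : 0 < h' by move: h0; rewrite eh; case: (h').
pose r' := (h'%:Z * G%:Z - a'%:Z * Q%:Z)%R.
have er : (r = d%:Z * r')%R.
  by move: eG; rewrite /r' eh ea !PoszM; lia.
have r'K : (`|r'| * K%:Z < Q%:Z)%R.
  apply: le_lt_trans rK; rewrite ler_wpM2r // er normrM -{1}[`|r'|%R]mul1r.
  by rewrite ler_wpM2r ?normr_ge0 //; lia.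
have nh' : P h'.
  rewrite /P h'0 /=; apply/orP.
  have eh' : (h'%:Z * G%:Z = a'%:Z * Q%:Z + r')%R by rewrite /r'; lia.
  have r'Q : (`|r'| < Q%:Z)%R.
    apply: le_lt_trans r'K; rewrite -{1}[`|r'|%R]mulr1 ler_wpM2l ?normr_ge0 //; lia.
  have [r'p|r'n] := lerP 0%R r'.
    left; have [t et] : exists t : nat, r' = Posz t by exists `|r'|; rewrite gez0_abs.
    have -> : h' * G = a' * Q + t by move: eh'; rewrite et; lia.
    rewrite modnMDl; move: r'K r'Q; rewrite et => *.
    rewrite modn_small; lia.
  right; have [t et] : exists t : nat, r' = (- t%:Z)%R.
    by exists `|r'|; rewrite ltz0_abs // opprK.
  have t0 : 0 < t by lia.
  have a'0 : 0 < a' by case: (a') eh' => //; rewrite et; lia.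
  have tQ : t < Q by lia.
  have -> : h' * G = a'.-1 * Q + (Q - t).
    by move: eh'; rewrite et -{1}(prednK a'0); lia.
  rewrite modnMDl modn_small; lia.
have := hmin h' nh'; rewrite {1}eh -{2}[h']muln1 leq_pmul2l // => d1.
by apply/eqP; rewrite eqn_leq d1 d0.
Qed.

(** One-sided equidistribution: cut the progression into stretches of length h,
    on each of which G/Q behaves like a reduced fraction a/h with large denominator. *)
Lemma block_average H K C Q G X : 0 < Q -> 0 < K -> spread H K Q G ->
  H * (C * Q) <= 2 * H * (\sum_(c < C) (X + c * G) %% Q) + H * (K * Q) + 5 * (C * Q).
Proof.
move=> Q0 K0 sp.
have [h [a [r [/andP[Hh hK] cop eG rK]]]] := dirichlet_reduced Q0 K0 sp.
have h0 : 0 < h by apply: leq_ltn_trans Hh.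
have rh : (`|r| * h%:Z <= Q%:Z)%R.
  apply: le_trans (ltW rK); rewrite ler_wpM2l ?normr_ge0 //; lia.
have blocks q : q * (h * Q) <= 2 * (\sum_(c < q * h) (X + c * G) %% Q) + q * (5 * Q).
  elim: q => [|q IH]; first by rewrite !mul0n.
  rewrite mulSn addnC [q.+1 * h]mulSn addnC [h + _]addnC big_split_ord /=.
  have := progression_average (X + q * h * G) h0 Q0 cop eG rh.
  have -> : \sum_(l < h) (X + q * h * G + l * G) %% Q =
            \sum_(i < h) (X + (q * h + i) * G) %% Q.
    by apply: eq_bigr => i _; rewrite mulnDl addnA.
  move: (\sum_(i < h) _) (\sum_(c < q * h) _) IH => S T; lia.
have B := blocks (C %/ h).
have L : \sum_(c < C %/ h * h) (X + c * G) %% Q <= \sum_(c < C) (X + c * G) %% Q.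
  by apply: (leq_sum_ord (fun c => (X + c * G) %% Q)); apply: leq_divM.
have eC := divn_eq C h; have Ch := ltn_pmod C h0.
move: B L; move: (\sum_(c < C %/ h * h) _) (\sum_(c < C) _) => S T B L.
move: eC Ch B; move: (C %/ h) (C %% h) => q s eC Ch B.
have b1 : q * (h * Q) <= 2 * T + q * (5 * Q) by lia.
have b2 : H * q <= C by rewrite eC; nia.
have b3 : C * Q <= q * (h * Q) + K * Q by rewrite eC; nia.
have b4 : H * (q * (5 * Q)) <= 5 * (C * Q).
  have := leq_mul b2 (leqnn (5 * Q)); lia.
have := leq_mul (leqnn H) b1; have := leq_mul (leqnn H) b3.
rewrite !mulnDr; lia.
Qed.

Local Open Scope ring_scope.

(** * Variance of the number of carries *)

(** The probability of a carry at [Q] for uniform [N]. *)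
Definition frac_div (R : realFieldType) (Q a : nat) : R := (a %% Q)%N%:R / Q%:R.

Lemma frac_div_ge0 (R : realFieldType) Q a : 0 <= frac_div R Q a.
Proof. by rewrite /frac_div divr_ge0 ?ler0n. Qed.

Lemma frac_div_lt1 (R : realFieldType) Q a : (0 < Q)%N -> frac_div R Q a < 1.
Proof. by move=> Q0; rewrite ltr_pdivrMr ?ltr0n // mul1r ltr_nat ltn_mod. Qed.

Lemma sum_carry (p w j a : nat) : (0 < p)%N -> (j <= w)%N ->
  (\sum_(N < p ^ w) carry (p ^ j) N a = p ^ (w - j) * (a %% p ^ j))%N.
Proof.
move=> p0 jw; have pj : (0 < p ^ j)%N by rewrite expn_gt0 p0.
have E : (p ^ w = p ^ (w - j) * p ^ j)%N by rewrite -expnD subnK.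
rewrite E.
rewrite -[in RHS](@sum_ltn_ord (p ^ j) (a %% p ^ j)); last by rewrite ltnW // ltn_mod.
by rewrite -(sum_periods (fun r => r < a %% p ^ j : nat)%N 0 _ pj).
Qed.

(** Within the residues below a mod p^l, those below a mod p^j modulo p^j have
    the expected frequency up to one incomplete period. *)
Lemma sum_carry2 (p w j l a : nat) : (0 < p)%N -> (j <= l)%N -> (l <= w)%N ->
  (\sum_(N < p ^ w) carry (p ^ j) N a * carry (p ^ l) N a <=
   p ^ (w - l) * (((a %% p ^ l) %/ p ^ j).+1 * (a %% p ^ j)))%N.
Proof.
move=> p0 jl lw.
have pj : (0 < p ^ j)%N by rewrite expn_gt0 p0.
have pl : (0 < p ^ l)%N by rewrite expn_gt0 p0.
have al : (a %% p ^ l <= p ^ l)%N by rewrite ltnW // ltn_mod.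
have E : (p ^ w = p ^ (w - l) * p ^ l)%N by rewrite -expnD subnK.
rewrite E.
have e N : (carry (p ^ j) N a * carry (p ^ l) N a =
   (fun r => (r %% p ^ j < a %% p ^ j) * (r < a %% p ^ l))%N ((0 + N) %% p ^ l))%N.
  by rewrite /= /carry modn_dvdm // dvdn_exp2l.
pose f r := ((r %% p ^ j < a %% p ^ j) * (r < a %% p ^ l))%N.
rewrite (eq_bigr (fun N : 'I__ => f ((0 + N) %% p ^ l)%N)); last by move=> N _; exact: e.
rewrite (sum_periods f 0 _ pl) /f leq_mul2l; apply/orP; right.
rewrite (sum_ord_restrict (fun i => i %% p ^ j < a %% p ^ j : nat)%N al).
have := sum_residues_le (fun r => r < a %% p ^ j : nat)%N 0 (a %% p ^ l) pj.
rewrite sum_ltn_ord; last by rewrite ltnW // ltn_mod.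
by [].
Qed.

(** Carries at p^j and p^l are nearly independent when l - j is large, which is
    what makes the variance linear in the number of positions. *)
Lemma carry_covariance (R : realFieldType) (p w j l a : nat) :
  (0 < p)%N -> (j < l)%N -> (l <= w)%N ->
  \sum_(N < p ^ w) ((carry (p ^ j) N a)%:R - frac_div R (p ^ j) a) *
                   ((carry (p ^ l) N a)%:R - frac_div R (p ^ l) a)
    <= (p ^ w)%:R / (p ^ (l - j))%:R.
Proof.
move=> p0 jl lw.
have pe i : (0 : R) < (p ^ i)%:R by rewrite ltr0n expn_gt0 p0.
pose c i N : R := (carry (p ^ i) N a)%:R.
pose m i : R := frac_div R (p ^ i) a.
have S1 i : (i <= w)%N -> \sum_(N < p ^ w) c i N = (p ^ w)%:R * m i.
  move=> iw; rewrite -natr_sum sum_carry // natrM /m /frac_div.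
  rewrite -{2}(subnK iw) expnD natrM -!mulrA; congr (_ * _).
  by rewrite mulrCA divff ?mulr1 // gt_eqF.
have -> : \sum_(N < p ^ w) (c j N - m j) * (c l N - m l) =
   \sum_(N < p ^ w) c j N * c l N - (p ^ w)%:R * (m j * m l).
  transitivity (\sum_(N < p ^ w) (c j N * c l N - m j * c l N - m l * c j N + m j * m l)).
    by apply: eq_bigr => N _; ring.
  rewrite big_split /= sumr_const card_ord -(mulr_natl (m j * m l)).
  rewrite !sumrB -!mulr_sumr !S1 ?(leq_trans (ltnW jl)) //; ring.
have S2 : \sum_(N < p ^ w) c j N * c l N <=
   (p ^ (w - l) * (((a %% p ^ l) %/ p ^ j).+1 * (a %% p ^ j)))%N%:R.
  rewrite (eq_bigr (fun N : 'I__ => (carry (p ^ j) N a * carry (p ^ l) N a)%N%:R)); last first.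
    by move=> N _; rewrite natrM.
  by rewrite -natr_sum ler_nat sum_carry2 // ltnW.
rewrite lerBlDr; apply: le_trans S2 _.
rewrite !natrM.
have fl : ((a %% p ^ l) %/ p ^ j)%N%:R <= (a %% p ^ l)%N%:R / (p ^ j)%:R :> R.
  by rewrite ler_pdivlMr // -natrM ler_nat leq_divM.
have e1 : (p ^ w)%:R = (p ^ (w - l))%:R * (p ^ l)%:R :> R.
  by rewrite -natrM -expnD subnK.
have e2 : (p ^ l)%:R = (p ^ (l - j))%:R * (p ^ j)%:R :> R.
  by rewrite -natrM -expnD subnK // ltnW.
rewrite e1 -mulrA -mulrA -mulrDr ler_pM2l //.
rewrite -addn1 natrD mulrDl mul1r addrC; apply: lerD.
  rewrite e2 [_ * (p ^ j)%:R]mulrC -mulrA divff ?gt_eqF // mulr1.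
  by rewrite ler_nat ltnW // ltn_mod expn_gt0 p0.
have -> : (p ^ l)%:R * (m j * m l) = (a %% p ^ l)%N%:R / (p ^ j)%:R * (a %% p ^ j)%N%:R.
  rewrite /m /frac_div; field; rewrite !gt_eqF //.
by rewrite ler_wpM2r.
Qed.

Lemma carry_variance (R : realFieldType) (p W a w : nat) : (1 < p)%N -> (w <= W)%N ->
  \sum_(N < p ^ W) (\sum_(1 <= j < w.+1)
     ((carry (p ^ j) N a)%:R - frac_div R (p ^ j) a)) ^+ 2
    <= 3 * w%:R * (p ^ W)%:R.
Proof.
move=> p1; have p0 := ltnW p1.
pose y j N : R := (carry (p ^ j) N a)%:R - frac_div R (p ^ j) a.
elim: w => [|w IH] wW.
  by rewrite big1 ?mulr0 ?mul0r // => N _; rewrite big_geq // expr0n.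
have -> : \sum_(N < p ^ W) (\sum_(1 <= j < w.+2) y j N) ^+ 2 =
  \sum_(N < p ^ W) (\sum_(1 <= j < w.+1) y j N) ^+ 2 +
  2 * \sum_(1 <= j < w.+1) \sum_(N < p ^ W) y j N * y w.+1 N +
  \sum_(N < p ^ W) (y w.+1 N) ^+ 2.
  rewrite exchange_big mulr_sumr -!big_split /=; apply: eq_bigr => N _.
  rewrite big_nat_recr //= sqrrD -mulr_suml mulr2n; ring.
have h1 := IH (ltnW wW).
have h2 : \sum_(1 <= j < w.+1) \sum_(N < p ^ W) y j N * y w.+1 N <= (p ^ W)%:R.
  apply: (@le_trans _ _ (\sum_(1 <= j < w.+1) (p ^ W)%:R / (2 ^ (w.+1 - j))%:R)).
    rewrite !big_nat; apply: ler_sum => j /andP[_ jw].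
    apply: le_trans (carry_covariance _ _ p0 jw wW) _.
    rewrite ler_pM2l ?ltr0n ?expn_gt0 ?p0 // lef_pV2 ?posrE ?ltr0n ?expn_gt0 ?p0 //.
    by rewrite ler_nat leq_exp_base.
  rewrite -mulr_sumr -[leRHS]mulr1 ler_wpM2l //.
  have -> : \sum_(1 <= j < w.+1) ((2 ^ (w.+1 - j))%:R)^-1 = 1 - ((2 ^ w)%:R)^-1 :> R.
    elim: (w) => [|v IHv]; first by rewrite big_geq // expn0 invr1 subrr.
    rewrite big_nat_recl // [X in _ + X](_ : _ =  1 - ((2 ^ v)%:R)^-1); last first.
      by rewrite -IHv big_add1 /=; apply: eq_bigr => i _; rewrite subSS.
    rewrite subn1 /= expnS natrM invfM; field.
    by rewrite pnatr_eq0 expn_eq0.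
  by rewrite gerBl invr_ge0.
have h3 : \sum_(N < p ^ W) (y w.+1 N) ^+ 2 <= (p ^ W)%:R.
  apply: (@le_trans _ _ (\sum_(N < p ^ W) 1)); last by rewrite sumr_const card_ord.
  apply: ler_sum => N _; rewrite /y.
  have := frac_div_ge0 R (p ^ w.+1) a.
  have := @frac_div_lt1 R (p ^ w.+1) a; rewrite expn_gt0 p0 => /(_ isT).
  by case: (carry _ _ _) => /=; nra.
rewrite -natr1; move: h1 h2 h3; lra.
Qed.

Lemma carries_concentrate (R : realFieldType) (p w a : nat) (t mu : R) :
  (1 < p)%N -> 0 < t ->
  mu <= \sum_(1 <= j < w.+1) frac_div R (p ^ j) a ->
  t ^+ 2 * (\sum_(N < p ^ w) ((carries p w N a)%:R < mu - t)%R)%N%:R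
    <= 3 * w%:R * (p ^ w)%:R.
Proof.
move=> p1 t0 hmu.
apply: le_trans (carry_variance R a p1 (leqnn w)).
rewrite natr_sum mulr_sumr; apply: ler_sum => N _.
rewrite sumrB -natr_sum -/(carries p w N a).
case: ltP => /= h; last by rewrite mulr0 sqr_ge0.
rewrite mulr1; nra.
Qed.

Lemma carries_concentrate_interval (R : realFieldType) (p w a s X : nat) (t mu : R) :
  (1 < p)%N -> 0 < t -> (p ^ w <= X)%N ->
  mu <= \sum_(1 <= j < w.+1) frac_div R (p ^ j) a ->
  t ^+ 2 * (\sum_(i < X) ((carries p w (s + i) a)%:R < mu - t)%R)%N%:R
    <= 6 * w%:R * X%:R.
Proof.
move=> p1 t0 QX hmu; have Q0 : (0 < p ^ w)%N by rewrite expn_gt0 ltnW.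
have c := carries_concentrate p1 t0 hmu.
have h : (\sum_(i < X) ((carries p w (s + i) a)%:R < mu - t)%R <=
   (X %/ p ^ w).+1 * \sum_(N < p ^ w) ((carries p w N a)%:R < mu - t)%R)%N.
  have := sum_residues_le (fun r => ((carries p w r a)%:R < mu - t)%R : nat) s X Q0.
  apply: leq_trans; apply: leq_sum => i _.
  by rewrite carries_mod [in X in (_ <= X)%N]carries_mod modn_mod.
have t2 : 0 <= t ^+ 2 by rewrite exprn_ge0 // ltW.
move: h; rewrite -(ler_nat R) => /(ler_wpM2l t2)/le_trans; apply.
rewrite natrM mulrCA.
apply: (@le_trans _ _ ((X %/ p ^ w).+1%:R * (3 * w%:R * (p ^ w)%:R))).
  by rewrite ler_wpM2l.
have : ((X %/ p ^ w).+1 * p ^ w)%N%:R <= (2 * X)%N%:R :> R.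
  by rewrite ler_nat mulSn; have := leq_divM X (p ^ w); lia.
rewrite !natrM => h; have w0 : 0 <= 3 * w%:R :> R by rewrite mulr_ge0.
by have := ler_wpM2l w0 h; lra.
Qed.

(** * Quotients of powers of two coprime integers *)

Lemma bernoulli_ge (R : realDomainType) (x : R) n : 1 <= x -> 1 + (x - 1) * n%:R <= x ^+ n.
Proof.
move=> x1; elim: n => [|n IH]; first by rewrite mulr0 addr0 expr0.
rewrite exprS -natr1; have n0 : 0 <= n%:R :> R by [].
apply: (@le_trans _ _ (x * (1 + (x - 1) * n%:R))); last by rewrite ler_wpM2l //; lra.
have := mulr_ge0 (sqr_ge0 (x - 1)) n0; nra.
Qed.

Lemma exists_expr_ge (R : archiRealFieldType) (x M : R) : 1 < x -> exists n, M <= x ^+ n.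
Proof.
move=> x1; exists (Num.truncn (M / (x - 1))).+1.
have x0 : 0 < x - 1 by lra.
apply: le_trans (bernoulli_ge _ (ltW x1)).
have : M / (x - 1) < (Num.truncn (M / (x - 1))).+1%:R by exact: truncnS_gt.
by rewrite ltr_pdivrMr // mulrC => h; lra.
Qed.

Lemma power_ratio_neq1 (l p s t : nat) : (1 < l)%N -> coprime l p ->
  (0 < s)%N -> (l ^ s != p ^ t)%N.
Proof.
move=> l1 cop s0; apply/eqP => e.
have : coprime (l ^ s) (l ^ s) by rewrite {2}e coprimeXl // coprimeXr.
rewrite /coprime gcdnn => /eqP e1.
by have := ltn_expl s l1; rewrite e1; lia.
Qed.

(** Pigeonhole on the leading part of l^b in base p, a number in [1, p); the
    quotient of two leading parts is again a quotient of powers. *)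
Lemma two_powers_close (R : archiRealFieldType) (l p M : nat) :
  (1 < l)%N -> (1 < p)%N -> coprime l p -> (0 < M)%N ->
  exists s t, let k : R := (l ^ s)%:R / (p ^ t)%:R in
    [/\ 1 - M%:R^-1 < k, k < 1 + M%:R^-1 & k != 1].
Proof.
move=> l1 p1 cop M0; have p0 := ltnW p1; have l0 := ltnW l1.
pose j b := trunc_log p (l ^ b).
have jb b : (p ^ j b <= l ^ b < p ^ (j b).+1)%N.
  by apply: trunc_log_bounds; rewrite // expn_gt0 l0.
have pj b : (0 < p ^ j b)%N by rewrite expn_gt0 p0.
have Mp0 : (0 < M * p)%N by rewrite muln_gt0 M0.
pose bin (b : 'I_(M * p).+1) : 'I_(M * p) :=
  insubd (Ordinal Mp0) ((M * l ^ b) %/ p ^ j b)%N.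
have binE b : bin b = ((M * l ^ b) %/ p ^ j b)%N :> nat.
  rewrite val_insubd ltn_divLR // -mulnA -expnS ltn_mul2l M0 /=.
  by case/andP: (jb b) => _ ->.
have /injectivePn[b1 [b2 b12 e12]] : ~~ injectiveb bin.
  apply/negP => /injectiveP inj.
  by have := leq_card bin inj; rewrite !card_ord ltnn.
wlog lt12 : b1 b2 b12 e12 / (b1 < b2)%N.
  move=> W; have := b12; rewrite -val_eqE neq_ltn => /orP[|] h; first exact: (W b1 b2).
  by apply: (W b2 b1); rewrite // eq_sym.
have j12 : (j b1 <= j b2)%N by apply: leq_trunc_log; rewrite leq_exp2l // ltnW.
exists (b2 - b1)%N, (j b2 - j b1)%N => k.
have pR i : (0 : R) < (p ^ i)%:R by rewrite ltr0n expn_gt0 p0.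
have lR i : (0 : R) < (l ^ i)%:R by rewrite ltr0n expn_gt0 l0.
pose y b : R := (l ^ b)%:R / (p ^ j b)%:R.
have y1 b : 1 <= y b by rewrite ler_pdivlMr // mul1r ler_nat; case/andP: (jb b).
have ek : k = y b2 / y b1.
  rewrite /k /y.
  have -> : (l ^ b2)%:R = (l ^ (b2 - b1))%:R * (l ^ b1)%:R :> R.
    by rewrite -natrM -expnD subnK // ltnW.
  have -> : (p ^ j b2)%:R = (p ^ (j b2 - j b1))%:R * (p ^ j b1)%:R :> R.
    by rewrite -natrM -expnD subnK.
  by field; rewrite !gt_eqF.
have MR : (0 : R) < M%:R by rewrite ltr0n.
have yb (b : 'I_(M * p).+1) : (bin b)%:R <= M%:R * y b < (bin b)%:R + 1.
  rewrite binE /y mulrA ler_pdivlMr // ltr_pdivrMr // -natrM natr1 -!natrM.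
  by rewrite ler_nat ltr_nat leq_divM ltn_ceil.
have [] := (andP (yb b1), andP (yb b2)); rewrite e12 => -[u1 u2] [v1 v2].
have y0 : 0 < y b1 by apply: lt_le_trans (y1 b1).
have Mi : M%:R * M%:R^-1 = 1 :> R by rewrite divff // gt_eqF.
have Mi0 : 0 < M%:R^-1 :> R by rewrite invr_gt0.
have d1 : y b1 - y b2 < M%:R^-1 by rewrite -(ltr_pM2l MR) Mi mulrBr; lra.
have d2 : y b2 - y b1 < M%:R^-1 by rewrite -(ltr_pM2l MR) Mi mulrBr; lra.
have yy := y1 b1.
split.
- rewrite ek ltr_pdivlMr //; nra.
- rewrite ek ltr_pdivrMr //; nra.
- rewrite /k; apply/eqP => e.
  have : (l ^ (b2 - b1))%:R = (p ^ (j b2 - j b1))%:R :> R.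
    move/(congr1 (fun u => u * (p ^ (j b2 - j b1))%:R)): e.
    by rewrite divfK ?mul1r // gt_eqF.
  move/eqP; rewrite eqr_nat; apply/negP/power_ratio_neq1 => //.
  by rewrite subn_gt0.
Qed.

(** The rotation by log l / log p is irrational, so the quotients approach 1; the
    point is to approach from above. *)
Lemma power_ratio_above1 (R : archiRealFieldType) (l p : nat) (d : R) :
  (1 < l)%N -> (1 < p)%N -> coprime l p -> 0 < d ->
  exists s t, (1 : R) < (l ^ s)%:R / (p ^ t)%:R <= 1 + d.
Proof.
move=> l1 p1 cop d0.
pose M := (Num.truncn (2 / d)).+2.
have Md : 2 / d < M%:R by apply: lt_trans (truncnS_gt _) _; rewrite ltr_nat.
have MR : (0 : R) < M%:R by rewrite ltr0n.
have M2 : (2 : R) <= M%:R by rewrite ler_nat.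
have iM : 2 * M%:R^-1 < d.
  by rewrite ltr_pdivrMr // mulrC -ltr_pdivrMr.
have iM0 : 0 < M%:R^-1 :> R by rewrite invr_gt0.
have iM2 : M%:R^-1 <= 2^-1 :> R by rewrite lef_pV2 // posrE.
have [s [t]] := two_powers_close R l1 p1 cop (ltn0Sn _ : (0 < M)%N).
set k := _ / _ => -[k1 k2 kn].
have [kgt|klt|/eqP] := ltgtP 1 k; last by rewrite eq_sym (negbTE kn).
  by exists s, t; rewrite -/k kgt /=; lra.
(* If k < 1, the last m with l k^m > 1 has l k^m <= 1/k, just above 1. *)
have k0 : 0 < k by lra.
have ki : 1 < k^-1 by rewrite invf_gt1.
have [m0 hm0] := exists_expr_ge l%:R ki.
have {}hm0 : exists m, l%:R * k ^+ m <= 1.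
  exists m0; rewrite -ler_pdivlMr ?exprn_gt0 // mul1r -exprVn //.
case: (ex_minnP hm0) => -[|m]; first by rewrite expr0 mulr1 leNgt ltr1n l1.
move=> hm hmin.
have gm : 1 < l%:R * k ^+ m.
  by rewrite ltNge; apply/negP => /hmin; rewrite ltnn.
exists (1 + m * s)%N, (m * t)%N.
have -> : (l ^ (1 + m * s))%:R / (p ^ (m * t))%:R = l%:R * k ^+ m :> R.
  rewrite /k expnD expn1 natrM -mulrA; congr (_ * _).
  by rewrite expr_div_n -!natrX -!expnM ![(_ * m)%N]mulnC.
rewrite gm /=; move: hm; rewrite exprSr mulrA.
move: (l%:R * k ^+ m) => X; nra.
Qed.

(** Indices that pairwise differ by at most C fit in an interval of C + 1 integers. *)
Lemma count_clustered (P : pred nat) (C n : nat) :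
  (forall k1 k2, (k1 < k2 < n)%N -> P k1 -> P k2 -> (k2 - k1 <= C)%N) ->
  (\sum_(k < n) P k <= C.+1)%N.
Proof.
elim: n => [|n IH] H; first by rewrite big_ord0.
rewrite big_ord_recr /=; case Pn: (P n) => /=; last first.
  rewrite addn0; apply: IH => k1 k2 /andP[h1 h2]; apply: H.
  by rewrite h1 (ltn_trans h2).
rewrite addn1 ltnS.
apply: (@leq_trans (\sum_(k < n) (n - C <= k)%N)).
  apply: leq_sum => k _; case Pk: (P k) => //.
  have := H k n; rewrite ltn_ord ltnSn Pk Pn => /(_ isT isT isT) h.
  by have -> : (n - C <= k)%N by lia.
have [nC|Cn] := leqP n C.
  apply: leq_trans nC; apply: (@leq_trans (\sum_(k < n) 1)); last by rewrite sum1_card card_ord.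
  by apply: leq_sum => i _; exact: leq_b1.
have e : (n - C + C)%N = n by lia.
rewrite -(big_mkord xpredT (fun k => (n - C <= k)%N : nat)) (@big_cat_nat _ _ _ (n - C)) ?leq_subr //=.
rewrite big_nat [X in (X + _ <= _)%N]big1 ?add0n; last first.
  by move=> i /andP[_ hi]; rewrite leqNgt hi.
apply: (@leq_trans (\sum_(n - C <= k < n) 1)); first by apply: leq_sum => i _; exact: leq_b1.
by rewrite sum_nat_const_nat; lia.
Qed.

(** A progression growing from z to at most 4z passes near at most 12z integers.
    Near one integer it stays for 3e/(z(k-1)) steps at most, since each step
    moves it by at least z(k-1); and n is of order at least 1/(k-1). *)
Lemma geometric_near_integers (R : archiRealFieldType) (z k e : R) (n : nat) (P : pred nat) :
  1 < k -> 4^-1 <= z -> z * (k - 1) <= e -> e <= 1 -> 2 <= k ^+ n -> k ^+ n <= 4 ->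
  (forall i, P i -> exists a : nat, `|z * k ^+ i - a%:R| < e) ->
  (\sum_(i < n) P i)%N%:R <= 144 * e * n%:R.
Proof.
move=> k1 z4 ze e1 kn2 kn4 HP.
have z0 : 0 < z by apply: lt_le_trans z4; rewrite invr_gt0.
have k10 : 0 < k - 1 by lra.
have zk : 0 < z * (k - 1) by rewrite mulr_gt0.
have e0 : 0 < e by apply: lt_le_trans ze.
have kpow i : (i <= n)%N -> k ^+ i <= 4.
  by move=> h; apply: le_trans kn4; rewrite ler_weXn2l // ltW.
pose M := (Num.truncn (4 * z + 1)).+1.
have M12 : M%:R <= 12 * z.
  rewrite /M -natr1; have : (Num.truncn (4 * z + 1))%:R <= 4 * z + 1.
    by rewrite truncn_le; lra.
  lra.
pose C := Num.truncn (2 * e / (z * (k - 1))).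
have C3 : C.+1%:R <= 3 * e / (z * (k - 1)).
  have : C%:R <= 2 * e / (z * (k - 1)) by rewrite truncn_le divr_ge0 //; lra.
  have : 1 <= e / (z * (k - 1)) by rewrite ler_pdivlMr // mul1r.
  rewrite -natr1 -!mulrA; move: (e / _) => x; lra.
have n4 : 1 <= (k - 1) * (4 * n%:R).
  have : k ^+ n - 1 <= (k - 1) * (4 * n%:R).
    rewrite subrX1 ler_pM2l // mulr_natr.
    rewrite -[X in _ *+ X]card_ord -sumr_const; apply: ler_sum => i _.
    by apply: kpow; rewrite ltnW.
  lra.
have step : (\sum_(i < n) P i <= M * C.+1)%N.
  pose Q a i := P i && (`|z * k ^+ i - a%:R| < e).
  apply: (@leq_trans (\sum_(i < n) \sum_(a < M) Q a i)).
    apply: leq_sum => i _; case Pi: (P i) => //.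
    have [a ha] := HP _ Pi.
    have aM : (a < M)%N.
      rewrite /M ltnS truncn_ge_nat; last lra.
      have := kpow i (ltnW (ltn_ord i)); move: ha; rewrite ltr_norml => /andP[h1 h2].
      nra.
    by rewrite (bigD1 (Ordinal aM)) //= /Q Pi ha.
  rewrite exchange_big /=.
  apply: (@leq_trans (\sum_(a < M) C.+1)); last by rewrite sum_nat_const card_ord.
  apply: leq_sum => a _; apply: (@count_clustered (Q a)) => i1 i2 /andP[i12 _].
  move=> /andP[_ h1] /andP[_ h2].
  rewrite /C truncn_ge_nat; last by rewrite divr_ge0 //; lra.
  rewrite ler_pdivlMr //.
  have : z * k ^+ i2 - z * k ^+ i1 < 2 * e.
    by move: h1 h2; rewrite !ltr_norml => /andP[a1 a2] /andP[b1 b2]; lra.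
  move=> h; rewrite -(subnKC (ltnW i12)) addKn exprD in h *; move: h.
  set m := (i2 - i1)%N.
  have := bernoulli_ge m (ltW k1); have := @exprn_ege1 R i1 k (ltW k1).
  move: (k ^+ i1) (k ^+ m) => X Y X1 HY.
  have m0 : 0 <= m%:R :> R by [].
  have : (k - 1) * m%:R <= X * (Y - 1).
    apply: (@le_trans _ _ (Y - 1)); first lra.
    by rewrite ler_peMl //; have := mulr_ge0 (ltW k10) m0; lra.
  move=> h h'.
  have := ler_wpM2l (ltW z0) h; lra.
have -> : 144 * e * n%:R = 36 * e * (4 * n%:R) by lra.
apply: (@le_trans _ _ (36 * e / (k - 1))); last first.
  by rewrite ler_pdivrMr //; nra.
apply: (@le_trans _ _ (M * C.+1)%N%:R); first by rewrite ler_nat.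
rewrite natrM; apply: (@le_trans _ _ (12 * z * (3 * e / (z * (k - 1))))).
  by apply: ler_pM.
rewrite le_eqVlt; apply/orP; left; apply/eqP; field.
by rewrite !gt_eqF.
Qed.

(** * Pairs of powers in bad position are rare *)

Lemma cancel_scale (F : fieldType) (x c y : F) : x != 0 -> x * (c * x^-1 * y) = c * y.
Proof. by move=> x0; field. Qed.

Lemma near_multiple_real (R : realFieldType) (K Q x : nat) : (0 < K)%N -> (0 < Q)%N ->
  near_multiple K Q x -> exists a : nat, `|x%:R / Q%:R - a%:R| < K%:R^-1 :> R.
Proof.
move=> K0 Q0; have e := divn_eq x Q; have m := ltn_pmod x Q0.
have QR : (0 : R) < Q%:R by rewrite ltr0n.
have KR : (0 : R) < K%:R by rewrite ltr0n.
have ex : x%:R / Q%:R = (x %/ Q)%:R + (x %% Q)%:R / Q%:R :> R.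
  by rewrite {1}e natrD natrM mulrDl mulfK // gt_eqF.
case/orP => h.
  exists (x %/ Q)%N; rewrite ex addrAC subrr add0r ger0_norm ?divr_ge0 //.
  by rewrite ltr_pdivrMr // mulrC ltr_pdivlMr // -natrM ltr_nat.
exists (x %/ Q).+1; rewrite ex -natr1 opprD addrACA subrr add0r.
have -> : (x %% Q)%:R / Q%:R - 1 = - ((Q - x %% Q)%:R / Q%:R) :> R.
  by rewrite natrB; [field; rewrite gt_eqF | exact: ltnW].
rewrite normrN ger0_norm ?divr_ge0 //.
by rewrite ltr_pdivrMr // mulrC ltr_pdivlMr // -natrM ltr_nat.
Qed.

Lemma sum_shift_le (F : nat -> nat) t B :
  (\sum_(b < B) (t <= b) * F b <= \sum_(b < B) F (b + t))%N.
Proof.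
rewrite -(big_mkord xpredT (fun b => (t <= b) * F b)%N).
have [Bt|tB] := leqP B t.
  rewrite big_nat big1 // => b /andP[_ bB].
  by rewrite leqNgt (leq_trans bB Bt).
rewrite (@big_cat_nat _ _ _ t) ?(ltnW tB) //= big_nat big1 ?add0n; last first.
  by move=> b /andP[_ bt]; rewrite leqNgt bt.
rewrite -{1}(add0n t) big_addn big_mkord.
apply: leq_trans (leq_sum_ord (fun b => F (b + t)%N) (leq_subr t B)).
by apply: leq_sum => b _; rewrite leq_addl mul1n.
Qed.

Lemma power_window_count (p l J u v : nat) : (1 < p)%N -> (0 < l)%N ->
  (\sum_(j < J) ((p ^ j <= u) && (u * l <= v * p ^ j)) <= (trunc_log p (v %/ l)).+1)%N.
Proof.
move=> p1 l0; have p0 := ltnW p1.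
apply: count_clustered (fun j => (p ^ j <= u) && (u * l <= v * p ^ j))%N _ _ _.
move=> k1 k2 /andP[k12 _] /andP[_ h1] /andP[h2 _].
apply: trunc_log_max => //; rewrite leq_divRL //.
rewrite -(@leq_pmul2r (p ^ k1)) ?expn_gt0 ?p0 // mulnAC -expnD subnK ?(ltnW k12) //.
by apply: leq_trans h1; rewrite leq_mul2r h2 orbT.
Qed.

(** Shifting a pair (b,j) of the strip i times along (s,t), where k = l^s/p^t is
    slightly above 1, multiplies the quotient l^b/p^j by k^i, so that it grows
    slowly across several integers and is close to one of them only rarely.
    Averaging the count over the shifts i < n transfers this to all pairs. *)
Lemma near_pairs_rare_one (l p h K : nat) :
  (1 < l)%N -> (1 < p)%N -> coprime l p -> (0 < h)%N -> (0 < K)%N ->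
  exists b0, forall B J, (K * \sum_(b < B) \sum_(j < J)
     (b0 <= b) * [&& p ^ j <= l ^ b, l ^ b < l * p ^ j & near_multiple K (p ^ j) (h * l ^ b)]
   <= 144 * (B * (trunc_log 2 (4 * l)).+1))%N.
Proof.
move=> l1 p1 cop h0 K0; pose R := rat.
have l0 := ltnW l1; have p0 := ltnW p1.
have KR : (0 : R) < K%:R by rewrite ltr0n.
have lR : (1 : R) < l%:R by rewrite ltr1n.
have hR : (0 : R) < h%:R by rewrite ltr0n.
pose d : R := (K%:R * h%:R * l%:R)^-1.
have KK : (1 : R) <= K%:R by rewrite (ler_nat _ 1).
have hh : (1 : R) <= h%:R by rewrite (ler_nat _ 1).
have d0 : 0 < d by rewrite invr_gt0 !mulr_gt0 //; lra.
have d1 : d <= 1.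
  by rewrite invf_le1 ?mulr_gt0 //; [rewrite !mulr_ege1 // ltW | lra].
have [s [t]] := power_ratio_above1 l1 p1 cop d0.
set k := _ / _ => /andP[k1 kd].
have k0 : 0 < k by lra.
have exn : exists n, 2 <= k ^+ n by apply: exists_expr_ge.
case: (ex_minnP exn) => n kn2 nmin.
have n0 : (0 < n)%N by case: (n) kn2 => //; rewrite expr0; lra.
have kn4 : k ^+ n <= 4.
  rewrite -(prednK n0) exprSr.
  have : k ^+ n.-1 < 2.
    by rewrite ltNge; apply/negP => /nmin; rewrite leqNgt ltn_predL n0.
  have : 0 < k ^+ n.-1 by rewrite exprn_gt0.
  move: (k ^+ n.-1) => X; nra.
(* Beyond n s all shifts back by (i s, i t), i < n, stay in the quadrant. *)
exists (n * s).+1 => B J.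
have pR i : (0 : R) < (p ^ i)%:R by rewrite ltr0n expn_gt0 p0.
have lRp i : (0 : R) < (l ^ i)%:R by rewrite ltr0n expn_gt0 l0.
have kE m : k ^+ m = (l ^ (m * s))%:R / (p ^ (m * t))%:R.
  by rewrite /k expr_div_n -!natrX -!expnM ![(_ * m)%N]mulnC.
have kpow m : (m <= n)%N -> k ^+ m <= 4.
  by move=> hm; apply: le_trans kn4; rewrite ler_weXn2l // ltW.
have kge m : 1 <= k ^+ m by rewrite exprn_ege1 // ltW.
pose bad b j := near_multiple K (p ^ j) (h * l ^ b).
pose strip b j := ((p ^ j <= 4 * l ^ b) && (l ^ b < l * p ^ j))%N.
set S := (\sum_(b < B) _)%N.
have step (m : 'I_n) : (S <= \sum_(b < B) \sum_(j < J)
    strip b j * bad (b + m * s) (j + m * t))%N.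
  apply: (@leq_trans (\sum_(b < B) (m * s <= b) * \sum_(j < J) (m * t <= j) *
      (strip (b - m * s) (j - m * t) * bad b j))%N).
    apply: leq_sum => b _; rewrite -big_distrr /=.
    have [nb|] := ltnP (n * s) b; last by rewrite mul0n.
    have mb : (m * s < b)%N by apply: leq_ltn_trans nb; rewrite leq_mul2r ltnW ?orbT.
    rewrite (ltnW mb) !mul1n; apply: leq_sum => j _.
    case: and3P => // -[h1 h2 h3].
    have mj : (m * t <= j)%N.
      rewrite -ltnS -(@ltn_exp2l p) //.
      rewrite -(@ltn_pmul2l l) //.
      have a2 : (p ^ (m * t) <= l ^ (m * s))%N.
        by have := kge m; rewrite kE ler_pdivlMr // mul1r ler_nat.
      have a1 : (l ^ (m * s) * l <= l ^ b)%N by rewrite -expnSr leq_exp2l.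
      apply: (@leq_ltn_trans (l ^ b)%N).
        by apply: leq_trans a1; rewrite mulnC leq_mul2r a2 orbT.
      by apply: leq_trans h2 _; rewrite leq_mul2l leq_pexp2l ?orbT.
    rewrite mj mul1n /bad h3 muln1.
    have eb : (l ^ b = l ^ (b - m * s) * l ^ (m * s))%N by rewrite -expnD subnK // ltnW.
    have ej : (p ^ j = p ^ (j - m * t) * p ^ (m * t))%N by rewrite -expnD subnK.
    have a1 : (l ^ (m * s) <= 4 * p ^ (m * t))%N.
      have := kpow m (ltnW (ltn_ord m)); rewrite kE ler_pdivrMr //.
      by rewrite -natrM ler_nat.
    have a2 : (p ^ (m * t) <= l ^ (m * s))%N.
      by have := kge m; rewrite kE ler_pdivlMr // mul1r ler_nat.
    have pm : (0 < p ^ (m * t))%N by rewrite expn_gt0 p0.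
    have lm : (0 < l ^ (m * s))%N by rewrite expn_gt0 l0.
    suff -> : strip (b - m * s)%N (j - m * t)%N by [].
    rewrite /strip; move: h1 h2; rewrite eb ej.
    move: (l ^ (b - _))%N (p ^ (j - _))%N (l ^ (m * s))%N (p ^ (m * t))%N a1 a2 pm lm.
    move=> x y u v a1 a2 v0 u0 h1 h2; apply/andP; split.
      rewrite -(leq_pmul2r v0); apply: (leq_trans h1).
      by rewrite [(4 * _)%N]mulnC -mulnA leq_mul2l a1 orbT.
    rewrite -(ltn_pmul2r u0); apply: (leq_trans h2).
    by rewrite mulnA leq_mul2l a2 orbT.
  apply: leq_trans (sum_shift_le (fun b => \sum_(j < J) (m * t <= j) *
      (strip (b - m * s) (j - m * t) * bad b j))%N (m * s) B) _.
  apply: leq_sum => b _; rewrite addnK.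
  apply: leq_trans (sum_shift_le (fun j =>
      (strip b (j - m * t) * bad (b + m * s) j))%N (m * t) J) _.
  by apply: leq_sum => j _; rewrite addnK.
have tot : (n * S <= \sum_(b < B) \sum_(j < J) strip b j *
     \sum_(m < n) bad (b + m * s) (j + m * t))%N.
  apply: (@leq_trans (\sum_(m < n) S)); first by rewrite sum_nat_const card_ord.
  apply: (@leq_trans (\sum_(m < n) \sum_(b < B) \sum_(j < J)
    strip b j * bad (b + m * s) (j + m * t)))%N; first by apply: leq_sum => m _.
  rewrite exchange_big /=; apply: leq_sum => b _.
  rewrite exchange_big /=; apply: leq_sum => j _.
  by rewrite big_distrr.
have inner b j : strip b j -> (K * \sum_(m < n) bad (b + m * s) (j + m * t) <= 144 * n)%N.
  case/andP => s1 s2; rewrite -(ler_nat R) !natrM.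
  pose z : R := h%:R * ((l ^ b)%:R / (p ^ j)%:R).
  have G := @geometric_near_integers R z k K%:R^-1 n
     (fun m => bad (b + m * s)%N (j + m * t)%N) k1.
  have z4 : 4^-1 <= z.
    rewrite /z; apply: (@le_trans _ _ ((l ^ b)%:R / (p ^ j)%:R)).
      by rewrite ler_pdivlMr // mulrC ler_pdivrMr // mulrC -natrM ler_nat.
    by rewrite ler_peMl // divr_ge0 // ltW.
  have zk : z * (k - 1) <= K%:R^-1.
    have zl : z <= h%:R * l%:R.
      by rewrite /z ler_pM2l // ler_pdivrMr // -natrM ler_nat ltnW.
    have kdd : k - 1 <= d by lra.
    apply: (@le_trans _ _ (h%:R * l%:R * d)).
      by apply: ler_pM => //; lra.
    rewrite /d; have -> : h%:R * l%:R * (K%:R * h%:R * l%:R)^-1 = K%:R^-1 :> R.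
      by field; rewrite !gt_eqF //; lra.
    by [].
  have K1 : K%:R^-1 <= 1 :> R by rewrite invf_le1.
  have HP i : bad (b + i * s)%N (j + i * t)%N ->
      exists a : nat, `|z * k ^+ i - a%:R| < K%:R^-1.
    move=> /(near_multiple_real R K0) H.
    have [|a ha] := H; first by rewrite expn_gt0 p0.
    exists a; move: ha; rewrite kE /z natrM !expnD !natrM.
    set X := (X in `|X - _|); set Y := (Y in _ -> `|Y - _| < _).
    suff -> : X = Y by [].
    by rewrite /X /Y; field; rewrite !gt_eqF.
  have := G z4 zk K1 kn2 kn4 HP.
  rewrite -(ler_pM2l KR) cancel_scale ?gt_eqF //.
have count b : (\sum_(j < J) strip b j <= (trunc_log 2 (4 * l)).+1)%N.
  apply: leq_trans (_ : _ <= (trunc_log p (4 * l %/ 1)).+1)%N _; last first.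
    rewrite divn1 ltnS; apply: trunc_log_max => //.
    apply: leq_trans (trunc_logP p1 _); last by rewrite muln_gt0 l0.
    exact: leq_exp_base.
  apply: leq_trans (power_window_count J (4 * l ^ b) (4 * l) p1 (ltn0Sn 0)).
  apply: leq_sum => j _; rewrite /strip muln1 -mulnA leq_mul2l /=.
  case: (p ^ j <= _)%N => //=; case: ltnP => // h1.
  by rewrite (ltnW h1).
rewrite -(leq_pmul2l n0) mulnCA.
apply: (@leq_trans (K * \sum_(b < B) \sum_(j < J) strip b j *
     \sum_(m < n) bad (b + m * s) (j + m * t)))%N; first by rewrite leq_mul2l tot orbT.
apply: (@leq_trans (\sum_(b < B) \sum_(j < J) strip b j * (144 * n)))%N.
  rewrite big_distrr; apply: leq_sum => b _; rewrite big_distrr; apply: leq_sum => j _ /=.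
  rewrite mulnCA; case sb: (strip b j); rewrite ?mul0n // !mul1n.
  exact: inner.
apply: (@leq_trans (\sum_(b < B) (trunc_log 2 (4 * l)).+1 * (144 * n)))%N.
  apply: leq_sum => b _; rewrite -big_distrl /= leq_mul2r count orbT //.
by rewrite sum_nat_const card_ord mulnA [(n * _)%N]mulnC -(mulnA 144) [(144 * (_ * _))%N]mulnCA.
Qed.

(** Each denominator h <= H contributes through [near_pairs_rare_one]; the bound is
    useful since K can be chosen large after H. *)
Lemma near_pairs_rare (l p H K : nat) :
  (1 < l)%N -> (1 < p)%N -> coprime l p -> (0 < K)%N ->
  exists b0, forall B J, (K * \sum_(b < B) \sum_(j < J)
     (b0 <= b) * [&& p ^ j <= l ^ b, l ^ b < l * p ^ j & ~~ spread H K (p ^ j) (l ^ b)]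
   <= 144 * H * (B * (trunc_log 2 (4 * l)).+1))%N.
Proof.
move=> l1 p1 cop K0; elim: H => [|H [b1 IH]].
  exists 0%N => B J; rewrite big1 ?muln0 // => b _; rewrite big1 // => j _.
  by rewrite !andbF.
have [b2 H2] := near_pairs_rare_one l1 p1 cop (ltn0Sn H) K0.
exists (maxn b1 b2) => B J.
have := leq_add (IH B J) (H2 B J); rewrite -mulnDr -big_split /=.
rewrite -mulnDl -mulnSr; apply: leq_trans; rewrite leq_mul2l; apply/orP; right.
apply: leq_sum => b _; rewrite -big_split /=; apply: leq_sum => j _.
rewrite geq_max; case: (b1 <= b)%N => //=; case: (b2 <= b)%N => //=; rewrite !mul1n.
rewrite /spread /index_iota !subSS !subn0 -[in X in iota 1 X]addn1 iotaD all_cat [all _ (iota _ 1)]/= andbT add1n.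
case: (p ^ j <= _)%N => //=; case: (_ < _)%N => //=; by case: all; case: near_multiple.
Qed.

(** * Greedy choice against several drifting sums *)

(** The square of the negative part is 2-smooth, hence lies below its second-order
    expansion. *)
Lemma sqr_min0D (R : realDomainType) (x y : R) :
  Num.min (x + y) 0 ^+ 2 <= Num.min x 0 ^+ 2 + 2 * Num.min x 0 * y + y ^+ 2.
Proof.
case: (leP x 0) => hx; case: (leP (x + y) 0) => hxy; nra.
Qed.

Lemma exists_le_average (R : realDomainType) (C : nat) (F : nat -> R) (B : R) :
  (0 < C)%N -> \sum_(c < C) F c <= C%:R * B -> exists2 c, (c < C)%N & F c <= B.
Proof.
move=> C0 H.
have [/existsP[c hc]|/existsPn no] := boolP [exists c : 'I_C, F c <= B].
  by exists (c : nat).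
have : \sum_(c < C) B < \sum_(c < C) F c.
  apply: ltr_sum; first by apply/hasP; exists (Ordinal C0); rewrite ?mem_index_enum.
  by move=> c _; rewrite ltNge no.
by rewrite sumr_const card_ord -mulr_natl ltNge H.
Qed.

(** Potential argument: [next i s c] are the possible successors of the state [s],
    and the increments Y p of the m running sums have nonnegative mean over the
    choices c.  By [sqr_min0D] the sum of the squared negative parts then grows
    by at most m M^2 on average, so some choice does no worse; after n steps
    every sum is at least - M sqrt(mn). *)
Lemma greedy_potential (R : realDomainType) (m C : nat) (next : nat -> nat -> nat -> nat)
    (Inv : nat -> nat -> Prop) (Y : nat -> nat -> nat -> R) (M : R) (s0 : nat) :
  (0 < C)%N -> Inv 0%N s0 ->
  (forall i s c, (c < C)%N -> Inv i s -> Inv i.+1 (next i s c)) ->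
  (forall p i s, Inv i s -> 0 <= \sum_(c < C) Y p i (next i s c)) ->
  (forall p i s, `|Y p i s| <= M) ->
  forall n, exists st : nat -> nat, [/\ st 0%N = s0,
    forall i, (i < n)%N -> exists2 c, (c < C)%N & st i.+1 = next i (st i) c,
    forall i, (i <= n)%N -> Inv i (st i) &
    \sum_(p < m) Num.min (\sum_(i < n) Y p i (st i.+1)) 0 ^+ 2 <= (m * n)%:R * M ^+ 2].
Proof.
move=> C0 I0 Im HY HM; elim=> [|n [st [st0 stS stI pot]]].
  exists (fun=> s0); split=> // [i|]; first by rewrite leqn0 => /eqP->.
  by rewrite muln0 mul0r big1 // => p _; rewrite big_ord0 minxx expr0n.
pose D p := \sum_(i < n) Y p i (st i.+1).
pose F c := \sum_(p < m) Num.min (D p + Y p n (next n (st n) c)) 0 ^+ 2.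
have cst k (x : R) : \sum_(i < k) x = k%:R * x by rewrite sumr_const card_ord mulr_natl.
have [c cC hc] : exists2 c, (c < C)%N & F c <= (m * n.+1)%:R * M ^+ 2.
  apply: exists_le_average => //.
  apply: (@le_trans _ _ (\sum_(c < C) \sum_(p < m) (Num.min (D p) 0 ^+ 2 +
     2 * Num.min (D p) 0 * Y p n (next n (st n) c) + M ^+ 2))).
    apply: ler_sum => c _; apply: ler_sum => p _.
    apply: le_trans (sqr_min0D _ _) _; rewrite lerD2l.
    by have := HM p n (next n (st n) c); rewrite ler_norml => /andP[]; nra.
  rewrite exchange_big /=.
  apply: (@le_trans _ _ (\sum_(p < m) (C%:R * Num.min (D p) 0 ^+ 2 + C%:R * M ^+ 2))).
    apply: ler_sum => p _; rewrite !big_split /= !cst.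
    rewrite lerD2r gerDl -mulr_sumr mulr_le0_ge0 ?(HY p n _ (stI n (leqnn n))) //.
    by rewrite mulr_ge0_le0 // ge_min lexx orbT.
  rewrite big_split /= -mulr_sumr cst.
  have -> : (m * n.+1)%:R * M ^+ 2 = (m * n)%:R * M ^+ 2 + m%:R * M ^+ 2.
    by rewrite mulnS natrD mulrDl addrC.
  by rewrite mulrDr mulrCA lerD2r ler_wpM2l.
exists (fun i => if (i <= n)%N then st i else next n (st n) c); split.
- by [].
- move=> i; rewrite ltnS => hi; have [->|ne] := eqVneq i n.
    by rewrite ltnn leqnn; exists c.
  have h : (i < n)%N by rewrite ltn_neqAle ne.
  by rewrite h hi; apply: stS.
- move=> i hi; have [->|ne] := eqVneq i n.+1.
    by rewrite ltnn; apply: Im => //; apply: stI.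
  have h : (i <= n)%N by rewrite -ltnS ltn_neqAle ne.
  by rewrite h; apply: stI.
- move: hc; rewrite /F; apply: le_trans; rewrite le_eqVlt; apply/orP; left; apply/eqP.
  apply: eq_bigr => p _; rewrite big_ord_recr /= ltnn; congr (Num.min (_ + _) _ ^+ 2).
  by apply: eq_bigr => i _; rewrite ltn_ord.
Qed.

(** * Descent through a range of scales *)

Lemma frac_div_sub (R : realFieldType) (Q x y : nat) : (0 < Q)%N -> (y <= x)%N ->
  frac_div R Q x - (x - y)%:R / Q%:R <= frac_div R Q y.
Proof.
move=> Q0 yx; have QR : (0 : R) < Q%:R by rewrite ltr0n.
rewrite /frac_div lerBlDr -mulrDl ler_pM2r ?invr_gt0 // -natrD ler_nat.
rewrite -{1}(subnKC yx) -modnDml; exact: leq_mod.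
Qed.

Lemma frac_div_below_multiple (R : realFieldType) (Q x y : nat) : (0 < Q)%N ->
  (y < x)%N -> (Q %| x)%N -> 1 - (x - y)%:R / Q%:R <= frac_div R Q y.
Proof.
move=> Q0 yx Qx; have QR : (0 : R) < Q%:R by rewrite ltr0n.
rewrite /frac_div lerBlDr -mulrDl ler_pdivlMr // mul1r -natrD ler_nat.
apply: dvdn_leq; first by rewrite addn_gt0 subn_gt0 yx orbT.
by rewrite /dvdn modnDml subnKC // ltnW.
Qed.

(** [block_average] read downwards, for K small against C and H large against 1. *)
Lemma frac_div_block (R : realFieldType) (H K C Q G x : nat) (e : R) :
  (0 < Q)%N -> (0 < K)%N -> (0 < H)%N -> (0 < C)%N ->
  K%:R <= e * C%:R -> 5 <= e * H%:R -> (C * G <= x)%N -> spread H K Q G ->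
  C%:R * (2^-1 - e) <= \sum_(c < C) frac_div R Q (x - c * G).
Proof.
move=> Q0 K0 H0 C0 eK eH Cx sp.
have QR : (0 : R) < Q%:R by rewrite ltr0n.
have HR : (0 : R) < H%:R by rewrite ltr0n.
have CR : (0 : R) < C%:R by rewrite ltr0n.
have -> : \sum_(c < C) frac_div R Q (x - c * G) =
   (\sum_(c < C) (x - C.-1 * G + c * G) %% Q)%N%:R / Q%:R.
  rewrite natr_sum mulr_suml (reindex_inj rev_ord_inj) /=.
  apply: eq_bigr => c _; rewrite /frac_div; congr ((_ %% _)%N%:R / _).
  have cC := ltn_ord c.
  have : (C.-1 * G <= x)%N by apply: leq_trans Cx; rewrite leq_mul2r leq_pred orbT.
  have -> : (C.-1 = c + (C - c.+1))%N by lia.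
  by rewrite mulnDl; lia.
rewrite ler_pdivlMr //.
have := block_average C (x - C.-1 * G) Q0 K0 sp.
move: (\sum_(c < C) _)%N => S; rewrite -(ler_nat R) !natrD !natrM.
move: (S%:R : R) => s hS.
rewrite -(ler_pM2l HR).
have h1 : H%:R * (K%:R * Q%:R) <= H%:R * (e * C%:R * Q%:R).
  by rewrite ler_pM2l // ler_pM2r.
have h2 : 5 * (C%:R * Q%:R) <= e * H%:R * (C%:R * Q%:R).
  by rewrite ler_pM2r // mulr_gt0.
lra.
Qed.

(** The powers p^j whose residues are decided by the multiple of G_i that is
    subtracted: what is subtracted later is small against T G_(i+1). *)
Definition in_block (T : nat) (G : nat -> nat) (p i j : nat) : bool :=
  (T * G i.+1 <= p ^ j <= G i)%N.

(** From a multiple of G_0 walk down by c_i G_i with digits c_i < C.  After step i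
    the total of all later moves is at most 2C G_(i+1), which is at most e p^j for
    p^j in block i, so the fractional part modulo p^j is decided up to e.  If p^j
    divides G_i, the final number is slightly below a multiple of p^j and the
    fractional part is close to 1 whatever the digits.  Otherwise the digits have
    mean effect 1/2 as soon as G_i is spread modulo p^j, and [greedy_potential]
    chooses them for all p < m at the same time. *)
Lemma greedy_descent (R : rcfType) (m H K C T J n M : nat) (e : R) (G : nat -> nat) (A0 : nat) :
  (0 < C)%N -> (0 < K)%N -> (0 < H)%N -> 0 < e < 2^-1 ->
  K%:R <= e * C%:R -> 5 <= e * H%:R -> 2 * C%:R <= e * T%:R ->
  (forall i, (0 < G i)%N) ->
  (forall i, (i < n)%N -> (G i.+1 %| G i)%N && (2 * C * G i.+1 <= G i)%N) ->
  (forall p i, (1 < p)%N -> (i < n)%N -> (\sum_(1 <= j < J) in_block T G p i j <= M)%N) ->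
  (G 0 %| A0)%N -> (2 * C * G 0 <= A0)%N ->
  exists A', [/\ (A' <= A0)%N, (A0 <= A' + 2 * C * G 0)%N, (G n <= A')%N,
    forall y p, (0 < y <= G n)%N -> (1 < p < m)%N ->
      \sum_(i < n) \sum_(1 <= j < J | in_block T G p i j)
         ((2^-1 - e) * (spread H K (p ^ j) (G i))%:R - e) - M%:R * Num.sqrt (m * n)%:R
      <= \sum_(i < n) \sum_(1 <= j < J | in_block T G p i j) frac_div R (p ^ j) (A' - y) &
    forall y p i j, (0 < y <= G n)%N -> (1 < p)%N -> (i < n)%N -> in_block T G p i j ->
      (p ^ j %| G i)%N -> 1 - e <= frac_div R (p ^ j) (A' - y)].
Proof.
move=> C0 K0 H0 /andP[e0 e2] eK eH eT G0 HG HM dA0 lA0.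
pose Y p i x : R := ((1 < p) && (i < n))%N%:R * \sum_(1 <= j < J | in_block T G p i j)
   (frac_div R (p ^ j) x - (2^-1 - e) * (spread H K (p ^ j) (G i))%:R).
pose Inv i s := (i <= n)%N -> (2 * C * G i <= s)%N /\ (G i %| s)%N.
pose move i s c := (s - c * G i)%N.
have pe p i : (1 < p)%N -> (0 < p ^ i)%N by move=> p1; rewrite expn_gt0 ltnW.
have Im i s c : (c < C)%N -> Inv i s -> Inv i.+1 (move i s c).
  move=> cC HI hin; have [h1 h2] := HI (ltnW hin); have /andP[h3 h4] := HG i hin.
  split; last by apply: dvdn_trans h3 _; rewrite dvdn_sub // dvdn_mull.
  apply: (leq_trans h4); rewrite /move leq_subRL; last first.
    by apply: leq_trans h1; rewrite leq_mul2r; lia.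
  by apply: leq_trans h1; rewrite -mulSnr leq_mul2r; lia.
have cst (x : R) : \sum_(c < C) x = C%:R * x by rewrite sumr_const card_ord mulr_natl.
have HY p i s : Inv i s -> 0 <= \sum_(c < C) Y p i (move i s c).
  move=> HI; have [/andP[p1 hin]|no] := boolP ((1 < p) && (i < n))%N; last first.
    by rewrite big1 // => c _; rewrite /Y (negbTE no) mul0r.
  have [h1 h2] := HI (ltnW hin).
  under eq_bigr => c _ do rewrite /Y p1 hin mul1r.
  rewrite exchange_big /=; apply: sumr_ge0 => j _.
  rewrite sumrB cst subr_ge0.
  case sp: (spread _ _ _ _); last first.
    by rewrite /= mulr0n !mulr0; apply: sumr_ge0 => c _; apply: frac_div_ge0.
  rewrite mulr1; apply: frac_div_block sp; rewrite ?pe //.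
  by apply: leq_trans h1; rewrite leq_mul2r; lia.
have HYM p i s : `|Y p i s| <= M%:R.
  have [/andP[p1 hin]|no] := boolP ((1 < p) && (i < n))%N; last first.
    by rewrite /Y (negbTE no) mul0r normr0.
  rewrite /Y p1 hin mul1r; apply: le_trans (ler_norm_sum _ _ _) _.
  have := HM p i p1 hin; rewrite -(ler_nat R); apply: le_trans.
  rewrite natr_sum [leLHS]big_mkcond /=; apply: ler_sum => j _.
  case: (in_block _ _ _ _ _) => //.
  have := frac_div_ge0 R (p ^ j) s; have := frac_div_lt1 R s (pe p j p1).
  case: (spread _ _ _ _) => /=; rewrite ler_norml => h1 h2; apply/andP; split; lra.
have I0 : Inv 0%N A0 by [].
have [st [st0 stS stI' pot]] := greedy_potential m C0 I0 Im HY HYM n.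
have stI i (h : (i <= n)%N) := stI' i h h.
have CR : (0 : R) < C%:R by rewrite ltr0n.
have tail i : (i <= n)%N -> (st i + G n <= st n + 2 * C * G i)%N.
  move=> hi; have [d ed] : exists d, (i + d = n)%N by exists (n - i)%N; lia.
  elim: d i hi ed => [|d IH] i hi ed.
    have -> : i = n by lia.
    by rewrite leq_add2l; have := G0 n; nia.
  have hin : (i < n)%N by lia.
  have ed' : (i.+1 + d = n)%N by lia.
  have := IH i.+1 hin ed'.
  have [c cC ->] := stS i hin; have /andP[_ h4] := HG i hin.
  have [h1 _] := stI i (ltnW hin).
  rewrite /move.
  have : (c * G i + G i <= C * G i)%N by rewrite -mulSnr leq_mul2r cC orbT.
  lia.
have dec : (st n <= st 0%N)%N.
  have : forall i, (i <= n)%N -> (st i <= st 0%N)%N.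
    elim=> // i IH hi; have [c _ ->] := stS i hi.
    by apply: leq_trans (leq_subr _ _) (IH _); rewrite ltnW.
  by apply.
have later y p i j : (0 < y <= G n)%N -> (1 < p)%N -> (i < n)%N -> in_block T G p i j ->
   (st n - y < st i.+1)%N /\ (st i.+1 - (st n - y))%:R / (p ^ j)%:R <= e.
  move=> /andP[y0 yG] p1 hin /andP[h1 _].
  have t := tail i.+1 hin.
  have [l1 _] := stI n (leqnn n).
  have Gn : (G n <= 2 * C * G n)%N by have := G0 n; nia.
  have le1 : (st n <= st i.+1)%N.
    have : forall d, (i.+1 + d <= n)%N -> (st (i.+1 + d) <= st i.+1)%N.
      elim=> [|d IH] hd; first by rewrite addn0.
      rewrite addnS; have [|c _ ->] := stS (i.+1 + d)%N; first by lia.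
      by apply: leq_trans (leq_subr _ _) (IH _); lia.
    by move/(_ (n - i.+1)%N); rewrite subnKC //; apply.
  split; first by lia.
  rewrite ler_pdivrMr ?ltr0n ?pe //.
  apply: (@le_trans _ _ (2 * C%:R * (G i.+1)%:R)).
    rewrite -!natrM ler_nat; lia.
  apply: (@le_trans _ _ (e * T%:R * (G i.+1)%:R)).
    by rewrite ler_wpM2r.
  by rewrite -mulrA ler_pM2l // -natrM ler_nat.
exists (st n); split.
- by rewrite -st0.
- by have := tail 0%N (leq0n n); rewrite st0; lia.
- by have [h _] := stI n (leqnn n); apply: leq_trans h; have := G0 n; nia.
- move=> y p hy /andP[p1 pm].
  have D1 : \sum_(i < n) Y p i (st i.+1) =
    \sum_(i < n) \sum_(1 <= j < J | in_block T G p i j)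
      (frac_div R (p ^ j) (st i.+1) - (2^-1 - e) * (spread H K (p ^ j) (G i))%:R).
    by apply: eq_bigr => i _; rewrite /Y p1 ltn_ord mul1r.
  have D2 : - (M%:R * Num.sqrt (m * n)%:R) <= \sum_(i < n) Y p i (st i.+1).
    have : Num.min (\sum_(i < n) Y p i (st i.+1)) 0 ^+ 2 <= (M%:R * Num.sqrt (m * n)%:R) ^+ 2.
      rewrite exprMn sqr_sqrtr // mulrC; apply: le_trans pot.
      by rewrite (bigD1 (Ordinal pm)) //= lerDl sumr_ge0 // => *; rewrite sqr_ge0.
    have s0 : 0 <= M%:R * Num.sqrt (m * n)%:R :> R by rewrite mulr_ge0 ?sqrtr_ge0.
    move: s0; move: (M%:R * _) (\sum_(i < n) _) => x z x0.
    by case: (leP z 0) => hz h; [nra | lra].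
  apply: (@le_trans _ _ (\sum_(i < n) \sum_(1 <= j < J | in_block T G p i j)
     (frac_div R (p ^ j) (st i.+1) - e))); last first.
    apply: ler_sum => i _; apply: ler_sum => j hj.
    have [h1 h2] := later y p i j hy p1 (ltn_ord i) hj.
    by apply: le_trans (frac_div_sub R (pe p j p1) (ltnW h1)); rewrite lerD2l lerN2.
  have dB (f g : nat -> nat -> R) :
    \sum_(i < n) \sum_(1 <= j < J | in_block T G p i j) (f i j - g i j) =
    \sum_(i < n) \sum_(1 <= j < J | in_block T G p i j) f i j -
    \sum_(i < n) \sum_(1 <= j < J | in_block T G p i j) g i j.
    by rewrite -sumrB; apply: eq_bigr => i _; rewrite sumrB.
  move: D2; rewrite D1.
  rewrite (dB (fun i j => frac_div R (p ^ j) (st i.+1))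
    (fun i j => (2^-1 - e) * (spread H K (p ^ j) (G i))%:R)).
  rewrite (dB (fun i j => frac_div R (p ^ j) (st i.+1)) (fun _ _ => e)).
  rewrite (dB (fun i j => (2^-1 - e) * (spread H K (p ^ j) (G i))%:R) (fun _ _ => e)).
  lra.
- move=> y p i j hy p1 hin hj dv.
  have [h1 h2] := later y p i j hy p1 hin hj.
  have dst : (p ^ j %| st i.+1)%N.
    have [c cC ->] := stS i hin; have [_ h3] := stI i (ltnW hin).
    by apply: (dvdn_trans dv); rewrite dvdn_sub // dvdn_mull.
  by apply: le_trans (frac_div_below_multiple R (pe p j p1) h1 dst); rewrite lerD2l lerN2.
Qed.

(** Blocks of different steps are disjoint. *)
Lemma sum_in_block_le (R : realFieldType) (T J n : nat) (G : nat -> nat) (p : nat) (f : nat -> R) :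
  (1 < T)%N -> (forall j, 0 <= f j) -> (forall i, (0 < G i)%N) ->
  (forall i, (i < n)%N -> (G i.+1 <= G i)%N) ->
  \sum_(i < n) \sum_(1 <= j < J | in_block T G p i j) f j <=
  \sum_(1 <= j < J | (G n < p ^ j <= G 0%N)%N) f j.
Proof.
move=> T1 f0 G0 Gd.
have mono a b : (a <= b <= n)%N -> (G b <= G a)%N.
  elim: b => [|b IH]; first by rewrite leqn0 andbC => /andP[_ /eqP->].
  rewrite leq_eqVlt => /andP[/orP[/eqP->//|ab] bn].
  by apply: leq_trans (Gd b bn) (IH _); rewrite -ltnS ab ltnW.
have -> : \sum_(i < n) \sum_(1 <= j < J | in_block T G p i j) f j =
   \sum_(1 <= j < J) (\sum_(i < n) in_block T G p i j)%N%:R * f j.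
  under eq_bigr do rewrite big_mkcond /=.
  rewrite exchange_big /=; apply: eq_bigr => j _.
  by rewrite natr_sum mulr_suml; apply: eq_bigr => i _; case: in_block; rewrite ?mul1r ?mul0r.
rewrite [leRHS]big_mkcond /=; apply: ler_sum => j _.
have one : (\sum_(i < n) in_block T G p i j <= 1)%N.
  apply: (@count_clustered (fun i => in_block T G p i j) 0) => a b /andP[ab bn].
  move=> /andP[h1 _] /andP[_ h2].
  have : (G b <= G a.+1)%N by apply: mono; rewrite ab ltnW.
  have := G0 a.+1; nia.
have [_|no] := boolP (G n < p ^ j <= G 0%N)%N.
  by rewrite -[leRHS]mul1r ler_wpM2r // (ler_nat _ _ 1).
rewrite big1 ?mul0r // => i _; case: (boolP (in_block _ _ _ _ _)) => // /andP[h1 h2].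
case/negP: no; apply/andP; split.
  have : (G n <= G i.+1)%N by apply: mono; rewrite ltn_ord leqnn.
  have := G0 i.+1; nia.
by apply: leq_trans h2 (mono _ _ _); rewrite /= ltnW.
Qed.

(** * Logarithmic counts of prime powers *)

Lemma exists_nat_ge (R : realType) (x : R) (k : nat) : exists n, (k < n)%N /\ x <= n%:R.
Proof.
exists (k + Num.truncn x).+1; split; first by rewrite ltnS leq_addr.
rewrite ltW //; apply: lt_le_trans (truncnS_gt x) _.
by rewrite ler_nat ltnS leq_addl.
Qed.

Lemma ln_natX (R : realType) (p j : nat) : (0 < p)%N -> ln ((p ^ j)%N%:R : R) = j%:R * ln p%:R.
Proof. by move=> p0; rewrite natrX lnXn ?ltr0n // mulr_natl. Qed.

Lemma ln_nat_gt0 (R : realType) (p : nat) : (1 < p)%N -> 0 < ln (p%:R : R).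
Proof. by move=> p1; rewrite ln_gt0 // ltr1n. Qed.

Lemma ler_ln_nat (R : realType) (a b : nat) : (0 < a)%N -> (a <= b)%N ->
  ln (a%:R : R) <= ln b%:R.
Proof.
move=> a0 ab; rewrite ler_ln ?posrE ?ltr0n ?ler_nat //; exact: leq_trans ab.
Qed.

Lemma ltr_ln_nat (R : realType) (a b : nat) : (0 < a)%N -> (a < b)%N ->
  ln (a%:R : R) < ln b%:R.
Proof.
move=> a0 ab; rewrite ltr_ln ?posrE ?ltr0n ?ltr_nat //; apply: leq_trans ab => //.
Qed.

Lemma count_powers_ge (R : realType) (p a b J : nat) : (1 < p)%N -> (1 < a)%N ->
  (0 < b)%N -> (b < 2 ^ J)%N ->
  (ln b%:R - ln a%:R) / ln p%:R - 1 <= (\sum_(1 <= j < J) (a <= p ^ j <= b)%N)%N%:R :> R.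
Proof.
move=> p1 a1 b0 bJ; have p0 := ltnW p1; have lp := ln_nat_gt0 R p1.
have /andP[u1 u2] := up_log_bounds p1 a1; have /andP[t1 t2] := trunc_log_bounds p1 b0.
set j1 := up_log p a in u1 u2; set j2 := trunc_log p b in t1 t2.
have j10 : (0 < j1)%N by rewrite /j1 up_log_gt0 p1.
have j2J : (j2 < J)%N.
  rewrite -(@ltn_exp2l 2) //; apply: leq_ltn_trans bJ; apply: leq_trans t1.
  exact: leq_exp_base.
have lb : ln b%:R < (j2%:R + 1) * ln p%:R :> R.
  by rewrite natr1 -ln_natX //; apply: ltr_ln_nat.
have la : (j1%:R - 1) * ln p%:R <= ln a%:R :> R.
  have -> : (j1%:R - 1 : R) = j1.-1%:R by rewrite -{1}(prednK j10) -natr1 addrK.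
  by rewrite -ln_natX //; apply: ler_ln_nat; [rewrite expn_gt0 p0 | exact: ltnW].
have key : (ln b%:R - ln a%:R) / ln p%:R - 1 <= j2%:R + 1 - j1%:R :> R.
  by rewrite lerBlDr ler_pdivrMr //; move: la lb; move: (ln b%:R) (ln a%:R) => x y; lra.
apply: (le_trans key).
have [h|h] := leqP j1 j2.+1; last first.
  apply: (@le_trans _ _ 0) => //; rewrite natr1 subr_le0 ler_nat; exact: ltnW.
rewrite natr1 -natrB // ler_nat.
have -> : (j2.+1 - j1 = \sum_(j1 <= j < j2.+1) 1)%N by rewrite sum_nat_const_nat muln1.
rewrite (@big_cat_nat _ _ _ j1 1 J) //=; last by apply: leq_trans h _.
rewrite (@big_cat_nat _ _ _ j2.+1 j1 J) //=.
apply: leq_trans (leq_addl _ _); apply: leq_trans (leq_addr _ _).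
rewrite !big_nat; apply: leq_sum => j /andP[h1 h2].
suff -> : (a <= p ^ j <= b)%N by [].
apply/andP; split; first by apply: (leq_trans u2); rewrite leq_exp2l.
by apply: leq_trans t1; rewrite leq_exp2l.
Qed.

Lemma uniform_bound (P : nat -> Prop) (Q : nat -> nat -> Prop) m :
  (forall p, P p -> exists b, Q p b) ->
  (forall p b b', (b <= b')%N -> Q p b -> Q p b') ->
  exists b, forall p, (p < m)%N -> P p -> Q p b.
Proof.
move=> H mono; elim: m => [|m [b Hb]]; first by exists 0%N.
have [/H[b' Hb']|no] := pselect (P m).
  exists (maxn b b') => p; rewrite ltnS leq_eqVlt => /orP[/eqP->|h] Pp.
    by apply: mono Hb'; rewrite leq_maxr.
  by apply: mono (Hb p h Pp); rewrite leq_maxl.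
exists b => p; rewrite ltnS leq_eqVlt => /orP[/eqP->|h] Pp //; exact: Hb.
Qed.

(** A block spans a factor at most q^S, hence at most log_p (q^S) + 1 powers. *)
Lemma sum_block_bound (T J q S i p : nat) (G : nat -> nat) : (0 < q)%N -> (1 < p)%N ->
  (0 < S)%N -> (0 < T)%N -> (G i = q ^ S * G i.+1)%N ->
  (\sum_(1 <= j < J) in_block T G p i j <= S * q)%N.
Proof.
move=> q0 p1 S0 T0 eG.
apply: (@leq_trans (\sum_(j < J) ((p ^ j <= G i) && (G i * 1 <= q ^ S * p ^ j)))%N).
  rewrite -(big_mkord xpredT (fun j => ((p ^ j <= G i) && (G i * 1 <= q ^ S * p ^ j) : nat)%N)).
  case: J => [|J]; first by rewrite big_geq.
  rewrite [leqRHS]big_ltn //; apply: leq_trans (leq_addl _ _).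
  apply: leq_sum => j _; rewrite /in_block muln1.
  have [h1|_] := leqP (T * G i.+1) (p ^ j); last by [].
  case: (p ^ j <= G i)%N => //=.
  suff -> : (G i <= q ^ S * p ^ j)%N by [].
  by rewrite eG leq_mul2l (leq_trans _ h1) ?orbT // leq_pmull.
apply: leq_trans (power_window_count J (G i) (q ^ S) p1 (ltn0Sn 0)) _.
rewrite divn1 -(@ltn_exp2l 2) //.
apply: (@leq_ltn_trans (p ^ trunc_log p (q ^ S))%N); first exact: leq_exp_base.
apply: (@leq_ltn_trans (q ^ S)%N); first by rewrite trunc_logP // expn_gt0 q0.
by rewrite mulnC expnM ltn_exp2r // ltn_expl.
Qed.

(** * One zone of scales *)

(** [greedy_descent] along the scales (q^S)^b for bl <= b <= bh.  Four
    hypotheses bound by fractions of eta S bh, in turn: the error e at each power, the pairs that fail to be spread, the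
    powers lost between consecutive blocks, and the error sqrt(mn) of the
    potential argument. *)
Lemma zone_descent_of_constants (R : realType) (q m H K C T S b1 : nat) (e eta : R) :
  prime q -> 0 < eta -> 0 < e -> e <= 4^-1 -> e * (16 * q%:R) <= eta ->
  (0 < H)%N -> 5 <= e * H%:R ->
  (0 < K)%N -> 3456 * H%:R * q%:R <= K%:R * eta ->
  (0 < C)%N -> K%:R <= e * C%:R ->
  (1 < T)%N -> 2 * C%:R <= e * T%:R ->
  (0 < S)%N -> 4 * (ln T%:R / ln 2 + 1) <= eta * S%:R -> (2 * C <= S)%N ->
  (forall p, (p < m)%N -> prime p /\ p != q -> forall B J,
    (K * \sum_(b < B) \sum_(j < J) (b1 <= b) *
      [&& p ^ j <= (q ^ S) ^ b, (q ^ S) ^ b < (q ^ S) * p ^ j & ~~ spread H K (p ^ j) ((q ^ S) ^ b)]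
      <= 144 * H * (B * (trunc_log 2 (4 * q ^ S)).+1))%N) ->
  forall bl bh A J, (0 < bh)%N -> (b1 <= bl)%N -> 16 * q%:R ^+ 2 * m%:R <= bh%:R * eta ^+ 2 ->
    (bl <= bh)%N -> ((2 * C).+1 * (q ^ S) ^ bh <= A)%N -> ((q ^ S) ^ bh < 2 ^ J)%N ->
  exists A', [/\ (A' <= A)%N, (A <= A' + (2 * C).+1 * (q ^ S) ^ bh)%N, ((q ^ S) ^ bl <= A')%N &
   forall y p, (0 < y <= (q ^ S) ^ bl)%N -> prime p -> (p < m)%N ->
    (if p == q then 1 else 2^-1) * ((bh - bl)%:R * (S%:R * ln q%:R / ln p%:R))
      - eta * (S * bh)%:R
    <= \sum_(1 <= j < J | ((q ^ S) ^ bl < p ^ j <= (q ^ S) ^ bh)%N) frac_div R (p ^ j) (A' - y)].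
Proof.
move=> pq eta0 e0 e4 eq16 H0 eH K0 eK C0 eC T1 eT S0 et CS Hb1 bl bh A J bh0 b1l n0l blh.
have q1 := prime_gt1 pq; have q0 := ltnW q1.
have qR : (0 : R) < q%:R by rewrite ltr0n.
have [l el] : exists l, l = (q ^ S)%N by exists (q ^ S)%N.
rewrite -!el in Hb1 * => lA lJ.
have lS : (S < l)%N.
  by rewrite el; apply: (@leq_trans (2 ^ S)%N); [exact: ltn_expl | exact: leq_exp_base].
have l0 : (0 < l)%N by apply: leq_ltn_trans lS.
have Cl : (2 * C <= l)%N by apply: leq_trans CS (ltnW lS).
have lnl : ln (l%:R : R) = S%:R * ln q%:R by rewrite el ln_natX.
have ln2 : 0 < ln (2 : R) by exact: ln_nat_gt0.
have lnT : 0 < ln (T%:R : R) by apply: ln_nat_gt0.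
have [t tE] : exists t : R, t = ln T%:R / ln 2 + 1 by exists (ln T%:R / ln 2 + 1).
rewrite -tE in et.
have t0 : 0 < t by rewrite tE addr_gt0 // divr_gt0.
pose G i := (l ^ (bh - i))%N; have [n nE] : exists n, n = (bh - bl)%N by exists (bh - bl)%N.
have G0 i : (0 < G i)%N by rewrite expn_gt0 l0.
have eG i : (i < n)%N -> (G i = l * G i.+1)%N.
  move=> hi; rewrite /G.
  have -> : (bh - i = (bh - i.+1).+1)%N by clear - hi nE blh; lia.
  by rewrite expnS.
have Gle i : (G i <= l ^ bh)%N by rewrite leq_pexp2l // leq_subr.
have Gn : G n = (l ^ bl)%N by rewrite /G nE subKn.
have GG0 : G 0%N = (l ^ bh)%N by rewrite /G subn0.
have nbh : (n <= bh)%N by rewrite nE leq_subr.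
have HG i : (i < n)%N -> (G i.+1 %| G i)%N && (2 * C * G i.+1 <= G i)%N.
  by move=> hi; rewrite (eG i hi) dvdn_mull //= leq_mul2r Cl orbT.
have HM p i : (1 < p)%N -> (i < n)%N ->
   (\sum_(1 <= j < J) in_block T G p i j <= S * q)%N.
  move=> p1 hi; have eGi : (G i = q ^ S * G i.+1)%N by rewrite -el; exact: eG.
  exact: (sum_block_bound J q0 p1 S0 (ltnW T1) eGi).
pose A0 := (A %/ G 0 * G 0)%N.
have dA0 : (G 0 %| A0)%N by rewrite dvdn_mull.
have lA0 : (2 * C * G 0 <= A0)%N.
  rewrite /A0 leq_mul2r leq_divRL // GG0; apply/orP; right.
  by apply: leq_trans lA; rewrite leq_mul2r leqnSn orbT.
have A0A : (A0 <= A)%N by rewrite leq_divM.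
have AA0 : (A < A0 + G 0)%N by rewrite /A0 addnC -mulSn ltn_ceil.
have e2 : 0 < e < 2^-1 by rewrite e0 /=; move: e4; clear; lra.
have [A' [A'1 A'2 A'3 A'4 A'5]] := greedy_descent m C0 K0 H0 e2 eC eH eT G0 HG HM dA0 lA0.
exists A'; split.
- exact: leq_trans A'1 A0A.
- by move: A'2 AA0; rewrite mulSn -GG0; clear; lia.
- by rewrite -Gn.
move=> y p hy pp pm; have p1 := prime_gt1 pp; have p0 := ltnW p1.
have lp := ln_nat_gt0 R p1.
rewrite -Gn in hy *; rewrite -GG0.
apply: le_trans (sum_in_block_le J p T1 _ G0 _); last 2 first.
- by move=> j; apply: frac_div_ge0.
- by move=> i hi; case/andP: (HG i hi) => h _; apply: dvdn_leq h.
pose a i : R := (\sum_(1 <= j < J) in_block T G p i j)%N%:R.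
set L := S%:R * _ / _.
have aL i : (i < n)%N -> L - t <= a i.
  move=> hi.
  have := @count_powers_ge R p (T * G i.+1) (G i) J p1.
  have T2 : (1 < T * G i.+1)%N by apply: (leq_trans T1); rewrite leq_pmulr.
  move=> /(_ T2 (G0 i) (leq_ltn_trans (Gle i) lJ)); apply: le_trans.
  rewrite eG // !natrM !lnM ?posrE ?ltr0n ?(ltnW T1) // lnl.
  have -> : S%:R * ln q%:R + ln (G i.+1)%:R - (ln T%:R + ln (G i.+1)%:R) =
    S%:R * ln q%:R - ln T%:R :> R by clear; lra.
  rewrite mulrBl -/L tE opprD addrA lerD2r lerD2l lerN2.
  rewrite ler_pM2l // lef_pV2 ?posrE //.
  exact: ler_ln_nat.
have aM i : (i < n)%N -> a i <= (S * q)%:R.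
  by move=> hi; rewrite ler_nat; apply: HM.
have cst (k : nat) (x : R) : \sum_(i < k) x = k%:R * x by rewrite sumr_const card_ord mulr_natl.
pose X := \sum_(i < n) a i.
have X1 : n%:R * (L - t) <= X by rewrite -cst; apply: ler_sum => i _; apply: aL.
have X2 : X <= n%:R * (S%:R * q%:R) by rewrite -natrM -cst; apply: ler_sum => i _; apply: aM.
have nb : n%:R <= bh%:R :> R by rewrite ler_nat.
have n0R : 0 <= n%:R :> R by [].
have SR : 0 < S%:R :> R by rewrite ltr0n.
have nS : n%:R * S%:R <= S%:R * bh%:R :> R by rewrite mulrC ler_pM2l.
have enS : eta * (n%:R * S%:R) <= eta * (S%:R * bh%:R) by rewrite ler_pM2l.
have nt : 4 * (n%:R * t) <= eta * (n%:R * S%:R).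
  have := ler_wpM2l n0R et; clear; lra.
have ne : 16 * (e * (n%:R * (S%:R * q%:R))) <= eta * (n%:R * S%:R).
  have nS0 : 0 <= n%:R * S%:R :> R by rewrite mulr_ge0.
  have := ler_wpM2r nS0 eq16; clear; lra.
have eX : e * X <= e * (n%:R * (S%:R * q%:R)) by rewrite ler_pM2l.
have e0X : 0 <= eta * (S%:R * bh%:R) by rewrite !mulr_ge0 // ltW.
rewrite natrM -nE.
case: eqP => [epq|/eqP npq].
  apply: (@le_trans _ _ (\sum_(i < n) (1 - e) * a i)).
    rewrite mul1r -mulr_sumr -/X.
    have := X1; clear X1 X2; rewrite mulrBr; move: enS nt ne eX e0X.
    move: (n%:R * L) (eta * (n%:R * S%:R)) (eta * (S%:R * bh%:R)) (n%:R * t) X.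
    by clear; move: (e * (n%:R * _)) => *; lra.
  apply: ler_sum => i _; rewrite /a natr_sum mulr_sumr [leRHS]big_mkcond /=.
  apply: ler_sum => j _; case ib: (in_block _ _ _ _ _); last by rewrite mulr0.
  rewrite mulr1; apply: (A'5 y p i j hy p1 (ltn_ord i) ib).
  case/andP: ib => _; rewrite /G el -expnM epq => h.
  by rewrite dvdn_exp2l // -(@leq_exp2l q).
have := A'4 y p hy; rewrite p1 pm => /(_ isT); apply: le_trans.
pose bad i := (\sum_(1 <= j < J) (in_block T G p i j && ~~ spread H K (p ^ j) (G i)))%N.
pose B := (\sum_(i < n) bad i)%N.
have low : (2^-1 - 2 * e) * X - B%:R <= \sum_(i < n) \sum_(1 <= j < J | in_block T G p i j)
   ((2^-1 - e) * (spread H K (p ^ j) (G i))%:R - e).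
  rewrite /B natr_sum /X mulr_sumr -sumrB; apply: ler_sum => i _.
  rewrite /a /bad !natr_sum mulr_sumr -sumrB [leRHS]big_mkcond /=; apply: ler_sum => j _.
  case: (in_block _ _ _ _ _) => /=; last by rewrite mulr0 subr0.
  move: e0; case: (spread _ _ _ _) => /=; clear; lra.
have badle : (K * B <= 144 * H * (bh.+1 * (trunc_log 2 (4 * l)).+1))%N.
  apply: leq_trans (Hb1 p pm (conj pp npq) bh.+1 J).
  rewrite leq_mul2l; apply/orP; right.
  pose F b := (\sum_(j < J) (b1 <= b) *
      [&& p ^ j <= l ^ b, l ^ b < l * p ^ j & ~~ spread H K (p ^ j) (l ^ b)])%N.
  have -> : (\sum_(b < bh.+1) F b = \sum_(i < bh.+1) F (bh - i))%N.
    by rewrite (reindex_inj rev_ord_inj) /=; apply: eq_bigr => i _; rewrite subSS.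
  apply: leq_trans (leq_sum_ord (fun i => F (bh - i)%N) (leqW nbh)).
  apply: leq_sum => i _; rewrite /bad /F.
  rewrite -(big_mkord xpredT (fun j => (b1 <= bh - i) * [&& p ^ j <= l ^ (bh - i),
     l ^ (bh - i) < l * p ^ j & ~~ spread H K (p ^ j) (l ^ (bh - i))])%N).
  case: (J) => [|J']; first by rewrite big_geq.
  rewrite [leqRHS]big_ltn //; apply: leq_trans (leq_addl _ _).
  have -> : (b1 <= bh - i)%N by move: (nat_of_ord i) (ltn_ord i) => i0; move: b1l; rewrite nE; clear; lia.
  apply: leq_sum => j _; rewrite mul1n.
  case ib: (in_block _ _ _ _ _) => //=; case: (spread _ _ _ _); rewrite ?andbF //= andbT.
  case/andP: ib => h1 h2; rewrite -/(G i) h2 /=.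
  suff -> : (G i < l * p ^ j)%N by [].
  rewrite eG // ltn_pmul2l //; apply: leq_trans h1.
  by rewrite ltn_Pmull.
have tl : ((trunc_log 2 (4 * l)).+1 <= 3 * (S * q))%N.
  have h : (4 * l < 2 ^ (q * S + 2))%N.
    by rewrite expnD mulnC ltn_pmul2r // el expnM ltn_exp2r // ltn_expl.
  have : (trunc_log 2 (4 * l) < q * S + 2)%N.
    rewrite -(@ltn_exp2l 2) //; apply: leq_ltn_trans h.
    by rewrite trunc_logP // muln_gt0 l0.
  have : (2 <= S * q)%N by apply: leq_trans (leq_pmull _ S0).
  clear; lia.
have KR : 0 < K%:R :> R by rewrite ltr0n.
have bB : 4 * B%:R <= eta * (S%:R * bh%:R).
  rewrite -(ler_pM2l KR).
  have h1 : (K * B <= 144 * H * (2 * bh * (3 * (S * q))))%N.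
    by apply: (leq_trans badle); rewrite leq_mul2l leq_mul ?orbT //; move: bh0; clear; lia.
  have h2 : K%:R * B%:R <= 864 * (H%:R * q%:R * (S%:R * bh%:R)) :> R.
    by move: h1; rewrite -(ler_nat R) !natrM => /le_trans; apply; clear; lra.
  have Sbh : 0 <= S%:R * bh%:R :> R by rewrite mulr_ge0.
  have := ler_wpM2r Sbh eK; move: h2; clear; lra.
have sq : 4 * ((S * q)%:R * Num.sqrt (m * n)%:R) <= eta * (S%:R * bh%:R).
  (* z is the size that sqrt(mn) may reach. *)
  pose z : R := eta * bh%:R / (4 * q%:R).
  have z0 : 0 <= z by rewrite divr_ge0 // mulr_ge0 // ltW.
  have hz : (m * n)%:R <= z ^+ 2.
    rewrite /z expr_div_n ler_pdivlMr ?exprn_gt0 ?mulr_gt0 //.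
    have h1 := n0l.
    rewrite natrM exprMn.
    have h2 := ler_wpM2r n0R h1.
    have h3 : bh%:R * eta ^+ 2 * n%:R <= bh%:R * eta ^+ 2 * bh%:R.
      by rewrite ler_wpM2l // mulr_ge0 // exprn_ge0 // ltW.
    move: h2 h3; clear; lra.
  have hs : Num.sqrt (m * n)%:R <= z.
    by rewrite -(ger0_norm z0) -sqrtr_sqr ler_wsqrtr.
  have Sq : 0 <= (S * q)%:R :> R by [].
  have := ler_wpM2l Sq hs; rewrite natrM.
  have -> : S%:R * q%:R * z = eta * (S%:R * bh%:R) / 4.
    by rewrite /z; field; rewrite gt_eqF.
  clear; lra.
apply: (@le_trans _ _ ((2^-1 - 2 * e) * X - B%:R - (S * q)%:R * Num.sqrt (m * n)%:R)).
  have := X1; clear X1 X2 low; rewrite mulrBr; move: enS nt ne eX bB sq e0X.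
  move: (n%:R * L) (eta * (n%:R * S%:R)) (eta * (S%:R * bh%:R)) (n%:R * t) ((S * q)%:R * _) X.
  by clear; move: (e * (n%:R * _)) => *; lra.
by rewrite lerD2r.
Qed.

(** Between the scales (q^S)^bl and (q^S)^bh a number can be lowered so that,
    even after a further shift by y, the fractional parts modulo powers of q have
    mean almost 1 and those modulo powers of every other prime p < m have mean
    almost 1/2.  The factor S ln q / ln p is the number of powers of p in one step. *)
Lemma zone_descent (R : realType) (q m : nat) (eta : R) : prime q -> 0 < eta ->
  exists S M0 b0 : nat, [/\ (0 < S)%N, (0 < M0)%N &
  forall bl bh A J, (b0 <= bl)%N -> (bl <= bh)%N ->
    (M0 * (q ^ S) ^ bh <= A)%N -> ((q ^ S) ^ bh < 2 ^ J)%N ->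
  exists A', [/\ (A' <= A)%N, (A <= A' + M0 * (q ^ S) ^ bh)%N, ((q ^ S) ^ bl <= A')%N &
   forall y p, (0 < y <= (q ^ S) ^ bl)%N -> prime p -> (p < m)%N ->
    (if p == q then 1 else 2^-1) * ((bh - bl)%:R * (S%:R * ln q%:R / ln p%:R))
      - eta * (S * bh)%:R
    <= \sum_(1 <= j < J | ((q ^ S) ^ bl < p ^ j <= (q ^ S) ^ bh)%N) frac_div R (p ^ j) (A' - y)]].
Proof.
move=> pq eta0; have q1 := prime_gt1 pq; have q0 := ltnW q1.
have qR : (0 : R) < q%:R by rewrite ltr0n.
have [e [e0 e4 eq16]] : exists e : R, [/\ 0 < e, e <= 4^-1 & e * (16 * q%:R) <= eta].
  exists (Num.min (eta / (16 * q%:R)) 4^-1); split.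
  - by rewrite lt_min divr_gt0 ?mulr_gt0 // invr_gt0 ltr0n.
  - by rewrite ge_min lexx orbT.
  - by rewrite -ler_pdivlMr ?mulr_gt0 // ge_min lexx.
have [H [H0 eH]] := exists_nat_ge (5 / e) 0.
rewrite ler_pdivrMr // mulrC in eH.
have [K [K0 eK]] := exists_nat_ge (3456 * H%:R * q%:R / eta) 0.
rewrite ler_pdivrMr // in eK.
have [C [C0 eC]] := exists_nat_ge (K%:R / e) 0.
rewrite ler_pdivrMr // [leRHS]mulrC in eC.
have [T [T1 eT]] := exists_nat_ge (2 * C%:R / e) 1.
rewrite ler_pdivrMr // [leRHS]mulrC in eT.
have [S [S2 et]] := exists_nat_ge (4 * (ln T%:R / ln 2 + 1) / eta) (2 * C).
rewrite ler_pdivrMr // [leRHS]mulrC in et.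
have S0 : (0 < S)%N by apply: leq_ltn_trans S2.
have [b1 Hb1] : exists b1, forall p, (p < m)%N -> prime p /\ p != q -> forall B J,
  (K * \sum_(b < B) \sum_(j < J) (b1 <= b) *
      [&& p ^ j <= (q ^ S) ^ b, (q ^ S) ^ b < (q ^ S) * p ^ j & ~~ spread H K (p ^ j) ((q ^ S) ^ b)]
      <= 144 * H * (B * (trunc_log 2 (4 * q ^ S)).+1))%N.
  apply: (@uniform_bound (fun p => prime p /\ p != q) (fun p b1 => forall B J,
    (K * \sum_(b < B) \sum_(j < J) (b1 <= b) *
      [&& p ^ j <= (q ^ S) ^ b, (q ^ S) ^ b < (q ^ S) * p ^ j & ~~ spread H K (p ^ j) ((q ^ S) ^ b)]
      <= 144 * H * (B * (trunc_log 2 (4 * q ^ S)).+1))%N)) => [p [pp pnq]|p b b' bb' Hb B J].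
    have l1 : (1 < q ^ S)%N by rewrite -{1}(expn0 q) ltn_exp2l.
    apply: (near_pairs_rare H l1 (prime_gt1 pp) _ K0).
    by rewrite coprimeXl // prime_coprime // dvdn_prime2 // eq_sym.
  apply: leq_trans (Hb B J); rewrite leq_mul2l; apply/orP; right.
  apply: leq_sum => i _; apply: leq_sum => j _; rewrite leq_mul2r; apply/orP; right.
  by have [h|//] := leqP b' i; rewrite (leq_trans bb' h).
have [n0 [n00 hn0]] := exists_nat_ge (16 * q%:R ^+ 2 * m%:R / eta ^+ 2) 0.
exists S, (2 * C).+1, (maxn b1 n0); split => // bl bh A J.
rewrite geq_max => /andP[b1l n0l] blh lA lJ.
have n0h : (n0 <= bh)%N := leq_trans n0l blh.
apply: (zone_descent_of_constants pq eta0 e0 e4 eq16 H0 eH K0 eK C0 eC T1 eT S0 et (ltnW S2) Hb1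
  (leq_trans n00 n0h) b1l _ blh lA lJ).
rewrite -ler_pdivrMr ?exprn_gt0 //; apply: (le_trans hn0).
by rewrite ler_nat.
Qed.

(** * The structured summand *)

(** The mean fractional part modulo powers of p that is achieved when the top
    proportion al of the scales is given to the prime 2 and the rest to 3. *)
Definition digit_weight (R : realType) (al : R) (p : nat) : R :=
  if p == 2%N then (1 + al) / 2 else if p == 3%N then (2 - al) / 2 else 2^-1.

Lemma linear_eventually (R : realType) (k c : R) : 0 < k ->
  exists r0, forall r, (r0 <= r)%N -> c <= k * r%:R.
Proof.
move=> k0; have [n [_ hn]] := exists_nat_ge (c / k) 0.
exists n => r nr; rewrite mulrC -ler_pdivrMr //; apply: (le_trans hn).
by rewrite ler_nat.
Qed.

Lemma ltr_mul_trunc_log (R : realType) (l M N : nat) : (1 < l)%N -> (0 < M)%N -> (M <= N)%N ->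
  ln (N%:R : R) < ((trunc_log l (N %/ M))%:R + 1) * ln l%:R + ln M%:R.
Proof.
move=> l1 M0 MN; set b := trunc_log _ _.
have h : (N < l ^ b.+1 * M)%N by rewrite -ltn_divLR // trunc_log_ltn.
have l0 := ltnW l1.
have : ln (N%:R : R) < ln (l ^ b.+1 * M)%N%:R.
  by apply: ltr_ln_nat h; apply: leq_trans MN.
by rewrite natrM lnM ?posrE ?ltr0n ?expn_gt0 ?l0 // ln_natX // -natr1.
Qed.

(** Adds up the two zones: the scales below 2^v and above 2^(r-v) are lost, which
    costs at most 2d, and roundings are collected in c. *)
Lemma two_zone_estimate (R : realType) (al d eta r v e1 w2 w3 t2 t3 c u lp : R) (p : nat) :
  0 < u -> u <= lp -> 0 <= c -> 0 < eta -> 0 < d ->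
  w2 = (if p == 2%N then 1 else 2^-1) -> w3 = (if p == 3%N then 1 else 2^-1) ->
  (r - v - e1) * u - c <= t2 -> (e1 - v) * u - c <= t3 ->
  (1 - al) * r - 1 <= e1 -> e1 <= (1 - al) * r -> v <= d * r -> 0 <= v ->
  2 * c + u <= eta / 2 * r * u -> 0 <= r ->
  (digit_weight al p - 2 * d) * r * u / lp - eta * r <=
  (w2 * (t2 / lp) - eta / 4 * r) + (w3 * (t3 / lp) - eta / 4 * r).
Proof.
move=> u0 ulp c0 eta0 d0 ew2 ew3 h2 h3 he1 he2 hv v0 hc r0.
have lp0 : 0 < lp by apply: lt_le_trans ulp.
have key : (digit_weight al p - 2 * d) * r * u <= w2 * t2 + w3 * t3 + (2 * c + u).
  have e1u : ((1 - al) * r - 1) * u <= e1 * u by rewrite ler_pM2r.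
  have e2u : e1 * u <= (1 - al) * r * u by rewrite ler_pM2r.
  have vu : v * u <= d * r * u by rewrite ler_pM2r.
  have vu0 : 0 <= v * u by rewrite mulr_ge0 // ltW.
  have [e2|ne2] := eqVneq p 2%N.
    by rewrite ew2 ew3 /digit_weight e2 /=; clear ew2 ew3 e2; lra.
  rewrite (negbTE ne2) in ew2; have [e3|ne3] := eqVneq p 3%N.
    by rewrite ew2 ew3 /digit_weight e3 /=; clear ew2 ew3 e3 ne2; lra.
  rewrite (negbTE ne3) in ew3; rewrite ew2 ew3 /digit_weight (negbTE ne2) (negbTE ne3).
  clear ew2 ew3 ne2 ne3; lra.
have key2 : (2 * c + u) / lp <= eta / 2 * r.
  rewrite ler_pdivrMr //; apply: (le_trans hc).
  by rewrite ler_wpM2l // mulr_ge0 // divr_ge0 // ltW.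
have ilp : 0 <= lp^-1 by rewrite invr_ge0 ltW.
have := ler_wpM2r ilp key; move: key2; clear.
rewrite !mulrDl !mulrA; lra.
Qed.

(** Apply [zone_descent] with q = 2 from 2^(r-v) down to 2^((1-al)r), and then with
    q = 3 down to 2^v, where v = r/d.  The second descent and the shift y are
    together below the last scale of the first zone, so they are an admissible
    shift for it. *)
Lemma structured_summand (R : realType) (m d : nat) (al eta : R) : (0 < d)%N ->
  d%:R^-1 < al -> d%:R^-1 < 1 - al -> 0 < eta ->
  exists r0, forall r, (r0 <= r)%N -> exists A, [/\ (2 ^ (r %/ d) < A)%N,
    (A <= 2 ^ (r - r %/ d))%N &
    forall y p, (0 < y <= 2 ^ (r %/ d))%N -> prime p -> (p < m)%N ->
      (digit_weight al p - 2 * d%:R^-1) * r%:R * ln 2 / ln p%:R - eta * r%:R <=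
      \sum_(1 <= j < r.+1 | (p ^ j <= 2 ^ (r - r %/ d))%N) frac_div R (p ^ j) (A - y)].
Proof.
move=> d0 dal dal' eta0.
have dR : 0 < d%:R^-1 :> R by rewrite invr_gt0 ltr0n.
have eta4 : 0 < eta / 4 by rewrite divr_gt0.
have [S2 [M2 [b2 [S20 M20 Z2]]]] := zone_descent m (isT : prime 2) eta4.
have [S3 [M3 [b3 [S30 M30 Z3]]]] := zone_descent m (isT : prime 3) eta4.
have [u uE] : exists u : R, u = ln 2 by exists (ln 2).
have u0 : 0 < u by rewrite uE; exact: ln_nat_gt0.
have [l2 l2E] : exists l2, l2 = (2 ^ S2)%N by exists (2 ^ S2)%N.
have [l3 l3E] : exists l3, l3 = (3 ^ S3)%N by exists (3 ^ S3)%N.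
rewrite -l2E in Z2; rewrite -l3E in Z3.
have l21 : (1 < l2)%N by rewrite l2E -{1}(expn0 2) ltn_exp2l.
have l31 : (1 < l3)%N by rewrite l3E -{1}(expn0 3) ltn_exp2l.
have lnl2 : ln (l2%:R : R) = S2%:R * u by rewrite l2E ln_natX // uE.
have [w wE] : exists w : R, w = ln l3%:R by exists (ln l3%:R).
have w0 : 0 < w by rewrite wE; exact: ln_nat_gt0.
have lnl3 : S3%:R * ln 3 = w :> R by rewrite wE l3E ln_natX.
have S2u : 0 < S2%:R * u by rewrite mulr_gt0 // ltr0n.
have [k2 k2E] : exists k : R, k = ln M2%:R by exists (ln M2%:R).
have k20 : 0 <= k2 by rewrite k2E ln_ge0 // (ler_nat _ 1).
have [k3 k3E] : exists k : R, k = ln M3.+1%:R by exists (ln M3.+1%:R).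
have k30 : 0 <= k3 by rewrite k3E ln_ge0 // (ler_nat _ 1).
(* An upper bound, in logarithms, for all roundings of the four end scales. *)
pose c : R := k2 + k3 + 2 * (S2%:R * u) + 2 * w.
have alp : 0 < 1 - al by apply: lt_trans dal'.
have [n1 H1] := linear_eventually (S2%:R * (b2%:R + 1) + 1) alp.
have a2p : 0 < al - d%:R^-1 by rewrite subr_gt0.
have a4p : 0 < 1 - al - d%:R^-1 by rewrite subr_gt0.
have a5p : 0 < eta / 2 by rewrite divr_gt0.
have [n2 H2] := linear_eventually (k2 / u) a2p.
have [n3 H3] := linear_eventually (b3%:R * w / u + 1) dR.
have [n4 H4] := linear_eventually (c / u + 2)  a4p.
have [n5 H5] := linear_eventually ((2 * c + u) / u)  a5p.
exists (maxn n1 (maxn n2 (maxn n3 (maxn n4 n5)))) => r.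
rewrite !geq_max => /and5P[/H1 {}H1 /H2 {}H2 /H3 {}H3 /H4 {}H4 /H5 {}H5].
have [v vE] : exists v, v = (r %/ d)%N by exists (r %/ d)%N.
rewrite -vE.
have vd : v%:R <= d%:R^-1 * r%:R :> R.
  by rewrite mulrC ler_pdivlMr ?ltr0n // -natrM ler_nat vE leq_divM.
have vd' : d%:R^-1 * r%:R - 1 <= v%:R :> R.
  have : (r < v.+1 * d)%N by rewrite vE ltn_ceil.
  rewrite -(ltr_nat R) natrM -natr1 -ltr_pdivrMr ?ltr0n // [_ / _]mulrC; clear; lra.
have vr : (v <= r)%N by rewrite vE leq_div.
have rvR : (r - v)%N%:R = r%:R - v%:R :> R by rewrite natrB.
pose e1 := Num.truncn ((1 - al) * r%:R).
have e1le : e1%:R <= (1 - al) * r%:R.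
  by rewrite truncn_le mulr_ge0 // ltW.
have e1ge : (1 - al) * r%:R - 1 <= e1%:R.
  by have := truncnS_gt ((1 - al) * r%:R); rewrite -/e1 -natr1; clear; lra.
have [E1 E1E] : exists E1, E1 = e1 by exists e1.
rewrite -E1E in e1le e1ge; clear e1 E1E.
have pow2 n : ln ((2 ^ n)%N%:R : R) = n%:R * u by rewrite ln_natX // uE.
have pow2gt n : (0 < 2 ^ n)%N by rewrite expn_gt0.
have uu (x : R) : x / u * u = x by rewrite divfK // gt_eqF.
have l20 := ltnW l21; have l30 := ltnW l31.
have H2u : k2 <= (r%:R - v%:R - E1%:R) * u.
  have := ler_wpM2r (ltW u0) H2; rewrite uu => /le_trans; apply.
  by rewrite ler_pM2r //; move: vd e1le; clear; lra.
have M2le : (M2 <= 2 ^ (r - v))%N.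
  rewrite -(ler_nat R) -ler_ln ?posrE ?ltr0n // pow2 -k2E; apply: (le_trans H2u).
  by rewrite ler_pM2r // rvR; have : 0 <= E1%:R :> R by []; clear; lra.
(* The binary zone runs over (2^S2)^b for bl2 <= b <= bh2, the ternary zone over
   (3^S3)^b for t < b <= bh3; M2 and M3 leave room for the descents. *)
have [bh2 bh2E] : exists b, b = trunc_log l2 (2 ^ (r - v) %/ M2) by exists (trunc_log l2 (2 ^ (r - v) %/ M2)).
have bh2lt : (r%:R - v%:R) * u < (bh2%:R + 1) * (S2%:R * u) + k2.
  by have := ltr_mul_trunc_log R l21 M20 M2le; rewrite -bh2E pow2 rvR lnl2 -k2E.
have bh2le : (M2 * l2 ^ bh2 <= 2 ^ (r - v))%N.
  by rewrite bh2E mulnC -leq_divRL // trunc_logP // divn_gt0.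
have [bl2 bl2E] : exists b, b = trunc_log l2 (2 ^ E1) by exists (trunc_log l2 (2 ^ E1)).
have bl2lt : E1%:R * u < (bl2%:R + 1) * (S2%:R * u).
  have := ltr_mul_trunc_log R l21 (isT : 0 < 1)%N (pow2gt E1).
  by rewrite divn1 -bl2E pow2 lnl2 ln1 addr0.
have bl2le : (l2 ^ bl2 <= 2 ^ E1)%N by rewrite bl2E trunc_logP.
have bl2leR : bl2%:R * (S2%:R * u) <= E1%:R * u.
  rewrite -lnl2 -ln_natX // -pow2; apply: ler_ln_nat bl2le.
  by rewrite expn_gt0 l20.
have b2bl2 : (b2 <= bl2)%N.
  rewrite -ltnS -(ltr_nat R) -natr1 -(ltr_pM2r S2u); apply: le_lt_trans bl2lt.
  rewrite mulrA ler_pM2r //; apply: le_trans e1ge.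
  have S2R : 0 <= S2%:R :> R by [].
  by move: H1 S2R; clear; lra.
have blh2 : (bl2 <= bh2)%N.
  rewrite -ltnS -(ltr_nat R) -natr1 -(ltr_pM2r S2u); apply: (le_lt_trans bl2leR).
  by move: H2u bh2lt; clear; lra.
have J2 : (l2 ^ bh2 < 2 ^ r.+1)%N.
  apply: (@leq_ltn_trans (2 ^ (r - v))%N).
    by apply: leq_trans bh2le; rewrite leq_pmull.
  by rewrite ltn_exp2l // ltnS leq_subr.
have [A1 [A1le A1ge A1low P2]] := Z2 bl2 bh2 (2 ^ (r - v))%N r.+1 b2bl2 blh2 bh2le J2.
have H4u : c + u <= (E1%:R - v%:R) * u.
  have := ler_wpM2r (ltW u0) H4; rewrite [(_ + 2) * u]mulrDl uu.
  have h1 := ler_wpM2r (ltW u0) vd; have h2 := ler_wpM2r (ltW u0) e1ge.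
  by move: h1 h2; clear; lra.
have c0 : 0 <= c by rewrite /c !addr_ge0 // mulr_ge0 // ltW.
have vu0 : 0 <= v%:R * u by rewrite mulr_ge0 // ltW.
have bl2big : k3 + w + v%:R * u <= bl2%:R * (S2%:R * u).
  by move: bl2lt H4u k20 w0 u0 S2u; rewrite /c; move: (S2%:R * u) => x; clear; lra.
have M3le : (M3.+1 <= l2 ^ bl2)%N.
  rewrite -(ler_nat R) -ler_ln ?posrE ?ltr0n ?expn_gt0 ?l20 // ln_natX // lnl2 -k3E.
  by move: bl2big w0 vu0; clear; lra.
have [bh3 bh3E] : exists b, b = trunc_log l3 (l2 ^ bl2 %/ M3.+1).
  by exists (trunc_log l3 (l2 ^ bl2 %/ M3.+1)).
have bh3lt : bl2%:R * (S2%:R * u) < (bh3%:R + 1) * w + k3.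
  by have := ltr_mul_trunc_log R l31 (ltn0Sn M3) M3le; rewrite -bh3E ln_natX // lnl2 -wE -k3E.
have bh3le : (M3.+1 * l3 ^ bh3 <= l2 ^ bl2)%N.
  by rewrite bh3E mulnC -leq_divRL // trunc_logP // divn_gt0.
have [t tE] : exists b, b = trunc_log l3 (2 ^ v) by exists (trunc_log l3 (2 ^ v)).
have tlow : (2 ^ v < l3 ^ t.+1)%N by rewrite tE trunc_log_ltn.
have tlowR : v%:R * u <= (t%:R + 1) * w.
  by rewrite natr1 wE -ln_natX // -pow2; apply: ler_ln_nat => //; exact: ltnW.
have thigh : t%:R * w <= v%:R * u.
  rewrite wE -ln_natX // -pow2; apply: ler_ln_nat; first by rewrite expn_gt0 l30.
  by rewrite tE trunc_logP.
have b3t : (b3 <= t.+1)%N.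
  rewrite -(ler_nat R) -natr1 -(ler_pM2r w0); apply: le_trans tlowR.
  have h : b3%:R * w / u <= v%:R by move: H3 vd'; clear; lra.
  by rewrite -(ler_pdivrMr _ _ u0).
have t3 : (t.+1 <= bh3)%N.
  rewrite -ltnS -(ltr_nat R) -!natr1 -(ltr_pM2r w0).
  move: bl2big bh3lt thigh; clear; lra.
have M3A : (M3 * l3 ^ bh3 <= A1)%N.
  by apply: leq_trans A1low; apply: leq_trans bh3le; rewrite leq_mul2r leqnSn orbT.
have J3 : (l3 ^ bh3 < 2 ^ r.+1)%N.
  apply: (@leq_ltn_trans (2 ^ (r - v))%N).
    by apply: leq_trans A1le; apply: leq_trans M3A; rewrite leq_pmull.
  by rewrite ltn_exp2l // ltnS leq_subr.
have [A2 [A2le A2ge A2low P3]] := Z3 t.+1 bh3 A1 r.+1 b3t t3 M3A J3.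
exists A2; split.
- exact: leq_trans tlow A2low.
- exact: leq_trans A2le A1le.
move=> y p /andP[y0 yv] pp pm; have p1 := prime_gt1 pp.
have yt : (y <= l3 ^ t.+1)%N by apply: leq_trans yv (ltnW tlow).
have yA2 : (y <= A2)%N by apply: leq_trans yt A2low.
have th : (l3 ^ t.+1 <= l3 ^ bh3)%N by rewrite leq_pexp2l.
have y2 : (0 < A1 - (A2 - y) <= l2 ^ bl2)%N.
  apply/andP; split; first by move: y0 yA2 A2le; clear; lia.
  by move: A2ge bh3le th yt yA2; rewrite mulSn; clear; lia.
have ey : (A1 - (A1 - (A2 - y)) = A2 - y)%N by move: A2le; clear; lia.
have := P2 _ p y2 pp pm; rewrite ey => Q2.
have Q3 := P3 y p _ pp pm; rewrite y0 yt in Q3; move: (Q3 isT) => {}Q3.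
have lp : u <= ln p%:R by rewrite uE; apply: ler_ln_nat.
have S2bh : S2%:R * bh2%:R <= r%:R :> R.
  rewrite -natrM ler_nat -ltnS -(@ltn_exp2l 2) //; apply: leq_trans J2.
  by rewrite l2E -expnM.
have S3bh : S3%:R * bh3%:R <= r%:R :> R.
  rewrite -natrM ler_nat -ltnS -(@ltn_exp2l 2) //; apply: leq_trans J3.
  by rewrite l3E -expnM ltnS leq_exp_base.
have est := @two_zone_estimate R al d%:R^-1 eta r%:R v%:R E1%:R
  (if p == 2%N then 1 else 2^-1) (if p == 3%N then 1 else 2^-1)
  ((bh2 - bl2)%:R * (S2%:R * u)) ((bh3 - t.+1)%:R * w) c u (ln p%:R) p
  u0 lp c0 eta0 dR erefl erefl.
rewrite -uE; apply: (le_trans (est _ _ e1ge e1le vd _ _ _)) => //.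
- rewrite natrB //; move: bh2lt bl2leR; rewrite /c; move: k30 w0 S2u; clear; lra.
- rewrite natrB //; move: bh3lt bl2lt thigh k20 w0 S2u; rewrite /c -natr1.
  move: (bl2%:R * (S2%:R * u)) (S2%:R * u) => x x'; clear; lra.
- by have := ler_wpM2r (ltW u0) H5; rewrite uu.
apply: (@le_trans _ _ (
  \sum_(1 <= j < r.+1 | (l2 ^ bl2 < p ^ j <= l2 ^ bh2)%N) frac_div R (p ^ j) (A2 - y) +
  \sum_(1 <= j < r.+1 | (l3 ^ t.+1 < p ^ j <= l3 ^ bh3)%N) frac_div R (p ^ j) (A2 - y))).
  apply: lerD.
    apply: le_trans Q2; rewrite -uE natrM; apply: lerB; first by rewrite !mulrA.
    by rewrite ler_pM2l.
  apply: le_trans Q3; rewrite lnl3 natrM; apply: lerB; first by rewrite !mulrA.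
  by rewrite ler_pM2l.
rewrite big_mkcond [X in _ + X]big_mkcond [leRHS]big_mkcond -big_split /=.
apply: ler_sum => j _; have f0 := frac_div_ge0 R (p ^ j) (A2 - y).
have h32 : (l3 ^ bh3 <= l2 ^ bl2)%N by apply: leq_trans bh3le; rewrite leq_pmull.
have h22 : (l2 ^ bh2 <= 2 ^ (r - v))%N by apply: leq_trans bh2le; rewrite leq_pmull.
have h2b : (l2 ^ bl2 <= l2 ^ bh2)%N by rewrite leq_pexp2l.
move: (p ^ j)%N f0 h32 h22 h2b => N; move: (frac_div _ _ _) => f.
move: (l3 ^ t.+1)%N (l3 ^ bh3)%N (l2 ^ bl2)%N (l2 ^ bh2)%N (2 ^ (r - v))%N => x1 x2 x3 x4 x5.
clear => f0 h1 h2 h3.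
have [/andP[a1 a2]|_] := boolP (x3 < N <= x4)%N.
  rewrite (leq_trans a2 h2) (_ : (x1 < N <= x2)%N = false) ?addr0 //.
  by apply/negbTE; move: a1 h1; clear; lia.
rewrite add0r; have [/andP[a1 a2]|_] := boolP (x1 < N <= x2)%N; last by case: ifP.
by rewrite (leq_trans a2) //; move: h1 h2 h3; clear; lia.
Qed.

(** * Counting failures in a dyadic block *)

Lemma g_ge_of_dvd (m n D a : nat) : (0 < n)%N -> (0 < a)%N -> (m * a < n + D)%N ->
  (a`! ^ m * (n + D - m * a)`! %| n`!)%N -> D%:Z <= g m.+1 n.
Proof.
move=> n0 a0 maN dv.
pose b (i : 'I_m.+1) := if (i < m)%N then a else (n + D - m * a)%N.
have -> : D%:Z = excess n b.
  rewrite /excess big_ord_recr /= /b ltnn.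
  under eq_bigr => i _ do rewrite /= ltn_ord.
  by rewrite sum_nat_const card_ord; lia.
apply: g_ub => //; apply/andP; split.
  apply/forallP => i; rewrite /b; case: ifP => // _; by rewrite subn_gt0.
rewrite big_ord_recr /= /b ltnn.
under eq_bigr => i _ do rewrite /= ltn_ord.
by rewrite prod_nat_const card_ord.
Qed.

(** If none of the four kinds of failure occurs for the pair (i, z), then
    [good_pair_dvd] applies to n = 2^r + i and a = A - 2^v + z. *)
Lemma bad_pair_cover (R : realType) (m r v A D1 E Y P0 i z : nat) (mu : nat -> R) (t : R) :
  (0 < m)%N -> (v <= r)%N -> (2 ^ v < A)%N -> (m * A <= 2 ^ r)%N -> (z < 2 ^ v)%N ->
  (forall p, prime p -> (P0 <= p <= Y)%N ->
    (D1 + p.-1 * E <= p.-1 * (trunc_log p (2 ^ v) %/ 10))%N) ->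
  (forall p (c : nat), prime p -> (p < P0)%N -> mu p - t <= c%:R ->
    (D1 + p.-1 * E <= p.-1 * c)%N) ->
  forall a, a = (A - 2 ^ v + z)%N ->
  (((g m.+1 (2 ^ r + i) < (m * D1)%N%:Z)%R : nat) <=
   (\sum_(p < Y.+1) (prime p && divisible_window (p ^ E.+1) (m * D1) (2 ^ r + i))) +
   ~~ large_residues Y (m * D1) (2 ^ r + i) a +
   (\sum_(p < Y.+1) \sum_(l < m) [&& prime p, P0 <= p &
      carries p (trunc_log p (2 ^ v)) (2 ^ r + m * D1 - l * a + i) a < trunc_log p (2 ^ v) %/ 10]) +
   (\sum_(p < P0) \sum_(l < m) (prime p &&
      ((carries p (trunc_log p (2 ^ (r - v))) (2 ^ r + m * D1 - l * a + i) a)%:R < mu p - t)%R)))%N.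
Proof.
move=> m0 vr ZA mA zZ Hmed Hsm a aE.
case: ltP => //= bad; set S1 := (\sum_(p < Y.+1) _)%N; set S2 := (~~ _ : nat).
set S3 := (\sum_(p < Y.+1) _)%N; set S4 := (\sum_(p < P0) _)%N.
rewrite lt0n; apply/negP => /eqP /eqP; rewrite !addn_eq0 => /andP[/andP[/andP[z1 z2] z3] z4].
suff : (m * D1)%N%:Z <= g m.+1 (2 ^ r + i) by rewrite leNgt bad.
have X0 : (0 < 2 ^ r)%N by rewrite expn_gt0.
have Z0 : (0 < 2 ^ v)%N by rewrite expn_gt0.
have a0 : (0 < a)%N by rewrite aE addn_gt0 subn_gt0 ZA.
have aA : (a < A)%N by rewrite aE; move: ZA zZ; clear; lia.
have la l : (l <= m)%N -> (l * a <= 2 ^ r)%N.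
  by move=> lm; apply: leq_trans mA; apply: leq_mul => //; exact: ltnW.
have maX : (m * a < 2 ^ r)%N.
  by apply: leq_trans mA; rewrite ltn_pmul2l.
have eN l : (l < m)%N -> (2 ^ r + i + m * D1 - l * a = 2 ^ r + m * D1 - l * a + i)%N.
  by move=> lm; have := la l (ltnW lm); clear; lia.
have XZ : (2 ^ v <= 2 ^ r)%N by rewrite leq_exp2l.
have XZ' : (2 ^ (r - v) <= 2 ^ r)%N by rewrite leq_exp2l // leq_subr.
have wle p V : (1 < p)%N -> (0 < V)%N -> (V <= 2 ^ r)%N -> (trunc_log p V <= 2 ^ r + i + m * D1)%N.
  move=> p1 V0 VX; rewrite -addnA; apply: leq_trans (leq_addr _ _).
  by apply: leq_trans VX; apply: leq_trans (trunc_logP p1 V0); rewrite ltnW // ltn_expl.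
have mN : (m * a < 2 ^ r + i + m * D1)%N by rewrite -addnA ltn_addr.
have n0 : (0 < 2 ^ r + i)%N by rewrite addn_gt0 X0.
apply: (g_ge_of_dvd n0 a0 mN).
apply: (@good_pair_dvd m (2 ^ r + i) D1 a Y E) => //.
- move=> p pp pY; move: z1; rewrite /S1 sum_nat_eq0 => /forallP/(_ (Ordinal (pY : (p < Y.+1)%N))).
  by rewrite /= pp eqb0.
- by move: z2; rewrite /S2 eqb0 negbK.
- move=> p pp pY; have p1 := prime_gt1 pp.
  have [pP|Pp] := ltnP p P0.
    exists (trunc_log p (2 ^ (r - v))); first by apply: wle; rewrite // expn_gt0.
    move=> l lm; apply: Hsm => //; rewrite leNgt; apply/negP => h.
    move: z4; rewrite /S4 sum_nat_eq0 => /forallP/(_ (Ordinal pP)) /=.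
    rewrite sum_nat_eq0 => /forallP/(_ (Ordinal lm)) /=.
    by rewrite pp /= -eN // h.
  exists (trunc_log p (2 ^ v)); first by apply: wle.
  move=> l lm; have PpY : (P0 <= p <= Y)%N by rewrite Pp.
  apply: leq_trans (Hmed p pp PpY) _; rewrite leq_mul2l; apply/orP; right.
  rewrite leqNgt; apply/negP => h.
  move: z3; rewrite /S3 sum_nat_eq0 => /forallP/(_ (Ordinal (pY : (p < Y.+1)%N))) /=.
  rewrite sum_nat_eq0 => /forallP/(_ (Ordinal lm)) /=.
  by rewrite pp Pp /= -eN // h.
Qed.

(** Double counting of pairs (n, z): an n with too small an excess fails for all
    2^v values of z.  The failures are, in order, those due to high prime powers
    in the window, to small residues modulo large primes, and ([T3], [T4]) to few
    carries at medium and small primes.  Medium primes have random digits in both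
    n and z; for small primes only n is random and a is structured. *)
Lemma dyadic_bad_count (R : realType) (m r v A D1 E Y P0 T : nat) (mu : nat -> R) (t : R) :
  (0 < m)%N -> (v <= r)%N -> (2 ^ v < A)%N -> (m * A <= 2 ^ r)%N -> (m * D1 <= 2 ^ r)%N ->
  (0 < Y)%N -> 0 < t ->
  (forall p, prime p -> (P0 <= p <= Y)%N ->
    [/\ (5 <= p)%N, (D1 + p.-1 * E <= p.-1 * (trunc_log p (2 ^ v) %/ 10))%N &
        (T <= 8 ^ (trunc_log p (2 ^ v) %/ 10))%N]) ->
  (forall p y, prime p -> (p < P0)%N -> (0 < y <= 2 ^ v)%N ->
     mu p <= \sum_(1 <= j < (trunc_log p (2 ^ (r - v))).+1) frac_div R (p ^ j) (A - y)) ->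
  (forall p (c : nat), prime p -> (p < P0)%N -> mu p - t <= c%:R ->
    (D1 + p.-1 * E <= p.-1 * c)%N) ->
  exists T3 T4 : nat, [/\ (T * T3 <= Y.+1 * (m * (4 * (2 ^ r * 2 ^ v))))%N,
    t ^+ 2 * T4%:R <= (2 ^ v * (P0 * (m * (6 * r * 2 ^ r))))%N%:R &
    (2 ^ v * (\sum_(i < 2 ^ r) (g m.+1 (2 ^ r + i) < (m * D1)%N%:Z)%R) <=
     2 ^ v * (Y.+1 * (m * D1 * (2 ^ r %/ 2 ^ E.+1).+1)) +
     2 ^ r * (m * D1 * (r.+2 * ((2 ^ v %/ Y).+1 * (m * D1)))) + T3 + T4)%N].
Proof.
move=> m0 vr ZA mA mDX Y0 t0 Hmed Hmu Hsm.
pose a z := (A - 2 ^ v + z)%N.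
pose F1 i p := prime p && divisible_window (p ^ E.+1) (m * D1) (2 ^ r + i).
pose F3 i z p l := [&& prime p, P0 <= p &
      carries p (trunc_log p (2 ^ v)) (2 ^ r + m * D1 - l * a z + i) (a z) < trunc_log p (2 ^ v) %/ 10]%N.
pose F4 i z p l := prime p &&
   ((carries p (trunc_log p (2 ^ (r - v))) (2 ^ r + m * D1 - l * a z + i) (a z))%:R < mu p - t)%R.
pose T3 := (\sum_(z < 2 ^ v) \sum_(i < 2 ^ r) \sum_(p < Y.+1) \sum_(l < m) F3 i z p l)%N.
pose T4 := (\sum_(z < 2 ^ v) \sum_(i < 2 ^ r) \sum_(p < P0) \sum_(l < m) F4 i z p l)%N.
have X0 : (0 < 2 ^ r)%N by rewrite expn_gt0.
have Z0 : (0 < 2 ^ v)%N by rewrite expn_gt0.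
have XZ : (2 ^ v <= 2 ^ r)%N by rewrite leq_exp2l.
exists T3, T4; split.
- have -> : T3 = (\sum_(p < Y.+1) \sum_(l < m) \sum_(z < 2 ^ v) \sum_(i < 2 ^ r) F3 i z p l)%N.
    rewrite /T3; under eq_bigr => z _.
      rewrite exchange_big /=; under eq_bigr => p _ do rewrite exchange_big /=.
      over.
    rewrite exchange_big /=; apply: eq_bigr => p _; exact: exchange_big.
  rewrite big_distrr /=.
  apply: (@leq_trans (\sum_(p < Y.+1) m * (4 * (2 ^ r * 2 ^ v)))%N); last first.
    by rewrite sum_nat_const card_ord.
  apply: leq_sum => p _; rewrite big_distrr /=.
  apply: (@leq_trans (\sum_(l < m) 4 * (2 ^ r * 2 ^ v))%N); last first.
    by rewrite sum_nat_const card_ord.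
  apply: leq_sum => l _.
  have [/andP[pp Pp]|no] := boolP (prime p && (P0 <= p)%N); last first.
    rewrite big1 ?muln0 // => z _; rewrite big1 // => i _.
    by rewrite /F3 andbA (negbTE no).
  have pY : (P0 <= p <= Y)%N by rewrite Pp -ltnS ltn_ord.
  have [p5 _ hT] := Hmed p pp pY; have p1 := prime_gt1 pp.
  have Q : (p ^ trunc_log p (2 ^ v) <= 2 ^ v)%N by apply: trunc_logP.
  apply: leq_trans (few_carries_pairs (A - 2 ^ v) (fun z => 2 ^ r + m * D1 - l * a z)%N
    p5 (leqnn _) (leq_trans Q XZ) Q).
  apply: leq_mul => //; apply: leq_sum => z _; apply: leq_sum => i _.
  by rewrite /F3 pp Pp.
- have -> : T4 = (\sum_(p < P0) \sum_(l < m) \sum_(z < 2 ^ v) \sum_(i < 2 ^ r) F4 i z p l)%N.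
    rewrite /T4; under eq_bigr => z _.
      rewrite exchange_big /=; under eq_bigr => p _ do rewrite exchange_big /=.
      over.
    rewrite exchange_big /=; apply: eq_bigr => p _; exact: exchange_big.
  have t2 : 0 <= t ^+ 2 by rewrite exprn_ge0 // ltW.
  have -> : (2 ^ v * (P0 * (m * (6 * r * 2 ^ r))) =
      \sum_(p < P0) \sum_(l < m) \sum_(z < 2 ^ v) (6 * r * 2 ^ r))%N.
    rewrite !sum_nat_const !card_ord; clear; rewrite mulnCA; congr (_ * _)%N; exact: mulnCA.
  rewrite !natr_sum mulr_sumr; apply: ler_sum => p _.
  rewrite !natr_sum mulr_sumr; apply: ler_sum => l _.
  rewrite !natr_sum mulr_sumr; apply: ler_sum => z _.
  have [pp|no] := boolP (prime p); last first.
    by rewrite big1 ?mulr0 // => i _; rewrite /F4 (negbTE no).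
  have p1 := prime_gt1 pp.
  have zy : (0 < 2 ^ v - z <= 2 ^ v)%N by rewrite subn_gt0 ltn_ord leq_subr.
  have ez : (A - (2 ^ v - z) = a z)%N.
    by rewrite /a; have := ltn_ord z; move: ZA; clear; lia.
  have := Hmu p _ pp (ltn_ord p) zy; rewrite ez => hm.
  set w := trunc_log p (2 ^ (r - v)) in hm *.
  have Q' : (p ^ w <= 2 ^ (r - v))%N by apply: trunc_logP; rewrite ?expn_gt0.
  have Q : (p ^ w <= 2 ^ r)%N by apply: leq_trans Q' _; rewrite leq_exp2l // leq_subr.
  have wr : (w <= r)%N.
    rewrite -(@leq_exp2l 2) //; apply: leq_trans Q; exact: leq_exp_base.
  have := carries_concentrate_interval (2 ^ r + m * D1 - l * a z)%N p1 t0 Q hm.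
  have -> : (\sum_(i < 2 ^ r) F4 i z p l = \sum_(i < 2 ^ r)
    ((carries p w (2 ^ r + m * D1 - l * a z + i) (a z))%:R < mu p - t)%R)%N.
    by apply: eq_bigr => i _; rewrite /F4 pp.
  move=> h; apply: (le_trans h); rewrite !natrM ler_pM2r ?ltr0n ?expn_gt0 //.
  by rewrite ler_pM2l // ler_nat.
have cover : (2 ^ v * (\sum_(i < 2 ^ r) (g m.+1 (2 ^ r + i) < (m * D1)%N%:Z)%R) <=
  \sum_(z < 2 ^ v) \sum_(i < 2 ^ r) ((\sum_(p < Y.+1) F1 i p) +
     ~~ large_residues Y (m * D1) (2 ^ r + i) (a z) +
    (\sum_(p < Y.+1) \sum_(l < m) F3 i z p l) + (\sum_(p < P0) \sum_(l < m) F4 i z p l)))%N.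
  have -> : (2 ^ v * (\sum_(i < 2 ^ r) (g m.+1 (2 ^ r + i) < (m * D1)%N%:Z)%R) =
     \sum_(z < 2 ^ v) (\sum_(i < 2 ^ r) (g m.+1 (2 ^ r + i) < (m * D1)%N%:Z)%R))%N.
    by rewrite [RHS]sum_nat_const card_ord.
  apply: leq_sum => z _; apply: leq_sum => i _.
  apply: (@bad_pair_cover R m r v A D1 E Y P0 i z mu t) => //.
  by move=> p pp pY; case: (Hmed p pp pY).
apply: (leq_trans cover).
under eq_bigr => z _ do rewrite !big_split /=.
rewrite !big_split /= leq_add2r leq_add2r; apply: leq_add.
  rewrite [leqLHS]sum_nat_const card_ord leq_mul2l; apply/orP; right.
  rewrite exchange_big /=.
  apply: (@leq_trans (\sum_(p < Y.+1) m * D1 * (2 ^ r %/ 2 ^ E.+1).+1)%N); last first.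
    by rewrite sum_nat_const card_ord.
  apply: leq_sum => p _; rewrite /F1.
  have [pp|no] := boolP (prime p); last by rewrite big1.
  have p0 := prime_gt0 pp; have pE : (0 < p ^ E.+1)%N by rewrite expn_gt0 p0.
  apply: leq_trans (divisible_window_rare (m * D1) (2 ^ r) (2 ^ r) pE) _.
  rewrite leq_mul2l ltnS leq_div2l ?expn_gt0 ?orbT //.
  by apply: leq_exp_base; exact: prime_gt1.
rewrite exchange_big /=.
apply: (@leq_trans (\sum_(i < 2 ^ r) m * D1 * (r.+2 * ((2 ^ v %/ Y).+1 * (m * D1))))%N); last first.
  by rewrite sum_nat_const card_ord.
apply: leq_sum => i _; apply: large_residues_fail_rare => // l /andP[l0 lD].
have N0 : (0 < 2 ^ r + i + l)%N by rewrite !addn_gt0 X0.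
rewrite -ltnS -(@ltn_exp2l 2) //; apply: leq_ltn_trans (size_primes_exp N0) _.
have := ltn_ord i; rewrite !expnS; move: lD mDX X0; clear; lia.
Qed.

(** * The balance between the primes *)

Lemma square_le_exp (C : nat) : exists t0, forall t, (t0 <= t)%N -> (C * t.+1 ^ 2 <= 2 ^ t)%N.
Proof.
pose w := (5 * C).+1.
exists (4 * w)%N; elim=> [|t IH].
  by rewrite leqn0 muln_eq0.
rewrite leq_eqVlt => /orP[/eqP <-|]; last first.
  rewrite ltnS => /[dup] h /IH IHt; rewrite (expnS 2 t).
  have : (C * t.+2 ^ 2 <= 2 * (C * t.+1 ^ 2))%N.
    rewrite mulnCA leq_mul2l; apply/orP; right; rewrite -!mulnn.
    have : (2 <= t)%N by move: h; rewrite /w; clear; lia.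
    by clear; nia.
  by move=> /leq_trans; apply; rewrite leq_mul2l IHt orbT.
have h1 : (w < 2 ^ w)%N by apply: ltn_expl.
have h2 : (C * (4 * w).+1 <= 2 ^ w * 2 ^ w)%N.
  apply: (@leq_trans (w * w)%N); last by apply: leq_mul; exact: ltnW.
  by rewrite /w; clear; nia.
have [->|C0] := posnP C; first by rewrite mul0n.
apply: (@leq_trans ((C * (4 * w).+1) * (C * (4 * w).+1))%N).
  rewrite -mulnn; move: (4 * w).+1 => x; move: C0; clear; nia.
apply: leq_trans (leq_mul h2 h2) _.
by rewrite -!expnD leq_exp2l //; clear; lia.
Qed.

(** Passing from p to p + 1 multiplies the left side by at most (6/5)^6, less than 12.
    The inequality is used as 6 ln p <= (p - 1) ln 12. *)
Lemma sixth_power_le p : (5 <= p)%N -> (p ^ 6 <= 12 ^ p.-1)%N.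
Proof.
move=> p5; rewrite -(subnK p5); move: (p - 5)%N => k.
elim: k => [|k IH]; first by vm_compute.
set x := (k + 5)%N in IH; rewrite addSn -/x /=.
have x5 : (5 <= x)%N by rewrite leq_addl.
have ex : (12 ^ x = 12 * 12 ^ x.-1)%N by rewrite -expnS prednK // (leq_trans _ x5).
rewrite ex; apply: leq_trans (leq_mul (leqnn 12) IH).
have h : (5 ^ 6 * x.+1 ^ 6 <= 6 ^ 6 * x ^ 6)%N.
  by rewrite -!expnMn leq_exp_base //; move: x5; clear; lia.
have h2 : (6 ^ 6 <= 5 ^ 6 * 12)%N by vm_compute.
have c0 : (0 < 5 ^ 6)%N by rewrite expn_gt0.
rewrite -(leq_pmul2l c0) mulnA; apply: (leq_trans h).
by rewrite leq_mul2r h2 orbT.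
Qed.

Lemma ln12E (R : realType) : ln (12 : R) = 2 * ln 2 + ln 3.
Proof.
have -> : (12 : R) = 2 ^+ 2 * 3 by rewrite -natrX -natrM.
by rewrite lnM ?posrE ?exprn_gt0 // lnXn // mulr_natl.
Qed.

(** With tau = 3 ln 2 / ln 12 and al = 2 tau - 1 the primes 2 and 3 impose the same
    bound tau; every larger prime imposes a weaker one. *)
Lemma digit_weight_bound (R : realType) (p : nat) : prime p ->
  3 * ln 2 / ln 12 <=
  digit_weight (2 * (3 * ln 2 / ln 12) - 1 : R) p * (p.-1)%:R * ln 2 / ln p%:R.
Proof.
move=> pp; have p1 := prime_gt1 pp.
have u0 : 0 < ln (2 : R) by exact: ln_nat_gt0.
have w0 : 0 < ln (3 : R) by exact: (ln_nat_gt0 R (isT : (1 < 3)%N)).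
have l12 : 0 < ln (12 : R) by rewrite ln12E; move: u0 w0; clear; lra.
rewrite /digit_weight; case: eqP => [->|n2].
  rewrite /= mulr1 le_eqVlt; apply/orP; left; apply/eqP.
  by field; rewrite !gt_eqF.
case: eqP => [->|n3].
  rewrite le_eqVlt; apply/orP; left; apply/eqP; move: l12; rewrite ln12E /= => l12.
  by field; rewrite !gt_eqF.
have p5 : (5 <= p)%N.
  by move: p pp p1 n2 n3 => [|[|[|[|[|p]]]]].
have lp := ln_nat_gt0 R p1.
have key : 6 * ln p%:R <= (p.-1)%:R * ln 12 :> R.
  have := sixth_power_le p5.
  have h : (0 < p ^ 6)%N by rewrite expn_gt0 ltnW.
  move/(ler_ln_nat R h); rewrite !ln_natX ?(ltnW p1) //.
rewrite ler_pdivrMr // mulrAC ler_pdivlMr //.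
have := ler_wpM2r (ltW u0) key; clear; lra.
Qed.

Lemma tau_bounds (R : realType) : (2^-1 : R) < 3 * ln (2 : R) / ln 12 < 1.
Proof.
have u0 : 0 < ln (2 : R) by exact: ln_nat_gt0.
have l12 : 0 < ln (12 : R) by exact: (ln_nat_gt0 R (isT : (1 < 12)%N)).
have h1 : 3 * ln 2 < ln 12 :> R.
  have -> : 3 * ln 2 = ln ((2 ^ 3)%N%:R : R) by rewrite ln_natX.
  exact: (@ltr_ln_nat R 8 12).
have h2 : ln 12 < 6 * ln 2 :> R.
  have -> : 6 * ln 2 = ln ((2 ^ 6)%N%:R : R) by rewrite ln_natX.
  exact: (@ltr_ln_nat R 12 64).
by apply/andP; split; [rewrite ltr_pdivlMr // | rewrite ltr_pdivrMr //]; move: h1 h2; clear; lra.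
Qed.

(** A tenth of the log_p (2^v) carry positions suffices once p - 1 beats 40 d log p. *)
Lemma medium_primes_margin (d l0 r t v D1 p : nat) : (0 < d)%N ->
  (forall l, (l0 <= l)%N -> (40 * d * l.+1 < 2 ^ l)%N) ->
  v = (r %/ d)%N -> ((4 * t + 4) * (160 * t + 170) <= v)%N -> (D1 <= r)%N ->
  prime p -> (2 ^ l0 <= p)%N -> (p <= 2 ^ (4 * t + 4))%N ->
  (D1 + p.-1 * (8 * t + 8) <= p.-1 * (trunc_log p (2 ^ v) %/ 10))%N /\
  (8 ^ (16 * t + 17) <= 8 ^ (trunc_log p (2 ^ v) %/ 10))%N.
Proof.
move=> d0 Hl ev hv Dr pp pl pY; have p1 := prime_gt1 pp; have p0 := ltnW p1.
set w := trunc_log p _.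
have hw : (2 ^ v < p ^ w.+1)%N by apply: trunc_log_ltn.
have w1 : (160 * t + 170 <= w)%N.
  rewrite leqNgt; apply/negP => h.
  have : (2 ^ v < 2 ^ ((4 * t + 4) * w.+1))%N.
    by apply: (leq_trans hw); rewrite expnM leq_exp_base.
  rewrite ltn_exp2l // => h2.
  have : ((4 * t + 4) * w.+1 <= (4 * t + 4) * (160 * t + 170))%N by rewrite leq_mul2l h orbT.
  by move: hv h2; clear; lia.
have w10 : (16 * t + 17 <= w %/ 10)%N.
  by rewrite leq_divRL //; move: w1; clear; lia.
split; last by rewrite leq_exp2l.
have /andP[b1 b2] := trunc_log_bounds (isT : (1 < 2)%N) p0.
set l := trunc_log 2 p in b1 b2.
have ll : (l0 <= l)%N by apply: trunc_log_max.
have h3 : (v < l.+1 * w.+1)%N.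
  rewrite -(@ltn_exp2l 2) //; apply: (leq_trans hw).
  by rewrite expnM leq_exp_base // ltnW.
have h4 : (r < d * (l.+1 * w.+1))%N.
  apply: (@leq_trans (v.+1 * d)%N); first by rewrite ev ltn_ceil.
  by rewrite mulnC leq_mul2l h3 orbT.
have h5 : (w.+1 <= 20 * (w %/ 10))%N.
  have := divn_eq w 10; have := ltn_pmod w (isT : (0 < 10)%N).
  by move: w10; clear; lia.
have h6 : (40 * d * l.+1 <= p.-1)%N.
  by have := Hl l ll; move: b1 p0; clear; lia.
have h7 : (2 * r <= p.-1 * (w %/ 10))%N.
  apply: leq_trans (leq_mul h6 (leqnn _)).
  apply: (@leq_trans (2 * (d * (l.+1 * w.+1))))%N; first by rewrite leq_mul2l ltnW.
  apply: (@leq_trans (2 * (d * (l.+1 * (20 * (w %/ 10))))))%N.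
    by rewrite !leq_mul2l h5 !orbT.
  by clear; lia.
have h8 : (p.-1 * (2 * (8 * t + 8)) <= p.-1 * (w %/ 10))%N.
  by rewrite leq_mul2l; apply/orP; right; move: w10; clear; lia.
by move: h7 h8 Dr; clear; lia.
Qed.

Lemma digit_weight_ge (R : realType) (al : R) p : 0 <= al <= 1 -> 2^-1 <= digit_weight al p.
Proof.
by move=> /andP[a0 a1]; rewrite /digit_weight; case: ifP => _; [|case: ifP => _]; move: a0 a1; clear; lra.
Qed.

(** The gap s between tau (1 - 4 dl) and gamma absorbs the window error E and twice
    the error eta r, because p stays below the constant P0. *)
Lemma small_primes_margin (R : realType) (al tau dl gamma s eta r u lp : R) (p P0 E D1 c : nat) :
  (0 < p)%N -> (p < P0)%N -> 0 <= al <= 1 ->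
  tau <= digit_weight al p * (p.-1)%:R * u / lp -> 0 < u -> 0 < lp ->
  0 <= dl -> 4 * dl < 1 -> tau * (1 - 4 * dl) = gamma + s ->
  4 * P0%:R * eta = s -> 0 < eta -> P0%:R * E%:R <= s / 2 * r -> 0 <= r -> D1%:R <= gamma * r ->
  (digit_weight al p - 2 * dl) * r * u / lp - eta * r - eta * r <= c%:R ->
  (D1 + p.-1 * E <= p.-1 * c)%N.
Proof.
move=> p0 pP0 hal ht u0 lp0 dl0 dl1 hs he eta0 hE r0 hD hc.
rewrite -(ler_nat R) natrD !natrM.
have w2 := digit_weight_ge p hal.
set W := digit_weight al p in ht hc w2.
have q0 : 0 <= (p.-1)%:R :> R by [].
have qP : (p.-1)%:R <= P0%:R :> R by rewrite ler_nat; apply: leq_trans (leq_pred _) (ltnW pP0).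
have E0 : 0 <= E%:R :> R by [].
pose B := (p.-1)%:R * u / lp.
have B0 : 0 <= B by rewrite /B divr_ge0 ?mulr_ge0 // ltW.
have WB : tau <= W * B by rewrite /B !mulrA.
have h1 : tau * (1 - 4 * dl) <= (W - 2 * dl) * B.
  apply: (@le_trans _ _ (W * B * (1 - 4 * dl))).
    by rewrite ler_wpM2r // subr_ge0 ltW.
  have -> : W * B * (1 - 4 * dl) = (W - 4 * (W * dl)) * B by ring.
  rewrite ler_wpM2r // lerD2l lerN2.
  by have := ler_wpM2r dl0 w2; clear; lra.
have h2 := ler_wpM2r r0 h1.
have h3 := ler_wpM2l q0 hc.
have e3 : (p.-1)%:R * ((W - 2 * dl) * r * u / lp - eta * r - eta * r) =
   (W - 2 * dl) * B * r - 2 * ((p.-1)%:R * (eta * r)) by rewrite /B; ring.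
rewrite e3 in h3.
have h4 : (p.-1)%:R * (eta * r) <= P0%:R * (eta * r).
  by apply: ler_wpM2r qP; rewrite mulr_ge0 // ltW.
have h5 : (p.-1)%:R * E%:R <= P0%:R * E%:R := ler_wpM2r E0 qP.
have h6 : 4 * (P0%:R * (eta * r)) = s * r by rewrite -he; ring.
rewrite hs in h2.
move: h2 h3 h4 h5 h6 hE hD; clear.
move: ((W - 2 * dl) * B) => x; lra.
Qed.

Lemma scaled_sum_bound x y z b s1 s2 s3 s4 u1 u2 u3 :
  (b <= y * s1 + z * s2 + s3 + s4)%N -> (x * s1 <= u1)%N -> (x * s2 <= u2)%N -> (x * s3 <= u3)%N ->
  (x * b <= y * u1 + z * u2 + u3 + x * s4)%N.
Proof.
move=> h h1 h2 h3; apply: leq_trans (leq_mul (leqnn x) h) _.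
rewrite !mulnDr leq_add2r; apply: leq_add => //.
by apply: leq_add; rewrite mulnCA leq_mul2l ?h1 ?h2 orbT.
Qed.

(** * Failures have density O(1/r) in dyadic blocks *)

(** [structured_summand] and [dyadic_bad_count] with v = r/d, and with Y about r^4
    and E about 8 log2 r so that all four kinds of failure are O(2^r / r). *)
Lemma dyadic_failure_bound (R : realType) (m : nat) (gamma : R) :
  (0 < m)%N -> 0 < gamma -> gamma < 3 * ln 2 / ln 12 ->
  exists (c : R) r0, forall r, (r0 <= r)%N ->
    (\sum_(i < 2 ^ r) (g m.+1 (2 ^ r + i) <
       (m * Num.truncn (gamma * r%:R))%N%:Z)%R)%N%:R * r%:R <= c * (2 ^ r)%:R.
Proof.
move=> m0 gam0 gamtau.
have [tau tauE] : exists tau : R, tau = 3 * ln 2 / ln 12 by exists (3 * ln 2 / ln 12).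
rewrite -tauE in gamtau.
have /andP[tau2 tau1] : 2^-1 < tau < 1 by rewrite tauE; exact: tau_bounds.
have [al alE] : exists al : R, al = 2 * tau - 1 by exists (2 * tau - 1).
have al0 : 0 < al by rewrite alE; move: tau2; clear; lra.
have al1 : 0 < 1 - al by rewrite alE; move: tau1; clear; lra.
have tg : 0 < tau - gamma by rewrite subr_gt0.
have [d [d1 dh]] : exists d, (1 < d)%N /\ [/\ d%:R^-1 < al, d%:R^-1 < 1 - al,
    4 * d%:R^-1 < 1 :> R & 4 * tau * d%:R^-1 < tau - gamma].
  have inv_lt (x : R) : 0 < x -> exists n, forall d, (n < d)%N -> d%:R^-1 < x.
    move=> x0; have [n [n0 hn]] := exists_nat_ge x^-1 0; exists n => d nd.
    rewrite -[x]invrK ltf_pV2 ?posrE ?invr_gt0 ?ltr0n ?(leq_trans _ nd) //.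
    by apply: (le_lt_trans hn); rewrite ltr_nat.
  have [n1 H1] := inv_lt _ al0; have [n2 H2] := inv_lt _ al1.
  have q4 : 0 < 4^-1 :> R by rewrite invr_gt0.
  have [n3 H3] := inv_lt _ q4.
  have q5 : 0 < (tau - gamma) / (4 * tau).
    by rewrite divr_gt0 // mulr_gt0 //; move: tau2; clear; lra.
  have [n4 H4] := inv_lt _ q5.
  exists (n1 + n2 + n3 + n4).+2; split => //; split.
  - by apply: H1; clear; lia.
  - by apply: H2; clear; lia.
  - have : (n1 + n2 + n3 + n4).+2%:R^-1 < 4^-1 :> R by apply: H3; clear; lia.
    by move: (_.+2%:R^-1) => x; clear; lra.
  - have : (n1 + n2 + n3 + n4).+2%:R^-1 < (tau - gamma) / (4 * tau) by apply: H4; clear; lia.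
    by rewrite ltr_pdivlMr ?[_ * (4 * tau)]mulrC // mulr_gt0 //; move: tau2; clear; lra.
have d0 := ltnW d1.
move: dh => [dal dal1 d4 d5].
have dl0 : 0 <= d%:R^-1 :> R by rewrite invr_ge0.
(* s is the room left below tau once the two ends of the scales are given up. *)
have [s sE] : exists s, tau * (1 - 4 * d%:R^-1) = gamma + s.
  by exists (tau * (1 - 4 * d%:R^-1) - gamma); rewrite [RHS]addrC subrK.
have s0 : 0 < s by move: sE d5; clear; lra.
have [l1 Hl1] := square_le_exp (41 * d).
(* P0 = 2^l0 separates small primes from medium ones. *)
have [l0 [l03 Hl0]] : exists l0, (3 <= l0)%N /\ forall l, (l0 <= l)%N -> (40 * d * l.+1 < 2 ^ l)%N.
  exists (l1 + 3)%N; split; first by rewrite leq_addl.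
  move=> l hl; apply: leq_trans (Hl1 l _); last by apply: leq_trans hl; rewrite leq_addr.
  by move: d0; rewrite -mulnn; clear; nia.
have [P0 P0E] : exists P0, P0 = (2 ^ l0)%N by exists (2 ^ l0)%N.
have P00 : (0 < P0)%N by rewrite P0E expn_gt0.
have P05 : (5 <= P0)%N.
  by rewrite P0E; apply: (@leq_trans (2 ^ 3)%N) => //; rewrite leq_exp2l.
have P0R : 0 < P0%:R :> R by rewrite ltr0n.
have [eta etaE] : exists eta : R, 4 * P0%:R * eta = s.
  exists (s / (4 * P0%:R)); rewrite mulrC divfK // gt_eqF // mulr_gt0 //.
have eta0 : 0 < eta.
  have h : 0 < 4 * P0%:R :> R by rewrite mulr_gt0.
  by rewrite -(pmulr_rgt0 _ h) etaE.
(* The error eta r per prime is multiplied by p - 1 < P0. *)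
have [r1 Hr1] := @structured_summand R P0 d al eta d0 dal dal1 eta0.
have [k [k0 hk]] := exists_nat_ge (16 * P0%:R / s) 0.
(* This gives v >= (681 + m) (t + 1)^2, which covers all lower bounds on v below. *)
have [t0 Ht0] := square_le_exp (d * (681 + m) + k).
pose c : R := 2 * (3 * m%:R + 2 * m%:R ^+ 2) + 6 * P0%:R * m%:R / eta ^+ 2.
exists c, (maxn r1 (2 ^ t0)) => r; rewrite geq_max => /andP[r1r tr].
have r0 : (0 < r)%N by apply: leq_trans tr; rewrite expn_gt0.
have rR : 0 < r%:R :> R by rewrite ltr0n.
have [A [A1 A2 A3]] := Hr1 r r1r.
have /andP[tlo thi] := trunc_log_bounds (isT : (1 < 2)%N) r0.
have tt0 : (t0 <= trunc_log 2 r)%N by apply: trunc_log_max.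
have := Ht0 _ tt0.
move: (trunc_log 2 r) tlo thi {tt0} => t tlo thi.
move=> ht; have {}ht : ((d * (681 + m) + k) * t.+1 ^ 2 <= r)%N by apply: leq_trans tlo.
have [v vE] : exists v, v = (r %/ d)%N by exists (r %/ d)%N.
rewrite -vE in A1 A2 A3.
have vbig : ((681 + m) * t.+1 ^ 2 <= v)%N.
  rewrite vE leq_divRL //; apply: leq_trans ht.
  by rewrite mulnC mulnA leq_mul2r leq_addr orbT.
have vmed : ((4 * t + 4) * (160 * t + 170) <= v)%N.
  by apply: leq_trans vbig; rewrite -mulnn; clear; nia.
have vm : (m <= v)%N.
  by apply: leq_trans vbig; rewrite -mulnn; clear; nia.
have v2 : (2 * v <= r)%N.
  apply: (@leq_trans (d * v)%N); first by rewrite leq_mul2r d1 orbT.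
  by rewrite vE mulnC leq_divM.
have vr : (v <= r)%N by apply: leq_trans v2; rewrite leq_pmull.
have vt : (8 * t + 9 <= v)%N by apply: leq_trans vmed; clear; nia.
have m2v : (m <= 2 ^ v)%N by apply: leq_trans vm (ltnW _); rewrite ltn_expl.
have mA : (m * A <= 2 ^ r)%N.
  apply: leq_trans (leq_mul m2v A2) _; rewrite -expnD leq_exp2l //.
  by move: vr; clear; lia.
have [D1 D1E] : exists D1, D1 = Num.truncn (gamma * r%:R) by exists (Num.truncn (gamma * r%:R)).
rewrite -D1E.
have D1R : D1%:R <= gamma * r%:R by rewrite D1E truncn_le mulr_ge0 // ltW.
have D1r : (D1 <= r)%N.
  rewrite -(ler_nat R); apply: (le_trans D1R).
  have g1 : gamma <= 1 by move: gamtau tau1; clear; lra.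
  by have := ler_wpM2r (ltW rR) g1; rewrite mul1r.
have mD : (m * D1 <= 2 ^ r)%N.
  apply: leq_trans (leq_mul m2v D1r) _.
  apply: leq_trans (leq_mul (leqnn _) (ltnW thi)) _; rewrite -expnD leq_exp2l //.
  by move: v2 vt; clear; lia.
have etr : 0 < eta * r%:R by rewrite mulr_gt0.
(* The mean number of carries at p that the structured summand guarantees. *)
pose mu p : R := (digit_weight al p - 2 * d%:R^-1) * r%:R * ln 2 / ln p%:R - eta * r%:R.
have Y0 : (0 < 2 ^ (4 * t + 4))%N by rewrite expn_gt0.
have F1 p : prime p -> (P0 <= p <= 2 ^ (4 * t + 4))%N ->
    [/\ (5 <= p)%N, (D1 + p.-1 * (8 * t + 8) <= p.-1 * (trunc_log p (2 ^ v) %/ 10))%N &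
        (8 ^ (16 * t + 17) <= 8 ^ (trunc_log p (2 ^ v) %/ 10))%N].
  move=> pp; rewrite {1}P0E => /andP[pl pY].
  have [h1 h2] := medium_primes_margin d0 Hl0 vE vmed D1r pp pl pY.
  by split => //; apply: (leq_trans P05); rewrite P0E.
have F2 p y : prime p -> (p < P0)%N -> (0 < y <= 2 ^ v)%N ->
    mu p <= \sum_(1 <= j < (trunc_log p (2 ^ (r - v))).+1) frac_div R (p ^ j) (A - y).
  move=> pp pP hy; have p1 := prime_gt1 pp.
  apply: (le_trans (A3 y p hy pp pP)).
  have X0 : (0 < 2 ^ (r - v))%N by rewrite expn_gt0.
  have w1 : (trunc_log p (2 ^ (r - v)) <= r)%N.
    rewrite -(@leq_exp2l 2) //; apply: (@leq_trans (p ^ trunc_log p (2 ^ (r - v)))%N).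
      exact: leq_exp_base.
    by apply: leq_trans (trunc_logP p1 X0) _; rewrite leq_exp2l // leq_subr.
  rewrite (@big_cat_nat _ _ _ (trunc_log p (2 ^ (r - v))).+1 1 r.+1) //= [X in _ + X]big1_seq ?addr0.
    by rewrite [leLHS]big_mkcond /=; apply: ler_sum => j _; case: ifP => // _; exact: frac_div_ge0.
  move=> j /andP[h1]; rewrite mem_index_iota => /andP[h2 _].
  suff : (j <= trunc_log p (2 ^ (r - v)))%N by rewrite leqNgt h2.
  exact: trunc_log_max.
have F3 p (cc : nat) : prime p -> (p < P0)%N -> mu p - eta * r%:R <= cc%:R ->
    (D1 + p.-1 * (8 * t + 8) <= p.-1 * cc)%N.
  move=> pp pP hc; have p1 := prime_gt1 pp.
  have ab : 0 <= al <= 1 by rewrite ltW //= -subr_ge0 ltW.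
  have ht' : tau <= digit_weight al p * (p.-1)%:R * ln 2 / ln p%:R.
    by rewrite alE tauE; exact: digit_weight_bound.
  have u0 : 0 < ln (2 : R) by exact: ln_nat_gt0.
  have lp := ln_nat_gt0 R p1.
  have hE : P0%:R * (8 * t + 8)%:R <= s / 2 * r%:R.
    have h1 : (k * t.+1 <= r)%N.
      apply: leq_trans ht; rewrite -mulnn; clear; nia.
    have h2 : k%:R * (t.+1)%:R <= r%:R :> R by rewrite -natrM ler_nat.
    have h3 : 16 * P0%:R <= k%:R * s by rewrite -ler_pdivrMr.
    have -> : ((8 * t + 8)%:R : R) = 8 * (t.+1)%:R by rewrite -natrM; congr (_%:R); clear; lia.
    have t1 : 0 <= (t.+1)%:R :> R by [].
    have h4 := ler_wpM2r t1 h3; have h5 := ler_wpM2l (ltW s0) h2.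
    by move: h4 h5; clear; move: (t.+1%:R) => x; lra.
  exact: (small_primes_margin (prime_gt0 pp) pP ab ht' u0 lp dl0 d4 sE etaE eta0 hE (ltW rR) D1R hc).
have [T3 [T4 [hT3 hT4 hT]]] := dyadic_bad_count m0 vr A1 mA mD Y0 etr F1 F2 F3.
move: hT; set BAD := (\sum_(i < 2 ^ r) _)%N => hT.
have dbl Q V : (0 < Q)%N -> (Q <= V)%N -> ((V %/ Q).+1 * Q <= 2 * V)%N.
  by move=> Q0 QV; rewrite mulSn; have := leq_divM V Q; move: QV; clear; lia.
have D1t : (D1 <= 2 ^ t.+1)%N by apply: leq_trans D1r (ltnW thi).
have Yt : ((2 ^ (4 * t + 4)).+1 <= 2 ^ (4 * t + 5))%N by rewrite ltn_exp2l //; clear; lia.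
have rt : (r.+2 <= 2 ^ (t + 2))%N.
  rewrite addn2 expnS; move: thi (expn_gt0 2 t.+1); clear; lia.
(* 2^t is of the order of r: each kind of failure, multiplied by 2^t, is at most a
   constant times the number 2^(r+v) of pairs. *)
have B1 : (2 ^ t * ((2 ^ (4 * t + 4)).+1 * (m * D1 * (2 ^ r %/ 2 ^ (8 * t + 8).+1).+1))
    <= 2 * (m * 2 ^ r))%N.
  have qX : (2 ^ (8 * t + 8).+1 <= 2 ^ r)%N.
    by rewrite leq_exp2l //; move: vt vr; clear; lia.
  have q0 : (0 < 2 ^ (8 * t + 8).+1)%N by rewrite expn_gt0.
  have := dbl _ _ q0 qX; move: (2 ^ r %/ _)%N => W hW.
  apply: (@leq_trans (2 ^ t * (2 ^ (4 * t + 5) * (m * 2 ^ t.+1 * W.+1))))%N.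
    by rewrite !leq_mul.
  have -> : (2 ^ t * (2 ^ (4 * t + 5) * (m * 2 ^ t.+1 * W.+1)) =
     m * (W.+1 * 2 ^ (t + (4 * t + 5) + t.+1)))%N.
    by rewrite !expnD; clear; lia.
  rewrite [leqRHS]mulnCA leq_mul2l; apply/orP; right; apply: leq_trans hW.
  by rewrite leq_mul2l leq_exp2l //; apply/orP; right; clear; lia.
have B2 : (2 ^ t * (m * D1 * (r.+2 * ((2 ^ v %/ 2 ^ (4 * t + 4)).+1 * (m * D1))))
    <= 2 * (m * m * 2 ^ v))%N.
  have YZ : (2 ^ (4 * t + 4) <= 2 ^ v)%N.
    by rewrite leq_exp2l //; move: vt; clear; lia.
  have := dbl _ _ Y0 YZ; move: (2 ^ v %/ _)%N => W hW.
  apply: (@leq_trans (2 ^ t * (m * 2 ^ t.+1 * (2 ^ (t + 2) * (W.+1 * (m * 2 ^ t.+1))))))%N.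
    by rewrite !leq_mul.
  have -> : (2 ^ t * (m * 2 ^ t.+1 * (2 ^ (t + 2) * (W.+1 * (m * 2 ^ t.+1)))) =
     m * m * (W.+1 * 2 ^ (t + t.+1 + (t + 2) + t.+1)))%N.
    by rewrite !expnD; clear; lia.
  rewrite [leqRHS]mulnCA leq_mul2l; apply/orP; right; apply: leq_trans hW.
  by rewrite leq_mul2l leq_exp2l //; apply/orP; right; clear; lia.
have B3 : (2 ^ t * T3 <= m * (2 ^ r * 2 ^ v))%N.
  have h1 : (2 ^ (4 * t + 7) * (2 ^ t * T3) <= 8 ^ (16 * t + 17) * T3)%N.
    rewrite mulnA leq_mul2r -expnD -[8%N]/(2 ^ 3)%N -expnM leq_exp2l //; apply/orP; right.
    by clear; lia.
  have h2 : ((2 ^ (4 * t + 4)).+1 * (m * (4 * (2 ^ r * 2 ^ v))) <=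
     2 ^ (4 * t + 7) * (m * (2 ^ r * 2 ^ v)))%N.
    apply: leq_trans (leq_mul Yt (leqnn _)) _.
    have -> : (2 ^ (4 * t + 7) = 2 ^ (4 * t + 5) * 4)%N by rewrite -[4%N]/(2 ^ 2)%N -expnD -addnA.
    by move: (2 ^ (4 * t + 5))%N (2 ^ r * 2 ^ v)%N => x y; clear; lia.
  have q0 : (0 < 2 ^ (4 * t + 7))%N by rewrite expn_gt0.
  by rewrite -(leq_pmul2l q0); apply: leq_trans h1 (leq_trans hT3 h2).
have XR : 0 < (2 ^ r)%:R :> R by rewrite ltr0n expn_gt0.
have ZR : 0 < (2 ^ v)%:R :> R by rewrite ltr0n expn_gt0.
have tR : 0 < (2 ^ t)%:R :> R by rewrite ltr0n expn_gt0.
have rt2 : r%:R <= 2 * (2 ^ t)%:R :> R.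
  by rewrite -natrM ler_nat -expnS ltnW.
have hsum : (2 ^ t)%:R * ((2 ^ v)%:R * BAD%:R) <=
   (3 * m%:R + 2 * m%:R ^+ 2) * ((2 ^ r)%:R * (2 ^ v)%:R) + (2 ^ t)%:R * T4%:R :> R.
  have h : (2 ^ t * (2 ^ v * BAD) <=
     2 ^ v * (2 * (m * 2 ^ r)) + 2 ^ r * (2 * (m * m * 2 ^ v)) + m * (2 ^ r * 2 ^ v) + 2 ^ t * T4)%N.
    exact: (scaled_sum_bound hT B1 B2 B3).
  move: h; rewrite -(ler_nat R) !natrD !natrM => h; apply: (le_trans h).
  by rewrite le_eqVlt; apply/orP; left; apply/eqP; ring.
have eta2 : 0 < eta ^+ 2 by rewrite exprn_gt0.
have h4 : r%:R * T4%:R <= 6 * P0%:R * m%:R / eta ^+ 2 * ((2 ^ r)%:R * (2 ^ v)%:R).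
  rewrite mulrAC ler_pdivlMr // -(ler_pM2l rR).
  move: hT4; rewrite !natrM => h.
  have -> : r%:R * (r%:R * T4%:R * eta ^+ 2) = (eta * r%:R) ^+ 2 * T4%:R :> R by ring.
  apply: (le_trans h); rewrite le_eqVlt; apply/orP; left; apply/eqP; ring.
have K0 : 0 <= (3 * m%:R + 2 * m%:R ^+ 2) * ((2 ^ r)%:R * (2 ^ v)%:R) :> R.
  by rewrite !mulr_ge0 // addr_ge0 ?mulr_ge0 ?exprn_ge0.
have h5 : r%:R * ((2 ^ v)%:R * BAD%:R) <= 2 * ((3 * m%:R + 2 * m%:R ^+ 2) * ((2 ^ r)%:R * (2 ^ v)%:R))
   + r%:R * T4%:R :> R.
  rewrite -(ler_pM2l tR).
  have a1 := ler_wpM2l (ltW rR) hsum; have a2 := ler_wpM2r K0 rt2.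
  move: a1 a2; move: ((3 * m%:R + 2 * m%:R ^+ 2) * ((2 ^ r)%:R * (2 ^ v)%:R)) => K.
  by move: ((2 ^ t)%:R) ((2 ^ v)%:R * BAD%:R) (r%:R) (T4%:R) => x1 x2 x3 x4; clear; lra.
rewrite -(ler_pM2l ZR).
have -> : (2 ^ v)%:R * (BAD%:R * r%:R) = r%:R * ((2 ^ v)%:R * BAD%:R) :> R by ring.
apply: (le_trans h5); rewrite /c.
have -> : (2 ^ v)%:R * ((2 * (3 * m%:R + 2 * m%:R ^+ 2) + 6 * P0%:R * m%:R / eta ^+ 2) * (2 ^ r)%:R) =
  2 * ((3 * m%:R + 2 * m%:R ^+ 2) * ((2 ^ r)%:R * (2 ^ v)%:R)) +
  6 * P0%:R * m%:R / eta ^+ 2 * ((2 ^ r)%:R * (2 ^ v)%:R) :> R by ring.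
by rewrite lerD2l.
Qed.

(** * From dyadic blocks to density zero *)

Lemma count_dyadic_block (P : pred nat) r :
  count P (index_iota 1 (2 ^ r.+1)) =
  (count P (index_iota 1 (2 ^ r)) + \sum_(i < 2 ^ r) P (2 ^ r + i))%N.
Proof.
have x0 : (0 < 2 ^ r)%N by rewrite expn_gt0.
rewrite -!sum1_count expnS mul2n -addnn (@big_cat_nat _ _ _ (2 ^ r)) //=; last by rewrite leq_addr.
congr (_ + _)%N; rewrite -{1}[(2 ^ r)%N]addn0 addnC big_addn addnK big_mkord big_mkcond /=.
by apply: eq_bigr => i _; rewrite addnC; case: (P _).
Qed.

(** A block [2^r, 2^(r+1)) with proportion e/4 of failures adds e/4 * 2^r to a count
    bounded by e/4 * 2^r plus a constant: the bound doubles with the block. *)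
Lemma density_of_dyadic (R : realType) (P : pred nat) :
  (forall e : R, 0 < e -> exists r1, forall r, (r1 <= r)%N ->
     (\sum_(i < 2 ^ r) P (2 ^ r + i)%N)%N%:R <= e * (2 ^ r)%:R) ->
  forall e : R, 0 < e -> exists N0, forall N, (N0 <= N)%N ->
     (count P (index_iota 1 N.+1))%:R <= e * N%:R.
Proof.
move=> H e e0; have e4 : 0 < e / 4 by rewrite divr_gt0.
have [r1 hr] := H _ e4.
have size_le n : (count P (index_iota 1 n) <= n)%N.
  by apply: leq_trans (count_size _ _) _; rewrite size_iota leq_subr.
have main L : (count P (index_iota 1 (2 ^ L)))%:R <= (2 ^ r1)%:R + e / 4 * (2 ^ L)%:R.
  elim: L => [|L IH].
    by rewrite expn0 /= addr_ge0 // mulr_ge0 // ltW.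
  have [lr|rl] := ltnP L r1.
    apply: (@le_trans _ _ (2 ^ r1)%:R); last by rewrite lerDl mulr_ge0 // ltW.
    by rewrite ler_nat; apply: leq_trans (size_le _) _; rewrite leq_exp2l.
  rewrite count_dyadic_block natrD.
  have := hr _ rl; rewrite expnS natrM.
  by move: IH; move: (count _ _)%:R (\sum_(i < _) _)%N%:R => x y; clear; lra.
have [N0 [N00 hN]] := exists_nat_ge (2 * (2 ^ r1)%:R / e) 0.
exists N0 => N NN.
have N1 : (0 < N)%N by apply: leq_trans NN.
have /andP[lo hi] := trunc_log_bounds (isT : (1 < 2)%N) N1.
have sub : (count P (index_iota 1 N.+1) <= count P (index_iota 1 (2 ^ (trunc_log 2 N).+1)))%N.
  rewrite -!sum1_count [leqRHS](@big_cat_nat _ _ _ N.+1) //=; exact: leq_addr.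
have h1 : (2 ^ (trunc_log 2 N).+1)%:R <= 2 * N%:R :> R.
  by rewrite -natrM ler_nat expnS leq_mul2l lo.
have h2 : 2 * (2 ^ r1)%:R <= N%:R * e.
  by rewrite -ler_pdivrMr //; apply: (le_trans hN); rewrite ler_nat.
have h3 := ler_wpM2l (ltW e4) h1.
have h4 : (count P (index_iota 1 N.+1))%:R <= (count P (index_iota 1 (2 ^ (trunc_log 2 N).+1)))%:R :> R.
  by rewrite ler_nat.
have := main (trunc_log 2 N).+1.
by move: h2 h3 h4; move: (count _ _)%:R (count _ _)%:R (e / 4 * _) => x y z; clear; lra.
Qed.

(** On the block of 2^r one has ln n <= (r + 1) ln 2, so c ln n is below m gamma r
    - m for large r as soon as gamma > c ln 2 / m. *)
Lemma small_excess_rare_in_blocks (R : realType) (m : nat) (c : R) : (0 < m)%N -> c < 3 * m%:R / ln 12 ->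
  forall e : R, 0 < e -> exists r1, forall r, (r1 <= r)%N ->
     (\sum_(i < 2 ^ r) ((g m.+1 (2 ^ r + i))%:~R < c * ln (2 ^ r + i)%:R :> R)%R)%N%:R <= e * (2 ^ r)%:R.
Proof.
move=> m0 hc e e0.
have mR : 0 < m%:R :> R by rewrite ltr0n.
have u0 : 0 < ln (2 : R) by exact: ln_nat_gt0.
have [tau tauE] : exists tau : R, tau = 3 * ln 2 / ln 12 by exists (3 * ln 2 / ln 12).
have tau0 : 0 < tau by rewrite tauE divr_gt0 ?mulr_gt0 //; exact: ln_nat_gt0.
have cm : c * ln 2 / m%:R < tau.
  rewrite ltr_pdivrMr //.
  have -> : tau * m%:R = 3 * m%:R / ln 12 * ln 2 by rewrite tauE; ring.
  by rewrite ltr_pM2r.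
(* The maximum with 0 serves negative c. *)
have [b [b0 bc bt]] : exists b, [/\ 0 <= b, c * ln 2 <= m%:R * b & b < tau].
  exists (Num.max (c * ln 2 / m%:R) 0); split; first by rewrite le_max lexx orbT.
    by rewrite [leRHS]mulrC -ler_pdivrMr // le_max lexx.
  by rewrite gt_max cm.
have [gam gamE] : exists gam, gam = (b + tau) / 2 by exists ((b + tau) / 2).
have gb : b < gam by rewrite gamE; move: bt; clear; lra.
have gt : gam < tau by rewrite gamE; move: bt; clear; lra.
have gam0 : 0 < gam by apply: le_lt_trans gb.
have gt' : gam < 3 * ln 2 / ln 12 by rewrite -tauE.
have [C [r0 H]] := dyadic_failure_bound m0 gam0 gt'.
have [n1 [_ hn1]] := exists_nat_ge (C / e) 0.
have [n2 [_ hn2]] := exists_nat_ge ((b + 1) / (gam - b)) 0.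
exists (r0 + n1 + n2).+1 => r hr.
have rr0 : (r0 <= r)%N by move: hr; clear; lia.
have rR : 0 < r%:R :> R by rewrite ltr0n; move: hr; clear; lia.
have rn1 : n1%:R <= r%:R :> R by rewrite ler_nat; move: hr; clear; lia.
have rn2 : n2%:R <= r%:R :> R by rewrite ler_nat; move: hr; clear; lia.
have hC : C <= e * r%:R by rewrite [leRHS]mulrC -ler_pdivrMr // (le_trans hn1).
have hb : b * (r%:R + 1) <= gam * r%:R - 1.
  have : b + 1 <= r%:R * (gam - b) by rewrite -ler_pdivrMr ?subr_gt0 // (le_trans hn2).
  by clear; lra.
rewrite -(ler_pM2r rR); apply: (@le_trans _ _ (C * (2 ^ r)%:R)); last first.
  by rewrite mulrAC ler_wpM2r.
apply: le_trans (H r rr0); rewrite ler_wpM2r // ler_nat.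
apply: leq_sum => i _; case: ltP => // hg; rewrite lt0b.
rewrite -(ltr_int R) -pmulrn natrM; apply: (lt_le_trans hg).
have n0 : (0 < 2 ^ r + i)%N by rewrite addn_gt0 expn_gt0.
have lnn : ln (2 ^ r + i)%:R <= (r%:R + 1) * ln 2 :> R.
  have -> : (r%:R + 1) * ln 2 = ln (2 ^ r.+1)%N%:R :> R by rewrite ln_natX // natr1.
  by apply: ler_ln_nat => //; rewrite expnS mul2n -addnn leq_add2l ltnW.
have ln0 : 0 <= ln (2 ^ r + i)%:R :> R by rewrite ln_ge0 // ler1n.
have tr : gam * r%:R - 1 <= (Num.truncn (gam * r%:R))%:R.
  by rewrite lerBlDr natr1 ltW // truncnS_gt.
apply: (@le_trans _ _ (m%:R * (b * (r%:R + 1)))); last first.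
  by rewrite ler_pM2l // (le_trans hb).
rewrite -(ler_pM2r u0) mulrAC.
apply: (le_trans (ler_wpM2r ln0 bc)).
rewrite -!mulrA ler_pM2l // ler_wpM2l //.
Qed.

Lemma small_excess_rare (R : realType) (m : nat) (c : R) : (0 < m)%N -> c < 3 * m%:R / ln 12 ->
  forall e : R, 0 < e -> exists N0, forall N, (N0 <= N)%N ->
  (count (fun n => (g m.+1 n)%:~R < c * ln n%:R :> R) (index_iota 1 N.+1))%:R <= e * N%:R.
Proof.
by move=> m0 hc; apply: density_of_dyadic; exact: small_excess_rare_in_blocks.
Qed.

Theorem theorem1p1 (R : realType) (k : nat) (hk : (2 <= k)%N) :
  (forall eps : R, 0 < eps ->
     (fun x : R =>
        (count_upto (fun n => (g k n)%:~R <
                       (3 * (k%:R - 1) / ln 12 - eps) * ln n%:R) x)%:R : R)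
       =o_ (+oo_R) (fun x : R => x)) /\
  (forall c : R, c < 3 * (k%:R - 1) / ln 12 ->
     almost_all R (fun n => c * ln n%:R <= (g k n)%:~R)).
Proof.
case: k hk => // m; rewrite ltnS => m0; rewrite -[m.+1%:R]natr1 addrK.
split=> [eps eps0 | c hc].
  have /(small_excess_rare m0) H : 3 * m%:R / ln 12 - eps < 3 * m%:R / ln 12 by rewrite gtrBl.
  apply/eqoP => e e0; have [N0 hN] := H _ e0.
  near=> x; have x1 : N0.+1%:R <= x by near: x; exact: nbhs_pinfty_ge.
  have x0 : 0 <= x by apply: le_trans x1.
  rewrite /count_upto ger0_norm // (ger0_norm x0).
  apply: le_trans (hN _ _) _.
    by rewrite truncn_ge_nat // (le_trans _ x1) // ler_nat.
  by rewrite ler_pM2l // truncn_le.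
apply/cvgrPdist_le => e e0; have [N0 hN] := small_excess_rare m0 hc e0.
exists N0.+1 => //= N /= NN.
have N1 : 0 < N%:R :> R by rewrite ltr0n (leq_trans _ NN).
rewrite sub0r normrN ger0_norm ?divr_ge0 // ler_pdivrMr //.
apply: le_trans (hN N (ltnW NN)); rewrite ler_nat.
by apply: sub_count => n /=; rewrite ltNge.
Unshelve. all: by end_near.
Qed.
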